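(* Let $d>0$, let $K\subset\mathbb{C}$ be a compact $d$-set, and let $f$ be a subharmonic function defined in an open neighbourhood of $K$. Then the restriction $f|_K$ belongs to $BMO(K,\mathcal{H}^d)$.
   Context: $\mathbb{D}(x,t)=\{z\in\mathbb{C}:|z-x|<t\}$; $\mathcal{H}^d$ is the $d$-dimensional Hausdorff measure. A compact set $K\subset\mathbb{C}$ is a $d$-set if there are constants $a,b>0$ with $b t^d\le\mathcal{H}^d(K\cap\mathbb{D}(x,t))\le a t^d$ for all $x\in K$ and $0<t\le\operatorname{diam}(K)$. For a complete metric space $X$ with a regular Borel measure $\mu$, a locally integrable function $f$ on $X$ belongs to $BMO(X,\mu)$ if $$|f|_*:=\sup_B\frac{1}{\mu(B)}\int_B|f-f_B|\,d\mu<\infty,\qquad f_B=\frac1{\mu(B)}\int_B f\,d\mu,$$ the supremum being over all metric balls $B\subset X$. Here $K$ carries the Euclidean metric. Subharmonic functions take values in $[-\infty,\infty)$ and, by the usual convention, are not identically $-\infty$ on any connected component of their domain. *)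

(* Defs.v *)
From HB Require Import structures.
From mathcomp Require Import all_boot all_order all_algebra.
From mathcomp Require Import all_classical all_reals all_analysis.
From mathcomp Require Import complex.

Set Implicit Arguments.
Unset Strict Implicit.
Unset Printing Implicit Defensive.

Import Order.TTheory GRing.Theory Num.Theory.
Import numFieldTopology.Exports numFieldNormedType.Exports.
Import Normc.

Local Open Scope classical_set_scope.
Local Open Scope ring_scope.
Local Open Scope complex_scope.

(* R[i] is only a numClosedFieldType in the library; give it the topology of
   its modulus. *)
HB.instance Definition _ (R : realType) := NormedModule.copy R[i] R[i]^o.

Definition borelC (R : realType) := g_sigma_algebraType (@open R[i]).
HB.instance Definition _ (R : realType) := Measurable.on (borelC R).

Section plane.
Context {R : realType}.
Implicit Types (A B X : set R[i]) (x z : R[i]) (d e t r : R).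

Definition disk x t : set R[i] := [set z | normc (z - x) < t].

Definition cdisk x t : set R[i] := [set z | normc (z - x) <= t].

Definition diam A : \bar R :=
  maxe 0%E (ereal_sup [set (normc (x - y))%:E | x in A & y in A]).

Lemma diskE x t : disk x t = ball x t%:C.
Proof.
apply/seteqP; split => z; rewrite /disk -ball_normE /= ltcE /= eqxx /=;
  by rewrite -normcN opprB.
Qed.

Local Open Scope ereal_scope.

(* No normalising constant: the d-set condition (up to the choice of a and b)
   and the BMO seminorm do not change when the measure is multiplied by a
   positive constant. The empty set has gauge 0 for every d, so that hausdorff
   is an outer measure without any hypothesis on d. *)
Definition hgauge d A : \bar R :=
  if A == set0 then 0 else poweR (diam A) d.

Definition hausdorff_cover e A : set (set R[i])^nat :=
  [set F | (forall i, diam (F i) <= e%:E) /\ A `<=` \bigcup_i F i].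

Definition hausdorff_content d e A : \bar R :=
  ereal_inf [set \sum_(i <oo) hgauge d (F i) | F in hausdorff_cover e A].

Definition hausdorff d A : \bar R :=
  ereal_sup [set hausdorff_content d e A | e in [set e : R | (0 < e)%R]].

Lemma hgauge0 d : hgauge d set0 = 0.
Proof. by rewrite /hgauge eqxx. Qed.

Lemma hgauge_ge0 d A : 0 <= hgauge d A.
Proof. by rewrite /hgauge; case: ifP => // _; exact: poweR_ge0. Qed.
Local Hint Resolve hgauge0 hgauge_ge0 : core.

Lemma diam0 : diam set0 = 0.
Proof.
rewrite /diam (_ : [set _ | _ in _ & _ in _] = set0) ?ereal_sup0 ?maxeNy//.
by rewrite predeqE => y; split => // -[].
Qed.

Lemma hausdorff_content_ge0 d e A : 0 <= hausdorff_content d e A.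
Proof. by apply: le_ereal_inf_tmp => _ [F _ <-]; exact: nneseries_ge0. Qed.

Lemma hausdorff_content0 d e : (0 < e)%R -> hausdorff_content d e set0 = 0.
Proof.
move=> e0; apply/eqP; rewrite eq_le hausdorff_content_ge0 andbT.
apply: ereal_inf_lbound; exists (fun=> set0).
  by split => [i|//]; rewrite diam0 lee_fin ltW.
by rewrite eseries0.
Qed.

Lemma le_hausdorff_content d e : {homo hausdorff_content d e : A B / A `<=` B >-> A <= B}.
Proof.
move=> A B AB; apply/ereal_inf_le_tmp => _ [F [dF BF] <-].
by exists F => //; split => //; exact: subset_trans BF.
Qed.

Lemma hausdorff_content_sigma_subadditive d e :
  sigma_subadditive (hausdorff_content d e).
Proof.
set mu := hausdorff_content d e.
move=> A; have [[i ioo]|] := pselect (exists i, mu (A i) = +oo).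
  rewrite (eseries_pinfty _ _ ioo) ?leey// => n _.
  by rewrite -ltNye (lt_le_trans _ (hausdorff_content_ge0 _ _ _)).
rewrite -forallNE => Aoo.
suff add2e (u : {posnum R}) :
    mu (\bigcup_n A n) <= \sum_(i <oo) mu (A i) + u%:num%:E.
  by apply/lee_addgt0Pr => _/posnumP[].
rewrite (le_trans _ (epsilon_trick _ _ _))//; last first.
  by move=> n; exact: hausdorff_content_ge0.
pose P n (B : (set R[i])^nat) := hausdorff_cover e (A n) B /\
  \sum_(k <oo) hgauge d (B k) <= mu (A n) + (u%:num / (2 ^ n.+1)%:R)%:E.
have [G PG] : {G : ((set R[i])^nat)^nat & forall n, P n (G n)}.
  apply: (@choice _ _ P) => n; rewrite /P.
  have muf : mu (A n) \is a fin_num.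
    rewrite ge0_fin_numE; last exact: hausdorff_content_ge0.
    by rewrite ltey; apply/eqP/Aoo.
  have en1 : (0 < u%:num / (2 ^ n.+1)%:R)%R by [].
  have [_ [B AnB <-] muBx] := lb_ereal_inf_adherent en1 muf.
  by exists B; split => //; exact/ltW.
have muG_ge0 (x : nat * nat) : 0 <= (hgauge d \o uncurry G) x by exact: hgauge_ge0.
apply: (@le_trans _ _ (\esum_(i in setT) (hgauge d \o uncurry G) i)).
  apply: ereal_inf_lbound => /=.
  have /card_esym/ppcard_eqP[f] := card_nat2.
  exists (uncurry G \o f).
    split => [i|].
      rewrite /= /uncurry; case: (f i) => a b; exact: (PG a).1.1.
    apply: (@subset_trans _  (\bigcup_n \bigcup_k G n k)) => [t [i _]|].
      by move=> /((PG i).1.2) -[j _ ?]; exists i => //; exists j.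
    move=> t [i _ [j _ Bijt]]; exists (f^-1%FUN (i, j)) => //=.
    by rewrite invK ?inE.
  rewrite -(esum_pred_image (hgauge d \o uncurry G) _ xpredT) ?[fun=> _]set_true//.
  by rewrite image_eq.
rewrite (_ : esum _ _ = \sum_(i <oo) \sum_(j <oo ) hgauge d (G i j)); last first.
  pose J : nat -> set (nat * nat) := fun i => [set (i, j) | j in setT].
  rewrite (_ : setT = \bigcup_k J k); last first.
    by rewrite predeqE => -[a b]; split => // _; exists a => //; exists b.
  rewrite esum_bigcupT /=; last 2 first.
    - apply/trivIsetP => i j _ _ ij.
      rewrite predeqE => -[n m] /=; split => //= -[] [_] _ [<-{n} _].
      by move=> [m' _] [] /esym/eqP; rewrite (negbTE ij).
    - by move=> /= [n m]; exact: hgauge_ge0.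
  rewrite -(image_id [set: nat]) -fun_true esum_pred_image//; last first.
    by move=> n _; exact: esum_ge0.
  apply: eq_eseriesr => /= j _.
  rewrite -(esum_pred_image (hgauge d \o uncurry G) (pair j) predT)//=; last first.
    by move=> ? ? _ _; exact: (@can_inj _ _ _ snd).
  by congr esum; rewrite predeqE => -[a b]; split; move=> [i _ <-]; exists i.
apply: lee_nneseries => [n _ _|n _]; first by exact: nneseries_ge0.
exact: (PG n).2.
Qed.

Lemma hausdorff0 d : hausdorff d set0 = 0.
Proof.
rewrite /hausdorff (_ : [set _ | _ in _] = [set 0]) ?ereal_sup1//.
rewrite predeqE => y; split => [[e e0 <-]|->]; first exact: hausdorff_content0.
by exists 1%R; [exact: ltr01|exact/hausdorff_content0/ltr01].
Qed.

Lemma hausdorff_ge0 d A : 0 <= hausdorff d A.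
Proof.
apply: (le_trans (hausdorff_content_ge0 d 1 A)).
by apply: ereal_sup_ubound; exists 1%R => //; exact: ltr01.
Qed.

Lemma le_hausdorff d : {homo hausdorff d : A B / A `<=` B >-> A <= B}.
Proof.
move=> A B AB; apply: ge_ereal_sup => _ [e e0 <-].
apply: (le_trans (le_hausdorff_content d e AB)).
by apply: ereal_sup_ubound; exists e.
Qed.

Lemma hausdorff_sigma_subadditive d : sigma_subadditive (hausdorff d).
Proof.
move=> F; apply: ge_ereal_sup => _ [e e0 <-].
apply: (le_trans (hausdorff_content_sigma_subadditive d e F)).
apply: lee_nneseries => [n _ _|n _]; first exact: hausdorff_content_ge0.
by apply: ereal_sup_ubound; exists e.
Qed.

HB.instance Definition _ d := isOuterMeasure.Build R R[i] (hausdorff d)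
  (hausdorff0 d) (hausdorff_ge0 d) (@le_hausdorff d)
  (@hausdorff_sigma_subadditive d).

Lemma diam_le A x y : A x -> A y -> (normc (x - y))%:E <= diam A.
Proof.
move=> Ax Ay; rewrite /diam le_max; apply/orP; right.
by apply: ereal_sup_ubound; exists x => //; exists y.
Qed.

Definition separated_by e A B := forall x y, A x -> B y -> (e <= normc (x - y))%R.

Lemma hausdorff_content_monoe d e e' A : (e <= e')%R ->
  hausdorff_content d e' A <= hausdorff_content d e A.
Proof.
move=> ee'; apply/ereal_inf_le_tmp => _ [F [dF AF] <-].
by exists F => //; split => // i; apply: (le_trans (dF i)); rewrite lee_fin.
Qed.

(* No set of a cover of mesh e < e' meets both A and B. *)
Lemma hausdorff_content_sep d e e' A B : (0 < e < e')%R -> separated_by e' A B ->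
  hausdorff_content d e A + hausdorff_content d e B <=
  hausdorff_content d e (A `|` B).
Proof.
move=> /andP[e0 ee'] sAB; apply: le_ereal_inf_tmp => _ [F [dF ABF] <-].
pose G (C : set R[i]) i := if pselect (F i `&` C !=set0) then F i else set0.
have GC C : C `<=` A `|` B -> hausdorff_cover e C (G C).
  move=> CAB; split => [i|x Cx].
    by rewrite /G; case: pselect => ? //=; rewrite diam0 lee_fin ltW.
  have [i _ Fix] := ABF _ (CAB _ Cx); exists i => //.
  by rewrite /G; case: pselect => [?|[]] //=; exists x.
have inf C : C `<=` A `|` B ->
    hausdorff_content d e C <= \sum_(i <oo) hgauge d (G C i).
  by move=> CAB; apply: ereal_inf_lbound; exists (G C) => //; exact: GC.
apply: (le_trans (leeD (inf A (@subsetUl _ _ _)) (inf B (@subsetUr _ _ _)))).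
rewrite -nneseriesD//; apply: lee_nneseries => [n _ _|n _].
  by rewrite adde_ge0.
rewrite {1 2}/G.
case: pselect => [FA|?]; case: pselect => [FB|?] /=;
  rewrite ?hgauge0 ?adde0 ?add0e//.
have [x [Fx Ax]] := FA; have [y [Fy By]] := FB.
have := diam_le Fx Fy; move/le_trans => /(_ _ (dF n)).
by rewrite lee_fin => /(le_trans (sAB _ _ Ax By)); rewrite leNgt ee'.
Qed.

Lemma hausdorff_sep d e A B : (0 < e)%R -> separated_by e A B ->
  hausdorff d A + hausdorff d B <= hausdorff d (A `|` B).
Proof.
move=> e0 sAB.
have key (u v : R) : (0 < u)%R -> (0 < v)%R ->
    hausdorff_content d u A + hausdorff_content d v B <= hausdorff d (A `|` B).
  move=> u0 v0; pose w := (Num.min (Num.min u v) (e / 2))%R.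
  have w0 : (0 < w)%R by rewrite !lt_min u0 v0 divr_gt0.
  have we : (w < e)%R.
    by apply: (@le_lt_trans _ _ (e / 2)%R); rewrite ?ge_min ?lexx ?orbT// gtr_pMr// invf_lt1 ?ltr1n.
  have wu : (w <= u)%R by rewrite !ge_min lexx.
  have wv : (w <= v)%R by rewrite !ge_min lexx ?orbT.
  apply: (le_trans (leeD (hausdorff_content_monoe d A wu) (hausdorff_content_monoe d B wv))).
  apply: (le_trans (hausdorff_content_sep _ _ sAB)); first by rewrite w0.
  by apply: ereal_sup_ubound; exists w.
have [->|Hoo] := eqVneq (hausdorff d (A `|` B)) +oo; first by rewrite leey.
have Hf : hausdorff d (A `|` B) \is a fin_num.
  by rewrite ge0_fin_numE ?ltey// hausdorff_ge0.
have fA u : (0 < u)%R -> hausdorff_content d u A \is a fin_num.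
  move=> u0; rewrite ge0_fin_numE ?hausdorff_content_ge0//.
  have := key u u u0 u0; rewrite -(fineK Hf) => h.
  apply: (le_lt_trans _ (ltry (fine (hausdorff d (A `|` B))))).
  by apply: le_trans h; rewrite leeDl// hausdorff_content_ge0.
have Bf : hausdorff d B \is a fin_num.
  by rewrite ge0_fin_numE ?hausdorff_ge0//; apply: (le_lt_trans (le_hausdorff _ (@subsetUr _ A B))); rewrite ltey.
rewrite -leeBrDr//; apply: ge_ereal_sup => _ [u u0 <-].
rewrite leeBrDr// addeC -leeBrDr ?fA//; apply: ge_ereal_sup => _ [v v0 <-].
by rewrite leeBrDr ?fA// addeC; exact: key.
Qed.

Lemma normc_dist_triangle (x y z : R[i]) :
  (normc (x - z) <= normc (x - y) + normc (y - z))%R.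
Proof. by have := @le_normcD R (x - y)%R (y - z)%R; rewrite addrA subrK. Qed.

(* hausdorff d is a metric outer measure, hence Borel sets are measurable: X is
   cut into the layers D n of points at distance in [1/(n+2), 1/(n+1)) of F. *)
Section caratheodory_criterion.
Variables (d : R) (F X : set R[i]).
Hypothesis Xoo : hausdorff d X != +oo.
Let H := hausdorff d.
Let h (n : nat) : R := (n.+1%:R^-1)%R.
Let S n := [set x | X x /\ forall y, F y -> (h n <= normc (x - y))%R].
Let D n := S n.+1 `\` S n.

Let h_gt0 n : (0 < h n)%R. Proof. by rewrite invr_gt0. Qed.
Let le_h n m : (n <= m)%N -> (h m <= h n)%R.
Proof. by move=> nm; rewrite lef_pV2 ?posrE// ler_nat ltnS. Qed.
Let lt_h n : (h n.+1 < h n)%R.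
Proof. by rewrite ltf_pV2 ?posrE// ltr_nat. Qed.

Let S_mono n m : (n <= m)%N -> S n `<=` S m.
Proof.
move=> nm x [Xx Sx]; split => // y Fy.
exact: (le_trans (le_h nm) (Sx _ Fy)).
Qed.

Let sepS n x y : S n x -> X y -> ~ S n.+1 y ->
  (h n - h n.+1 <= normc (x - y))%R.
Proof.
move=> [Xx Sx] Xy nSy.
have [z Fz yz] : exists2 z, F z & (normc (y - z) < h n.+1)%R.
  apply: contrapT => nex; apply: nSy; split => // z Fz.
  by rewrite leNgt; apply/negP => yz; apply: nex; exists z.
rewrite lerBlDr; apply: (le_trans (Sx _ Fz)).
apply: (le_trans (normc_dist_triangle x y z)).
by rewrite lerD2l ltW.
Qed.

Let sumD (b : nat) n :
  \sum_(i < n) H (D (b + i.*2).+1) <= H (S (b + n.*2)%N).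
Proof.
elim: n => [|n IH]; first by rewrite big_ord0 hausdorff_ge0.
rewrite big_ord_recr/=; apply: (le_trans (leeD2r _ IH)).
have hh : (0 < h (b + n.*2)%N - h (b + n.*2).+1)%R by rewrite subr_gt0 lt_h.
have sep : separated_by (h (b + n.*2)%N - h (b + n.*2).+1)
     (S (b + n.*2)%N) (D (b + n.*2).+1).
  by move=> x y Sx [Sy nSy]; apply: sepS => //; exact: Sy.1.
apply: (le_trans (hausdorff_sep d hh sep)).
apply: le_hausdorff; rewrite doubleS !addnS subUset; split.
  by apply: S_mono; rewrite -addn2 leq_addr.
by move=> x [].
Qed.

Let sumDX n : \sum_(0 <= i < n) H (D i.+1) <= H X + H X.
Proof.
have SX m : H (S m) <= H X by apply: le_hausdorff => x [].
apply: (@le_trans _ _ (\sum_(0 <= i < n.*2) H (D i.+1))).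
  apply: lee_sum_nneg_natr => [i _ _|]; first exact: hausdorff_ge0.
  by rewrite -addnn leq_addr.
apply: (le_trans _ (leeD (le_trans (sumD 0 n) (SX _))
                         (le_trans (sumD 1 n) (SX _)))).
rewrite le_eqVlt; apply/orP; left; apply/eqP.
elim: n => [|n IH]; first by rewrite !big_ord0 big_geq// adde0.
by rewrite doubleS !big_nat_recr//= !big_ord_recr/= IH add0n add1n -!addeA;
  congr (_ + _); rewrite addeCA.
Qed.

Hypothesis Fclosed : forall x, ~ F x ->
  exists2 e : R, (0 < e)%R & forall y, F y -> (e <= normc (x - y))%R.

Let cover_off n : X `&` ~` F `<=` S n `|` \bigcup_(k in ~` `I_n) D k.
Proof.
move=> x [Xx /Fclosed[e e0 xe]].
have [m Sm] : exists m, S m x.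
  exists (Num.truncn (e^-1)%R); split => // y Fy; apply: le_trans (xe _ Fy).
  rewrite -[leRHS]invrK lef_pV2 ?posrE ?invr_gt0// ltW//.
  by rewrite truncnS_gt.
have [nm|mn] := leqP n m; last by left; exact: (S_mono (ltnW mn)).
rewrite -(subnK nm) in Sm; move: (m - n)%N Sm => k {nm}.
elim: k => [|k IH]; first by left.
rewrite addSn => Sk; have [Sk'|nSk] := pselect (S (k + n)%N x); first exact: IH.
by right; exists (k + n)%N => //=; apply/negP; rewrite -leqNgt leq_addl.
Qed.

Lemma hausdorff_caratheodory_aux : H (X `&` F) + H (X `&` ~` F) <= H X.
Proof.
have Xf : H X \is a fin_num by rewrite ge0_fin_numE ?ltey// hausdorff_ge0.
have tail0 : \sum_(n <= k <oo) H (D k) @[n --> \oo] --> 0.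
  apply: nneseries_tail_cvg => [|k _]; last exact: hausdorff_ge0.
  have DX : H (D 0%N) <= H X by apply: le_hausdorff => x [[]].
  apply: (@le_lt_trans _ _ (H X + (H X + H X))).
    apply: lime_le; first by apply: is_cvg_nneseries => *; exact: hausdorff_ge0.
    apply: nearW => -[|n].
      by rewrite big_geq// !adde_ge0// hausdorff_ge0.
    by rewrite big_nat_recl//; exact: leeD.
  by rewrite -ge0_fin_numE ?adde_ge0 ?hausdorff_ge0// !fin_numD Xf.
have XFf : H (X `&` F) \is a fin_num.
  rewrite ge0_fin_numE ?hausdorff_ge0//.
  by apply: (le_lt_trans (le_hausdorff d (@subIsetl _ X F))); rewrite ltey.
suff main n : H (X `&` F) + H (X `&` ~` F) <= H X + \sum_(n <= k <oo) H (D k).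
  have cv : H X + \sum_(n <= k <oo) H (D k) @[n --> \oo] --> H X + 0.
    by apply: cvgeD => //; [exact: fin_num_adde_defr|exact: cvg_cst].
  rewrite -[leRHS]adde0 -(cvg_lim _ cv)//; apply: lime_ge; last exact: nearW.
  by apply/cvg_ex; eexists; exact: cv.
have sep : separated_by (h n) (S n) (X `&` F).
  by move=> x y [Xx Sx] [_ Fy]; exact: Sx.
have := hausdorff_sep d (h_gt0 n) sep.
move=> /le_trans SX.
have {}SX : H (S n) + H (X `&` F) <= H X.
  by apply: SX; apply: le_hausdorff => x [[]//|[]//].
rewrite -[leLHS]addeC.
have h1 : H (X `&` ~` F) <= H (S n) + \sum_(n <= k <oo) H (D k).
  apply: (le_trans (le_hausdorff d (cover_off n))).
  apply: (le_trans (outer_measureU2 _ _ _)); rewrite leeD2l//.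
  exact: outer_measure_sigma_subadditive_tail.
apply: (le_trans (leeD2r _ h1)).
by rewrite addeAC leeD2r.
Qed.

End caratheodory_criterion.

Lemma borel_caratheodory d (A : set (borelC R)) :
  measurable A -> (hausdorff d).-caratheodory A.
Proof.
apply: (@smallest_sub _ (sigma_algebra setT) (@open R[i])
  (hausdorff d).-caratheodory).
  split; [exact: caratheodory_measurable_set0
         |move=> B mB; rewrite setTD; exact: caratheodory_measurable_setC
         |exact: caratheodory_measurable_bigcup].
move=> U oU; apply: le_caratheodory_measurable => X /=.
have [->|Xoo] := eqVneq (hausdorff d X) +oo; first by rewrite leey.
rewrite addeC -[X in _ + hausdorff _ (_ `&` X)]setCK.
apply: hausdorff_caratheodory_aux => // x /contrapT Ux.
have /nbhs_ballP[e /= e0 eU] := open_nbhs_nbhs (conj oU Ux).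
exists (complex.Re e); first by move: e0; rewrite ltcE => /andP[].
move=> y; apply: contra_notP => /negP; rewrite -ltNge => xy; apply: eU.
rewrite -ball_normE /= ltcE /= xy andbT.
by move: e0; rewrite ltcE => /andP[].
Qed.

Definition hausdorff_measure d : set (borelC R) -> \bar R := hausdorff d.

Let hausdorff_measure0 d : hausdorff_measure d set0 = 0.
Proof. exact: hausdorff0. Qed.

Let hausdorff_measure_ge0 d A : 0 <= hausdorff_measure d A.
Proof. exact: hausdorff_ge0. Qed.

Let hausdorff_measure_sigma_additive d :
  semi_sigma_additive (hausdorff_measure d).
Proof.
move=> F mF tF mUF; apply: caratheodory_measure_sigma_additive => //.
  by move=> i; exact: borel_caratheodory.
exact: borel_caratheodory.
Qed.

HB.instance Definition _ d := isMeasure.Build _ _ _ (hausdorff_measure d)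
  (hausdorff_measure0 d) (@hausdorff_measure_ge0 d)
  (@hausdorff_measure_sigma_additive d).

(* When K is a singleton no t satisfies 0 < t <= diam K. *)
Definition d_set d (K : set R[i]) : Prop :=
  exists a b : R, [/\ (0 < a)%R, (0 < b)%R &
    forall x t, K x -> (0 < t)%R -> t%:E <= diam K ->
      (b * t `^ d)%:E <= hausdorff_measure d (K `&` disk x t) <= (a * t `^ d)%:E].

(* The integral is meaningful for the functions below: they are bounded above
   on the circle, and its value may be -oo. *)
Definition circle_mean (f : R[i] -> \bar R) z r : \bar R :=
  (2 * pi)^-1%:E * \int[@lebesgue_measure R]_(t in `[0%R, (2 * pi)%R])
    f (z + r%:C * (cos t +i* sin t))%R.

Record subharmonic (U : set R[i]) (f : R[i] -> \bar R) : Prop := {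
  subharmonic_lty : forall z, U z -> f z < +oo ;
  subharmonic_usc : forall z (c : R), U z -> f z < c%:E ->
    \forall w \near z, f w < c%:E ;
  subharmonic_mean : forall z r, (0 < r)%R -> cdisk z r `<=` U ->
    f z <= circle_mean f z r ;
  subharmonic_neqNy : forall z, U z ->
    exists2 w, connected_component U z w & f w != -oo }.

End plane.

(* BMO(X, mu) for a subset X of the plane with the induced metric, mu being
   used only on subsets of X. The balls are open, centred at points of X. With
   0^-1 = +oo and +oo * 0 = 0 in \bar R, the average over a null set is 0. *)
Section bmo.
Context {R : realType}.
Local Open Scope ereal_scope.
Variables (X : set (borelC R)) (mu : {measure set (borelC R) -> \bar R}).
Implicit Types (B : set (borelC R)) (f : borelC R -> \bar R) (x : R[i]) (r : R).

Definition average B f : \bar R := (mu B)^-1 * \int[mu]_(x in B) f x.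

Definition mean_oscillation B f : \bar R :=
  average B (fun x => `|f x - average B f|).

Definition metric_ball x r : set (borelC R) := X `&` disk x r.

Definition locally_integrable_on f : Prop :=
  forall x, X x -> exists2 r, (0 < r)%R & mu.-integrable (metric_ball x r) f.

Definition bmo_seminorm f : \bar R :=
  ereal_sup [set mean_oscillation (metric_ball x r) f |
    x in X & r in [set r : R | (0 < r)%R]].

Definition bmo f : Prop := locally_integrable_on f /\ bmo_seminorm f < +oo.

End bmo.

(* Main.v *)
(* Near K put v = M - f, which is nonnegative, superharmonic and Lebesgue
   integrable. With psi_s(w) = s (1 - s|w|^2)_+^2 and b_s(w) = (1 - s|w|^2)_+^3
   the averages V_r(z) = \int v(w) psi_s(w - z) dw, s = r^-2, increase to
   kappa v(z) as r decreases to 0. Since Delta b_s = - 12 s d/ds psi_s, the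
   quantity s dV/ds is the value of a positive multiple of - Delta v on
   b_s(. - z), so that an inequality between combinations of bumps b gives one
   between the increments of the potentials V. This is used twice.
   (1) The H^d-integral over K of z |-> b_s(w - z) is O(r^d), so that the
   integral of V_(r/2) - V_r over a ball of K is O(r^d); the sum over the scales
   r, r/2, r/4, ... is geometric of ratio 2^-d, whence the integral of
   kappa v - V_r over a ball of radius r is O(r^d).
   (2) For |z - x| < r <= t, the bumps of radius t at x and z differ by
   O(r/t) b_(s0)(. - x), s0 being a fixed scale; summing over the dyadic scales
   t >= r, |V_r(z) - V_r(x)| is bounded uniformly in r.
   Hence the mean oscillation of f on small balls is bounded, the constant being
   taken equal to M - V_r(x) / kappa; for large balls f is integrable on K.
   The positivity of - Delta v is only used through the circle means of v at
   radius e -> 0; neither distributions nor the Riesz measure of f are needed. *)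

Require Import Defs.
From HB Require Import structures.
From mathcomp Require Import all_boot all_order all_algebra.
From mathcomp Require Import all_classical all_reals all_analysis.
From mathcomp Require Import measurable_realfun.
From mathcomp Require Import complex ring lra.

Set Implicit Arguments.
Unset Strict Implicit.
Unset Printing Implicit Defensive.

Import Order.TTheory GRing.Theory Num.Theory.
Import numFieldTopology.Exports numFieldNormedType.Exports.
Import Normc.

Local Open Scope classical_set_scope.
Local Open Scope ring_scope.
Local Open Scope complex_scope.

(** * Lebesgue measure on the plane *)

Section plane_borel.
Context {R : realType}.
Implicit Types (z w : R[i]) (x y t e : R).

(** The cube in [ker_b] is the least power of the positive part that has a second-order Taylor
    expansion with a cubic remainder. The mean of a bump over a circle of radius e is therefore
    known up to O(e^3), and after division by e^2 the error disappears as e -> 0. The kernels are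
    polynomials in |w|^2 cut off by a positive part, so these circle means reduce to integrals of
    trigonometric polynomials. Halving r multiplies s by 4. The increment of V over one halving is
    expressed by the mean value theorem at a single intermediate scale; pointwise inequalities
    between bumps pass to the derivatives of V, so this unknown scale can be traded for a known one.
    The interchange of integrals over K and over the plane is done before e -> 0, where only
    nonnegative measurable functions occur; this is why explicit error terms are carried along. The
    function v is cut off to 0 away from K, and its mean value inequality survives only for small
    circles centred near K. *)

Definition sqn z : R := complex.Re z ^+ 2 + complex.Im z ^+ 2.

Lemma sqn_ge0 z : 0 <= sqn z.
Proof. by rewrite addr_ge0 ?sqr_ge0. Qed.

Lemma normc_sqrt z : normc z = Num.sqrt (sqn z). Proof. by case: z. Qed.

Lemma normc_sqr z : normc z ^+ 2 = sqn z.
Proof. by rewrite normc_sqrt sqr_sqrtr// sqn_ge0. Qed.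

Lemma normc_ge0 z : 0 <= normc z. Proof. by rewrite normc_sqrt sqrtr_ge0. Qed.

Lemma normc_lt z t : 0 < t -> (normc z < t) = (sqn z < t ^+ 2).
Proof. by move=> t0; rewrite -normc_sqr ltr_pXn2r ?nnegrE ?normc_ge0 ?ltW. Qed.

Lemma normc_le z t : 0 <= t -> (normc z <= t) = (sqn z <= t ^+ 2).
Proof. by move=> t0; rewrite -normc_sqr ler_pXn2r ?nnegrE ?normc_ge0. Qed.

(** The radius of a ball of [R[i]] is itself an element of [R[i]]; being positive, it is real. *)
Lemma open_disk (U : set R[i]) z : open U -> U z ->
  exists2 e, 0 < e & disk z e `<=` U.
Proof.
move=> oU Uz; have /nbhs_ballP[e /= e0 eU] := open_nbhs_nbhs (conj oU Uz).
exists (complex.Re e); first by move: e0; rewrite ltcE => /andP[].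
suff -> : disk z (complex.Re e) = ball z e by [].
rewrite diskE; congr ball.
by move: e0; rewrite ltcE; case: (e) => a b /= /andP[/eqP ->].
Qed.

Lemma disk_open z t : open (disk z t).
Proof.
rewrite diskE; have [t0|t0] := ltP 0 t.
  by apply: ball_open; rewrite ltcE/= eqxx.
rewrite (_ : ball z t%:C = set0) ?open0//; apply/seteqP; split => // w.
rewrite -diskE /disk/= => h.
by have := le_lt_trans (normc_ge0 _) h; rewrite ltNge t0.
Qed.

Lemma open_from_disk (U : set R[i]) :
  (forall z, U z -> exists2 e, 0 < e & disk z e `<=` U) -> open U.
Proof.
move=> h; rewrite openE => z /h[e e0 eU]; apply/nbhs_ballP; exists e%:C => /=.
  by rewrite ltcE/= eqxx.
by rewrite -diskE.
Qed.

Definition toC (p : R * R) : borelC R := (p.1 +i* p.2).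

Lemma measurable_open (U : set R[i]) : open U -> measurable (U : set (borelC R)).
Proof. by move=> oU; exact: sub_sigma_algebra. Qed.

(** An open set is the countable union of the rational squares that it contains, and squares are
    measurable in the product. *)
Lemma measurable_toC :
  measurable_fun [set: (measurableTypeR R * measurableTypeR R)%type] toC.
Proof.
apply: (@measurability _ _ _ (borelC R) _ _ (@open R[i])) => //.
move=> _ [U oU <-]; rewrite setTI.
pose sq (i : rat * rat * nat) : set (R * R) :=
  `]ratr i.1.1 - i.2.+1%:R^-1, ratr i.1.1 + i.2.+1%:R^-1[%classic `*`
  `]ratr i.1.2 - i.2.+1%:R^-1, ratr i.1.2 + i.2.+1%:R^-1[%classic.
rewrite (_ : _ @^-1` _ = \bigcup_(i in [set i | sq i `<=` toC @^-1` U]) sq i).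
  rewrite bigcup_mkcond; apply: countable_bigcupT_measurable => // i.
  by case: ifP => // _; apply: measurableX; exact: measurable_itv.
apply/seteqP; split => [[x y] /= Uxy|p [i /= iU] /iU //].
have [e e0 eU] := open_disk oU Uxy.
(* A point of a square of half-side h whose centre is within h of (x, y) in each coordinate has
   coordinates within 2h of x and y; then 8h^2 < e^2 suffices. *)
pose n := Num.truncn (4 / e); pose h := n.+1%:R^-1 : R.
have h0 : 0 < h by rewrite invr_gt0.
have he : h * 4 < e.
  rewrite mulrC /h ltr_pdivrMr// mulrC -ltr_pdivrMr//.
  exact: truncnS_gt.
have [q1 /andP[q11 q12]] : exists q : rat, x - h < ratr q < x + h.
  have [q] := @rat_in_itvoo R (x - h) (x + h) ltac:(lra).
  by rewrite in_itv/=; exists q.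
have [q2 /andP[q21 q22]] : exists q : rat, y - h < ratr q < y + h.
  have [q] := @rat_in_itvoo R (y - h) (y + h) ltac:(lra).
  by rewrite in_itv/=; exists q.
exists (q1, q2, n); last first.
  by split; rewrite /= in_itv/= -/h; apply/andP; split; lra.
move=> [x' y'] [] /=; rewrite !in_itv/= -/h => /andP[a1 a2] /andP[b1 b2].
apply: eU; rewrite /disk /mkset normc_lt// /sqn /=; nra.
Qed.

Lemma continuous_measurable_plane (f : R[i] -> R) :
  (forall U : set R, open U -> open (f @^-1` U)) ->
  measurable_fun [set: borelC R] (f : borelC R -> measurableTypeR R).
Proof.
move=> cf; apply: (measurability _ (measurable_realfun.RGenOpens.measurableE R)).
by move=> _ [_ [a [b ->] <-]]; rewrite setTI; apply: measurable_open; apply: cf; exact: interval_open.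
Qed.

Lemma abs_Re_le z : `|complex.Re z| <= normc z.
Proof. by rewrite normc_sqrt -sqrtr_sqr ler_sqrt ?sqn_ge0// lerDl sqr_ge0. Qed.

Lemma abs_Im_le z : `|complex.Im z| <= normc z.
Proof. by rewrite normc_sqrt -sqrtr_sqr ler_sqrt ?sqn_ge0// lerDr sqr_ge0. Qed.

Lemma preimage_open_lip (f : R[i] -> R) :
  (forall z w, `|f z - f w| <= normc (z - w)) ->
  forall U : set R, open U -> open (f @^-1` U).
Proof.
move=> fl U oU; apply: open_from_disk => z Ufz.
have /nbhs_ballP[e /= e0 eU] := open_nbhs_nbhs (conj oU Ufz).
exists e => // w; rewrite /disk/= => zw; apply: eU.
rewrite /ball/= distrC; apply: le_lt_trans zw; exact: fl.
Qed.

Lemma measurable_Re :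
  measurable_fun [set: borelC R] (@complex.Re R : borelC R -> measurableTypeR R).
Proof.
apply: continuous_measurable_plane; apply: preimage_open_lip => -[a b] [c d].
exact: (abs_Re_le (Complex (a - c) (b - d))).
Qed.

Lemma measurable_Im :
  measurable_fun [set: borelC R] (@complex.Im R : borelC R -> measurableTypeR R).
Proof.
apply: continuous_measurable_plane; apply: preimage_open_lip => -[a b] [c d].
exact: (abs_Im_le (Complex (a - c) (b - d))).
Qed.

Lemma measurable_rect (a b c d : R) : measurable
  ([set z | (complex.Re z \in `[a, b]) && (complex.Im z \in `[c, d])] : set (borelC R)).
Proof.
rewrite (_ : [set z | _] =
  @complex.Re R @^-1` `[a, b]%classic `&` @complex.Im R @^-1` `[c, d]%classic).
  apply: measurableI; rewrite -[X in measurable X]setTI.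
    by apply: measurable_Re => //; exact: measurable_itv.
  by apply: measurable_Im => //; exact: measurable_itv.
by apply/seteqP; split => [z /andP[]|z [? ?]]; last exact/andP.
Qed.

Lemma measurable_complex d (T : measurableType d)
    (f g : T -> measurableTypeR R) :
  measurable_fun [set: T] f -> measurable_fun [set: T] g ->
  measurable_fun [set: T] ((fun u => Complex (f u) (g u)) : T -> borelC R).
Proof.
move=> mf mg; rewrite (_ : (fun _ => _) = toC \o (fun u => (f u, g u)))//.
by apply: measurableT_comp measurable_toC _; exact: measurable_fun_pair.
Qed.

End plane_borel.

Section lebC.
Context {R : realType}.
Implicit Types (z w : R[i]) (x y t e : R).
Local Open Scope ereal_scope.
Local Notation mu := (@lebesgue_measure R).

(** Transported to [borelC], so that the plane carries this measure and [hausdorff_measure] on the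
    same measurable space. *)
Definition lebC : set (borelC R) -> \bar R := pushforward (mu \x mu) toC.

Let lebCm : {measure set (borelC R) -> \bar R} :=
  measure_function_pushforward__canonical__measure_function_Measure
    (mu \x mu) measurable_toC.

Let lebC0 : lebC set0 = 0. Proof. exact: (measure0 lebCm). Qed.
Let lebC_ge0 A : 0 <= lebC A. Proof. exact: (measure_ge0 lebCm). Qed.
Let lebC_sa : semi_sigma_additive lebC.
Proof. exact: (@measure_semi_sigma_additive _ _ _ lebCm). Qed.

HB.instance Definition _ := isMeasure.Build _ _ _ lebC lebC0 lebC_ge0 lebC_sa.

Lemma lebC_rect (a b c d : R) : (a <= b)%R -> (c <= d)%R ->
  lebC [set z | (complex.Re z \in `[a, b]) && (complex.Im z \in `[c, d])] =
  ((b - a) * (d - c))%:E.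
Proof.
move=> ab cd; rewrite /lebC /pushforward (_ : _ @^-1` _ = `[a, b] `*` `[c, d]).
  have itv x y : (x <= y)%R -> mu `[x, y]%classic = (y - x)%:E.
    rewrite lebesgue_measure_itv/= lte_fin EFinB.
    by case: ltgtP => // -> _; rewrite subee.
  rewrite product_measure1E; try exact: measurable_itv.
  by rewrite EFinM -!itv.
by apply/seteqP; split => [[x y]/= /andP[]//|[x y] /= [-> ->]].
Qed.

(** Needed wherever [lebC] is a factor in Fubini-Tonelli, as in [radial_average] and
    [circle_int_adj]. *)
Let lebC_sigma_finite : sigma_finite [set: borelC R] lebC.
Proof.
pose F (n : nat) : set (borelC R) :=
  [set z | (complex.Re z \in `[- n%:R, n%:R]) && (complex.Im z \in `[- n%:R, n%:R])]%R.
exists F.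
  apply/esym; rewrite -subTset => z _.
  exists (Num.truncn (normc z)).+1 => //; rewrite /F/= !in_itv/= -!ler_norml.
  by rewrite !(le_trans _ (ltW (truncnS_gt _))) ?abs_Re_le ?abs_Im_le.
have nn n : (- n%:R <= n%:R :> R)%R by apply: (@le_trans _ _ 0%R); rewrite ?oppr_le0.
by move=> n; split; [exact: measurable_rect|rewrite lebC_rect ?ltry].
Qed.

HB.instance Definition _ := @Measure_isSigmaFinite.Build _ _ _ lebC lebC_sigma_finite.

Variable g : borelC R -> \bar R.
Hypothesis mg : measurable_fun [set: borelC R] g.
Hypothesis g0 : forall z, 0 <= g z.

Lemma integral_lebC_yx : \int[lebC]_z g z = \int[mu]_x \int[mu]_y g (Complex x y).
Proof.
rewrite /lebC (ge0_integral_pushforward measurable_toC)//.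
rewrite preimage_setT fubini_tonelli1//.
- by apply: measurableT_comp => //; exact: measurable_toC.
- by move=> z; exact: g0.
Qed.

Lemma integral_lebC_xy : \int[lebC]_z g z = \int[mu]_y \int[mu]_x g (Complex x y).
Proof.
rewrite /lebC (ge0_integral_pushforward measurable_toC)//.
rewrite preimage_setT fubini_tonelli2//.
- by apply: measurableT_comp => //; exact: measurable_toC.
- by move=> z; exact: g0.
Qed.

End lebC.

(** * Translations and shears *)

Section invariance.
Context {R : realType}.
Implicit Types (z w : R[i]) (x y t e : R).
Local Open Scope ereal_scope.
Local Notation mu := (@lebesgue_measure R).

Lemma measurable_addl (a : R) :
  measurable_fun [set: measurableTypeR R] (fun x => (a + x)%R : measurableTypeR R).
Proof. by apply: measurable_funD => //; exact: measurable_id. Qed.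

Lemma lebesgue_measure_shift (a : R) (A : set (measurableTypeR R)) : measurable A ->
  mu ((fun x => (a + x)%R) @^-1` A) = mu A.
Proof.
move=> mA.
pose m : {measure set (measurableTypeR R) -> \bar R} :=
  measure_function_pushforward__canonical__measure_function_Measure
    mu (measurable_addl a).
apply/esym/(@lebesgue_measure_unique _ m) => //= _ [[b c]] _ <-.
rewrite /pushforward/= (_ : _ @^-1` _ = `](b - a)%R, (c - a)%R]%classic).
  by rewrite !lebesgue_measure_itv/= !lte_fin ltrD2r -!EFinD; case: ifP => // _; congr EFin; ring.
by apply/seteqP; split => x /=; rewrite !in_itv/= ltrBlDl lerBrDl.
Qed.

Lemma ge0_integral_shift (a : R) (g : measurableTypeR R -> \bar R) D :
  measurable D ->
  measurable_fun D g -> (forall x, 0 <= g x) ->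
  \int[mu]_(x in (fun x => (a + x)%R) @^-1` D) g (a + x)%R = \int[mu]_(x in D) g x.
Proof.
move=> mD mg g0.
rewrite -(ge0_integral_pushforward (measurable_addl a))//.
apply: eq_measure_integral => [|? A mA _]; first exact: measurable_addl.
exact: (lebesgue_measure_shift a mA).
Qed.

Section plane.
Variable g : borelC R -> \bar R.
Hypothesis mg : measurable_fun [set: borelC R] g.
Hypothesis g0 : forall z, 0 <= g z.

Let mgx y : measurable_fun [set: measurableTypeR R] (fun x => g (Complex x y)).
Proof. by apply: measurableT_comp mg _; apply: measurable_complex; [exact: measurable_id|exact: measurable_cst]. Qed.

Let mgy x : measurable_fun [set: measurableTypeR R] (fun y => g (Complex x y)).
Proof. by apply: measurableT_comp mg _; apply: measurable_complex; [exact: measurable_cst|exact: measurable_id]. Qed.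

(** On each horizontal line the map is a translation, so Fubini reduces the claim to invariance in
    dimension one. Translations and rotations will be composed of such maps. *)
Lemma lebC_shearx (a b : R) :
  \int[lebC]_z g (Complex (a * complex.Im z + b + complex.Re z) (complex.Im z))%R = \int[lebC]_z g z.
Proof.
rewrite integral_lebC_xy//; last first.
  apply: measurableT_comp mg _; apply: measurable_complex; last exact: measurable_Im.
  apply: measurable_funD; last exact: measurable_Re.
  apply: measurable_funD => //; apply: measurable_funM => //; exact: measurable_Im.
rewrite [RHS](integral_lebC_xy mg g0); apply: eq_integral => y _ /=.
by have := ge0_integral_shift (a * y + b)%R measurableT (mgx y) (fun x => g0 _);
  rewrite preimage_setT.
Qed.

Lemma lebC_sheary (a b : R) :
  \int[lebC]_z g (Complex (complex.Re z) (a * complex.Re z + b + complex.Im z))%R = \int[lebC]_z g z.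
Proof.
rewrite integral_lebC_yx//; last first.
  apply: measurableT_comp mg _; apply: measurable_complex; first exact: measurable_Re.
  apply: measurable_funD; last exact: measurable_Im.
  apply: measurable_funD => //; apply: measurable_funM => //; exact: measurable_Re.
rewrite [RHS](integral_lebC_yx mg g0); apply: eq_integral => x _ /=.
by have := ge0_integral_shift (a * x + b)%R measurableT (mgy x) (fun x => g0 _);
  rewrite preimage_setT.
Qed.
End plane.

Variable g : borelC R -> \bar R.
Hypothesis mg : measurable_fun [set: borelC R] g.
Hypothesis g0 : forall z, 0 <= g z.

Lemma measurable_shearx (a b : R) : measurable_fun [set: borelC R]
  ((fun z => Complex (a * complex.Im z + b + complex.Re z) (complex.Im z))%R : borelC R -> borelC R).
Proof.
apply: measurable_complex; last exact: measurable_Im.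
apply: measurable_funD; last exact: measurable_Re.
apply: measurable_funD => //; apply: measurable_funM => //; exact: measurable_Im.
Qed.

Lemma measurable_sheary (a b : R) : measurable_fun [set: borelC R]
  ((fun z => Complex (complex.Re z) (a * complex.Re z + b + complex.Im z))%R : borelC R -> borelC R).
Proof.
apply: measurable_complex; first exact: measurable_Re.
apply: measurable_funD; last exact: measurable_Im.
apply: measurable_funD => //; apply: measurable_funM => //; exact: measurable_Re.
Qed.

Lemma lebC_shift w : \int[lebC]_z g (w + z)%R = \int[lebC]_z g z.
Proof.
case: w => a b.
have m1 := measurableT_comp mg (measurable_shearx 0 a).
rewrite -[RHS](lebC_shearx mg g0 0 a) -[RHS](lebC_sheary m1 (fun z => g0 _) 0 b)/=.
by apply: eq_integral => -[x y] _ /=; rewrite !mul0r !add0r.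
Qed.

End invariance.

(* A rotation whose angle is not pi is a product of three shears. *)
Lemma lebC_rotate_neq_pi {R : realType} (g : borelC R -> \bar R)
  (mg : measurable_fun [set: borelC R] g) (g0 : forall z, (0 <= g z)%E) (c s : R) :
  c ^+ 2 + s ^+ 2 = 1 -> c != -1 ->
  (\int[lebC]_z g (Complex c s * z)%R = \int[lebC]_z g z)%E.
Proof.
(* The tangent of half the angle: shearing by -t in x, then by s in y, then by -t in x is the
   rotation. *)
move=> cs c1; pose t := s / (1 + c).
have c10 : 1 + c != 0 by apply: contra c1; rewrite addrC addr_eq0.
have e2 : t * (1 + c) = s by rewrite /t divfK.
have e1 : t * s = 1 - c.
  apply: (mulfI c10); rewrite mulrA [(1 + c) * t]mulrC e2 -expr2.
  by rewrite -[LHS](addrK (c ^+ 2)) [s ^+ 2 + _]addrC cs; ring.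
have m1 := measurableT_comp mg (measurable_shearx (- t) 0).
have m2 := measurableT_comp m1 (measurable_sheary s 0).
rewrite -[RHS](lebC_shearx mg g0 (- t) 0) -[RHS](lebC_sheary m1 (fun z => g0 _) s 0)/=.
rewrite -[RHS](lebC_shearx m2 (fun z => g0 _) (- t) 0)/=.
apply: eq_integral => -[x y] _ /=; congr (g (Complex _ _)).
- have -> : c * x - s * y = c * x - (t * (1 + c)) * y by rewrite e2.
  by rewrite [RHS](_ : _ = (1 - t * s) * x - t * y - t * (1 - t * s) * y); [rewrite e1|]; ring.
- by rewrite [RHS](_ : _ = - (t * s) * y + s * x + y); [rewrite e1|]; ring.
Qed.

(** * Rotations, polar form and periodic integrals *)

Section rotation.
Context {R : realType}.
Implicit Types (z w : R[i]) (x y t e : R).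
Local Open Scope ereal_scope.
Local Notation mu := (@lebesgue_measure R).

Definition cis t : R[i] := Complex (cos t) (sin t).

Lemma sqn_cis t : sqn (cis t) = 1%R.
Proof. by rewrite /sqn/= cos2Dsin2. Qed.

Lemma sqnM z w : sqn (z * w)%R = (sqn z * sqn w)%R.
Proof. by case: z => a b; case: w => c d; rewrite /sqn/=; ring. Qed.

Lemma cisD t u : cis (t + u) = (cis t * cis u)%R.
Proof. by rewrite /cis cosD sinD; congr Complex; ring. Qed.

Lemma lebC_rotate (g : borelC R -> \bar R)
    (mg : measurable_fun [set: borelC R] g) (g0 : forall z, 0 <= g z) t :
  \int[lebC]_z g (cis t * z)%R = \int[lebC]_z g z.
Proof.
have [c1|c1] := eqVneq (cos t) (-1)%R; last first.
  by apply: lebC_rotate_neq_pi => //; rewrite cos2Dsin2.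
(* The excluded half turn is performed as two quarter turns. *)
have mr : measurable_fun [set: borelC R] ((fun z => Complex 0 1 * z)%R : borelC R -> borelC R).
  rewrite (_ : (fun _ => _) = (fun z => Complex (- complex.Im z) (complex.Re z))%R).
    by apply: measurable_complex; [apply: measurableT_comp => //; exact: measurable_Im|exact: measurable_Re].
  by apply/funext => -[x y]/=; congr Complex; ring.
have q (h : borelC R -> \bar R) : measurable_fun [set: borelC R] h -> (forall z, 0 <= h z) ->
    \int[lebC]_z h (Complex 0 1 * z)%R = \int[lebC]_z h z.
  move=> mh h0; apply: lebC_rotate_neq_pi => //; first by ring.
  by rewrite eq_sym oppr_eq0 oner_eq0.
rewrite -[RHS]q// -[RHS](q _ (measurableT_comp mg mr))//=.
apply: eq_integral => z _; congr g; rewrite mulrA; congr *%R.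
have s0 : sin t = 0%R.
  by apply/eqP; rewrite -sqrf_eq0 sin2cos2 c1 sqrrN expr1n subrr.
by rewrite /cis c1 s0; congr Complex; ring.
Qed.

Lemma cis_polar z : exists2 a, (0 <= a <= pi *+ 2)%R & z = ((normc z)%:C * cis a)%R.
Proof.
have [z0|z0] := eqVneq (normc z) 0%R.
  exists 0%R; first by rewrite lexx mulrn_wge0// pi_ge0.
  by rewrite z0 mul0r; apply: eq0_normc.
have n0 : (0 < normc z)%R by rewrite lt_neqAle eq_sym z0 normc_ge0.
case: z z0 n0 => x y; set n := normc _ => z0 n0.
have nE : (n ^+ 2 = x ^+ 2 + y ^+ 2)%R by rewrite normc_sqr.
pose u := (x / n)%R; pose v := (y / n)%R.
have xE : x = (n * u)%R by rewrite /u mulrC divfK.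
have yE : y = (n * v)%R by rewrite /v mulrC divfK.
have uv : (u ^+ 2 + v ^+ 2 = 1)%R.
  by apply: (mulfI (_ : n ^+ 2 != 0)%R); rewrite ?sqrf_eq0// mulr1 {2}nE xE yE; ring.
have u1 : (-1 <= u <= 1)%R by apply/andP; split; nra.
have [v0|v0] := leP 0%R v.
  exists (acos u).
    by rewrite acos_ge0//= (le_trans (acos_lepi u1))// mulr2n lerDl pi_ge0.
  rewrite /cis acosK ?in_itv//= sin_acos// -uv addrAC subrr add0r sqrtr_sqr ger0_norm//.
  by rewrite xE yE; congr Complex; ring.
exists (pi *+ 2 - acos u)%R.
  rewrite subr_ge0 (le_trans (acos_lepi u1)) ?mulr2n ?lerDl ?pi_ge0//=.
  by rewrite lerBlDr lerDl acos_ge0.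
rewrite /cis [(_ - acos u)%R]addrC cosD2pi sinD2pi cosN sinN acosK ?in_itv//= sin_acos//.
rewrite -uv addrAC subrr add0r sqrtr_sqr ltr0_norm// opprK.
by rewrite xE yE; congr Complex; ring.
Qed.

(** Lets the integral over a circle start at the argument of a given point, as [radial_average]
    requires. *)
Lemma integral_periodic (h : measurableTypeR R -> \bar R) (a : R) :
  measurable_fun [set: measurableTypeR R] h -> (forall x, 0 <= h x) ->
  (forall x : R, h (x + pi *+ 2)%R = h x) -> (0 <= a <= pi *+ 2)%R ->
  \int[mu]_(x in `[0%R, (pi *+ 2)%R]) h (a + x)%R = \int[mu]_(x in `[0%R, (pi *+ 2)%R]) h x.
Proof.
move=> mh h0 hp /andP[a0 a1]; set T := (pi *+ 2)%R in hp a1 *.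
have mhS D : measurable_fun D h by exact: measurable_funS mh.
have split_itv (b c d : R) : (b <= c <= d)%R -> \int[mu]_(x in `]b, d]) h x =
    \int[mu]_(x in `]b, c]) h x + \int[mu]_(x in `]c, d]) h x.
  move=> /andP[bc cd]; rewrite -ge0_integral_setU//=.
  - congr integral; apply/seteqP; split => x /=; rewrite !in_itv/=.
      by case: (leP x c) => xc /andP[xb xd]; [left|right]; rewrite ?xb ?xc ?xd.
    by case=> /andP[x1 x2]; rewrite ?x1 ?x2 ?(le_trans x2)// (le_lt_trans bc).
  - apply/disj_setPS => x [] /=; rewrite !in_itv/= => /andP[_ x1] /andP[x2 _].
    by have := lt_le_trans x2 x1; rewrite ltxx.
have e1 : \int[mu]_(x in `[0%R, T]) h (a + x)%R = \int[mu]_(x in `[a, (a + T)%R]) h x.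
  rewrite -[RHS](ge0_integral_shift a)// (_ : _ @^-1` _ = `[0%R, T]%classic)//.
  by apply/seteqP; split => x /=; rewrite !in_itv/= lerDl lerD2l.
(* One endpoint is dropped so that the pieces cut below are disjoint. *)
have oc b c : \int[mu]_(x in `[b, c]) h x = \int[mu]_(x in `]b, c]) h x.
  by apply/esym; apply: integral_itv_obnd_cbnd; exact: mhS.
rewrite e1 !oc.
rewrite (split_itv 0%R a T) ?a0// (split_itv a T (a + T)%R) ?a1 ?lerDr//.
rewrite addeC; congr (_ + _).
rewrite -[LHS](ge0_integral_shift T)//.
rewrite (_ : _ @^-1` _ = `]0%R, a]%classic); last first.
  by apply/seteqP; split => x /=; rewrite !in_itv/= ltrDl [(a + T)%R]addrC lerD2l.
by apply: eq_integral => x _; rewrite addrC hp.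
Qed.

End rotation.

(** * Measurability of complex arithmetic *)

Section measurable_arith.
Context {R : realType} d (T : measurableType d).
Implicit Types (f g : T -> borelC R).

Lemma measurable_ReC f : measurable_fun [set: T] f ->
  measurable_fun [set: T] (fun u => complex.Re (f u) : measurableTypeR R).
Proof. by move=> mf; exact: measurableT_comp measurable_Re mf. Qed.

Lemma measurable_ImC f : measurable_fun [set: T] f ->
  measurable_fun [set: T] (fun u => complex.Im (f u) : measurableTypeR R).
Proof. by move=> mf; exact: measurableT_comp measurable_Im mf. Qed.

Lemma measurable_addC f g : measurable_fun [set: T] f -> measurable_fun [set: T] g ->
  measurable_fun [set: T] ((fun u => (f u : R[i]) + (g u : R[i])) : T -> borelC R).
Proof.
move=> mf mg; rewrite (_ : (fun _ => _) = (fun u => Complex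
    (complex.Re (f u) + complex.Re (g u)) (complex.Im (f u) + complex.Im (g u)))).
  by apply: measurable_complex; apply: measurable_funD;
    do ?[exact: measurable_ReC|exact: measurable_ImC].
by apply/funext => u; case: (f u); case: (g u).
Qed.

Lemma measurable_mulC f g : measurable_fun [set: T] f -> measurable_fun [set: T] g ->
  measurable_fun [set: T] ((fun u => (f u : R[i]) * (g u : R[i])) : T -> borelC R).
Proof.
move=> mf mg; rewrite (_ : (fun _ => _) = (fun u => Complex
    (complex.Re (f u) * complex.Re (g u) - complex.Im (f u) * complex.Im (g u))
    (complex.Re (f u) * complex.Im (g u) + complex.Im (f u) * complex.Re (g u)))).
  by apply: measurable_complex; [apply: measurable_funB|apply: measurable_funD];
    apply: measurable_funM; do ?[exact: measurable_ReC|exact: measurable_ImC].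
by apply/funext => u; case: (f u); case: (g u).
Qed.

Lemma measurable_RtoC (f : T -> measurableTypeR R) : measurable_fun [set: T] f ->
  measurable_fun [set: T] ((fun u => (f u)%:C) : T -> borelC R).
Proof. by move=> mf; apply: measurable_complex => //; exact: measurable_cst. Qed.

Lemma measurable_subC f g : measurable_fun [set: T] f -> measurable_fun [set: T] g ->
  measurable_fun [set: T] ((fun u => (f u : R[i]) - (g u : R[i])) : T -> borelC R).
Proof.
move=> mf mg; rewrite (_ : (fun _ => _) = (fun u => (f u : R[i]) + (-1)%:C * (g u : R[i]))).
  by apply: measurable_addC => //; apply: measurable_mulC.
by apply/funext => u; rewrite rmorphN rmorph1 mulN1r.
Qed.

Lemma measurable_sqn f : measurable_fun [set: T] f ->
  measurable_fun [set: T] (fun u => sqn (f u) : measurableTypeR R).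
Proof.
by move=> mf; apply: measurable_funD; apply: measurable_funX;
  [exact: measurable_ReC|exact: measurable_ImC].
Qed.

Lemma measurable_cis (f : T -> measurableTypeR R) : measurable_fun [set: T] f ->
  measurable_fun [set: T] ((fun u => cis (f u)) : T -> borelC R).
Proof.
move=> mf; apply: measurable_complex; apply: measurableT_comp mf;
  apply: continuous_measurable_fun; [exact: continuous_cos|exact: continuous_sin].
Qed.

Lemma measurable_normc f : measurable_fun [set: T] f ->
  measurable_fun [set: T] (fun u => normc (f u) : measurableTypeR R).
Proof.
move=> mf; rewrite (_ : (fun _ => _) = (fun u => Num.sqrt (sqn (f u)))).
  apply: measurableT_comp (measurable_sqn mf).
  by apply: continuous_measurable_fun; exact: sqrt_continuous.
by apply/funext => u; rewrite normc_sqrt.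
Qed.

End measurable_arith.

(** * Averaging over circles *)

Section radial.
Context {R : realType}.
Implicit Types (z w : R[i]) (x y t e : R).
Local Open Scope ereal_scope.
Local Notation mu := (@lebesgue_measure R).

Variables (h : R -> R) (g : borelC R -> \bar R).
Hypothesis mh : measurable_fun [set: measurableTypeR R] (h : measurableTypeR R -> measurableTypeR R).
Hypothesis h0 : forall x, (0 <= h x)%R.
Hypothesis mg : measurable_fun [set: borelC R] g.
Hypothesis g0 : forall z, 0 <= g z.

Let I : set (measurableTypeR R) := `[0%R, (2 * pi)%R]%classic.
Let mI : measurable I. Proof. exact: measurable_itv. Qed.
Let muI : mu I = (2 * pi)%:E.
Proof.
rewrite /I lebesgue_measure_itv/= lte_fin mulr_gt0 ?pi_gt0//.
by rewrite oppr0 adde0.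
Qed.

Let mhs : measurable_fun [set: borelC R] (fun w : borelC R => (h (sqn w))%:E).
Proof.
apply/measurable_EFinP; apply: measurableT_comp mh _; apply: measurable_sqn.
exact: measurable_id.
Qed.

Let mrot : measurable_fun [set: (measurableTypeR R * borelC R)%type]
  (fun p => (h (sqn p.2))%:E * g (cis p.1 * p.2)%R * (\1_I p.1)%:E).
Proof.
apply: emeasurable_funM; first apply: emeasurable_funM.
- by apply: measurableT_comp mhs _; exact: measurable_snd.
- apply: measurableT_comp mg _; apply: measurable_mulC; last exact: measurable_snd.
  by apply: measurable_cis; exact: measurable_fst.
- apply/measurable_EFinP; apply: measurableT_comp; last exact: measurable_fst.
  exact: measurable_indic.
Qed.

(** This replaces polar coordinates. The function of an angle t and a point w, with g evaluated at w
    turned by t, is integrated in both orders: for fixed t rotation invariance removes t, and for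
    fixed w periodicity removes the argument of w. *)
Lemma radial_average :
  \int[lebC]_w ((h (sqn w))%:E * \int[mu]_(t in I) g ((normc w)%:C * cis t)%R) =
  (2 * pi)%:E * \int[lebC]_w ((h (sqn w))%:E * g w).
Proof.
have mhg : measurable_fun [set: borelC R] (fun w : borelC R => (h (sqn w))%:E * g w).
  exact: emeasurable_funM.
have hg0 w : 0 <= (h (sqn w))%:E * g w by rewrite mule_ge0 ?lee_fin.
pose F p := (h (sqn p.2))%:E * g (cis p.1 * p.2)%R * (\1_I p.1)%:E.
have F0 p : 0 <= F p by rewrite /F mule_ge0// ?mule_ge0// lee_fin.
have := fubini_tonelli (m1 := mu) (m2 := @lebC R) F mrot F0.
have -> : \int[mu]_t \int[lebC]_w F (t, w) = (2 * pi)%:E * \int[lebC]_w ((h (sqn w))%:E * g w).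
  transitivity (\int[mu]_(t in I) cst (\int[lebC]_w ((h (sqn w))%:E * g w)) t).
    rewrite [RHS]integral_mkcond; apply: eq_integral => t _; rewrite patchE /F/=.
    rewrite indicE; case: ifPn => tI; last first.
      by rewrite integral0_eq// => w _; rewrite mule0.
    rewrite -(lebC_rotate mhg hg0 t); apply: eq_integral => w _.
    by rewrite mule1 sqnM sqn_cis mul1r.
  by rewrite integral_cst// muleC; congr (_ * _); exact: muI.
move=> ->; apply: eq_integral => w _; rewrite /F/=.
under [RHS]eq_integral do rewrite -muleA.
rewrite ge0_integralZl//; last 3 first.
- apply: emeasurable_funM.
    apply: measurableT_comp mg _; apply: measurable_mulC; last exact: measurable_cst.
    by apply: measurable_cis; exact: measurable_id.
  by apply/measurable_EFinP; exact: measurable_indic.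
- by move=> t _; rewrite mule_ge0// lee_fin.
- by rewrite lee_fin.
congr (_ * _); rewrite [LHS]integral_mkcond/=.
transitivity (\int[mu]_(t in I) g (cis t * w)%R); last first.
  rewrite integral_mkcond; apply: eq_integral => t _; rewrite patchE indicE.
  by case: ifP => _; rewrite ?mule1 ?mule0.
rewrite -[LHS]integral_mkcond.
have [a a2 wE] := cis_polar w.
rewrite /I mulr_natl -(@integral_periodic _ _ a)//.
- apply: eq_integral => t _; rewrite {2}wE cisD mulrC -!mulrA; congr g.
  by rewrite mulrCA; congr *%R; rewrite mulrC.
- apply: measurableT_comp mg _; apply: measurable_mulC; first exact: measurable_cst.
  by apply: measurable_cis; exact: measurable_id.
- by move=> x; rewrite /cis cosD2pi sinD2pi.
Qed.

End radial.

(** * Mean value inequality with radial weights *)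

Section supermean.
Context {R : realType}.
Implicit Types (z w : R[i]) (x y t e : R).
Local Open Scope ereal_scope.
Local Notation mu := (@lebesgue_measure R).

(** By [radial_average] v may be replaced by its circle integrals about z; where the weight is not
    zero the radius is at most rho and the hypothesis on circles applies. *)
Lemma ge0_supermean_disk (h : R -> R) (v : borelC R -> \bar R) z (rho : R) :
  measurable_fun [set: measurableTypeR R] (h : measurableTypeR R -> measurableTypeR R) ->
  (forall x, (0 <= h x)%R) ->
  measurable_fun [set: borelC R] v -> (forall w, 0 <= v w) ->
  (forall r, (0 < r <= rho)%R ->
    \int[mu]_(t in `[0%R, (2 * pi)%R]) v (z + r%:C * cis t)%R <= (2 * pi)%:E * v z) ->
  (0 <= rho)%R -> (forall u, (rho ^+ 2 < u)%R -> h u = 0%R) ->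
  \int[lebC]_w ((h (sqn w))%:E * v (z + w)%R) <= (\int[lebC]_w (h (sqn w))%:E) * v z.
Proof.
move=> mh h0 mv v0 sm rho0 hs.
have pi20 : (0 < 2 * pi :> R)%R by rewrite mulr_gt0 ?pi_gt0.
have mvz : measurable_fun [set: borelC R] (fun w : borelC R => v (z + w)%R).
  apply: measurableT_comp mv _; apply: measurable_addC; first exact: measurable_cst.
  exact: measurable_id.
have mhs : measurable_fun [set: borelC R] (fun w : borelC R => (h (sqn w))%:E).
  apply/measurable_EFinP; apply: measurableT_comp mh _; apply: measurable_sqn.
  exact: measurable_id.
rewrite -(@lee_pmul2l _ (2 * pi)%:E) ?lte_fin//.
rewrite -(radial_average mh h0 mvz)// muleCA (muleC _ (_ * v z)).
have mI : measurable_fun [set: borelC R] (fun w : borelC R => \int[mu]_(t in `[0%R, (2 * pi)%R])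
    v (z + (normc w)%:C * cis t)%R).
  under eq_fun do rewrite integral_mkcond.
  pose F (p : borelC R * measurableTypeR R) :=
    v (z + (normc p.1)%:C * cis p.2)%R * (\1_(`[0%R, (2 * pi)%R]%classic : set (measurableTypeR R)) p.2)%:E.
  rewrite (_ : (fun _ => _) = fubini_F mu F); last first.
    apply/funext => w; apply: eq_integral => t _; rewrite patchE /F/= indicE.
    by case: ifP; rewrite ?mule1 ?mule0.
  apply: measurable_fun_fubini_tonelli_F.
    apply: emeasurable_funM.
      apply: measurableT_comp mv _; apply: measurable_addC; first exact: measurable_cst.
      apply: measurable_mulC.
        by apply: measurable_RtoC; apply: measurable_normc; exact: measurable_fst.
      by apply: measurable_cis; exact: measurable_snd.
    apply/measurable_EFinP; apply: measurableT_comp; last exact: measurable_snd.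
    by apply: measurable_indic; exact: measurable_itv.
  by move=> p; rewrite /F mule_ge0// lee_fin.
rewrite muleC -ge0_integralZr//; last 2 first.
- by move=> w _; rewrite lee_fin.
- by rewrite mule_ge0// lee_fin ltW.
apply: ge0_le_integral => //.
- by move=> w _; rewrite mule_ge0 ?lee_fin// integral_ge0.
- exact: emeasurable_funM.
- by apply: emeasurable_funM => //; exact: measurable_cst.
move=> w _; have [wr|wr] := leP (sqn w) (rho ^+ 2)%R; last by rewrite hs// !mul0e.
apply: lee_pmul => //; [by rewrite lee_fin|exact: integral_ge0|].
(* The circle of radius 0 is outside the scope of [sm], but there equality holds. *)
have [->|w0] := eqVneq (normc w) 0%R.
  under eq_integral do rewrite mul0r addr0.
  rewrite integral_cst; last exact: measurable_itv.
  rewrite muleC le_eqVlt; apply/orP; left; apply/eqP; congr (_ * _).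
  by rewrite [LHS]lebesgue_measure_itv/= lte_fin pi20 oppr0 adde0.
by apply: sm; rewrite lt_neqAle eq_sym w0 normc_ge0/= normc_le.
Qed.

(** These monomials are the ones that occur when a bump is expanded to second order along a
    circle. *)
Lemma integral_trig (a b c d e k : R) :
  \int[mu]_(t in `[0%R, (2 * pi)%R]) (a * cos t + b * sin t + c * cos t ^+ 2 +
     d * (cos t * sin t) + e * sin t ^+ 2 + k)%:E = (pi * (c + e + 2 * k))%:E.
Proof.
have pi20 : (0 < 2 * pi :> R)%R by rewrite mulr_gt0 ?pi_gt0.
pose F t := (a * sin t - b * cos t + c * (t + sin t * cos t) / 2 +
  d * sin t ^+ 2 / 2 + e * (t - sin t * cos t) / 2 + k * t)%R.
have dF x : is_derive x (1 : R)%R F (a * cos x + b * sin x + c * cos x ^+ 2 +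
     d * (cos x * sin x) + e * sin x ^+ 2 + k)%R.
  rewrite /F; apply: is_derive_eq.
  rewrite -![_ *: _]/(_ * _)%R.
  have := @cos2Dsin2 R x; set C := cos x; set S := sin x => CS.
  have -> : (1 + (S * - S + C * C) = 2 * C ^+ 2)%R by lra.
  have -> : (1 - (S * - S + C * C) = 2 * S ^+ 2)%R by lra.
  by field.
have cF : continuous F.
  by move=> x; apply/differentiable_continuous/derivable1_diffP; exact: ex_derive.
rewrite (@continuous_FTC2 _ _ F)//.
- rewrite -EFinB /F mulr_natl cos2pi sin2pi cos0 sin0; congr EFin; by field.
- apply: continuous_subspaceT => x.
  apply/differentiable_continuous/derivable1_diffP; exact: ex_derive.
- split=> [x _||]; first exact: ex_derive.
    by apply: cvg_at_right_filter; exact: cF.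
  by apply: cvg_at_left_filter; exact: cF.
- by move=> x _; rewrite derive1E derive_val.
Qed.

End supermean.

(** * Kernels *)

Section kernels.
Context {R : realType}.
Implicit Types (s u t x y e : R).

Definition pos x : R := Num.max 0 x.
(* u stands for |w|^2: then ker_k s u is the derivative of ker_psi s u in s, and
   the Laplacian of ker_b s |w|^2 is - 12 s ker_k s |w|^2. *)
Definition ker_b s u := pos (1 - s * u) ^+ 3.
Definition ker_psi s u := s * pos (1 - s * u) ^+ 2.
Definition ker_k s u := pos (1 - s * u) ^+ 2 - 2 * s * u * pos (1 - s * u).

Lemma pos_ge0 x : 0 <= pos x. Proof. by rewrite /pos le_max lexx. Qed.

Lemma pos_le1 x : x <= 1 -> pos x <= 1.
Proof. by move=> x1; rewrite /pos ge_max ler01. Qed.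

Lemma posP x : (0 <= x /\ pos x = x) \/ (x < 0 /\ pos x = 0).
Proof. by rewrite /pos; case: (leP 0 x) => h; [left|right]. Qed.

(** The expansion crosses the kink at 0 because the second derivative 6 [pos t] is Lipschitz with
    constant 6. *)
Lemma pos3_taylor t d :
  `|pos (t - d) ^+ 3 - pos t ^+ 3 + 3 * pos t ^+ 2 * d - 3 * pos t * d ^+ 2| <= `|d| ^+ 3.
Proof.
case: (posP t) => -[t0 ->]; case: (posP (t - d)) => -[d0 ->].
- rewrite (_ : _ - _ = - d ^+ 3); last by ring.
  by rewrite normrN normrX.
- have dt : t < d by lra.
  have d00 : 0 < d by lra.
  rewrite (ger0_norm (ltW d00)) ler_norml.
  have e1 : 0 <= (d - t) ^+ 3 by rewrite exprn_ge0//; lra.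
  have e2 : (d - t) ^+ 3 <= d ^+ 3 by rewrite lerXn2r ?nnegrE//; lra.
  have -> : 0 ^+ 3 - t ^+ 3 + 3 * t ^+ 2 * d - 3 * t * d ^+ 2 = (d - t) ^+ 3 - d ^+ 3 by ring.
  by apply/andP; split; lra.
- have d1 : d < 0 by lra.
  rewrite (ltr0_norm d1) expr0n/= expr0n/= !(mulr0,mul0r,subr0,addr0).
  rewrite ger0_norm ?exprn_ge0// lerXn2r ?nnegrE//; lra.
- by rewrite !expr0n/= !(mulr0,mul0r,subr0,addr0) normr0 exprn_ge0.
Qed.

Lemma pos_lip x y : `|pos x - pos y| <= `|x - y|.
Proof.
case: (posP x) => -[x0 ->]; case: (posP y) => -[y0 ->];
  rewrite ?subr0 ?sub0r ?subrr ?normrN ?normr0//.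
  by rewrite !ger0_norm//; lra.
by rewrite ger0_norm// ltr0_norm; lra.
Qed.

Lemma pos2_taylor t d : `|pos (t - d) ^+ 2 - pos t ^+ 2 + 2 * d * pos t| <= d ^+ 2.
Proof.
case: (posP t) => -[t0 ->]; case: (posP (t - d)) => -[d0 ->]; rewrite ler_norml;
  apply/andP; split; nra.
Qed.

(** The remainder is uniform for bounded u, so it can be integrated against v; differentiation under
    the integral then needs no limit theorem. *)
Lemma ker_psi_taylor s s' u : 0 <= s -> 0 <= s' -> 0 <= u ->
  `|ker_psi s' u - ker_psi s u - (s' - s) * ker_k s u| <=
  (s * u ^+ 2 + 2 * u) * (s' - s) ^+ 2.
Proof.
move=> s0 s'0 u0; rewrite /ker_psi /ker_k.
set t := 1 - s * u; set h := s' - s.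
have -> : 1 - s' * u = t - h * u by rewrite /t /h; ring.
have -> : s' = s + h by rewrite /h; ring.
have -> : (s + h) * pos (t - h * u) ^+ 2 - s * pos t ^+ 2 -
   h * (pos t ^+ 2 - 2 * s * u * pos t) =
   s * (pos (t - h * u) ^+ 2 - pos t ^+ 2 + 2 * (h * u) * pos t) +
   h * ((pos (t - h * u) - pos t) * (pos (t - h * u) + pos t)) by ring.
apply: (le_trans (ler_normD _ _)); rewrite !normrM (ger0_norm s0) [leRHS]mulrDl.
apply: lerD.
  rewrite -[leRHS]mulrA ler_wpM2l//; apply: (le_trans (pos2_taylor _ _)).
  by rewrite exprMn mulrC.
have t1 : t <= 1 by rewrite /t; nra.
have t1' : t - h * u <= 1 by rewrite /t /h; nra.
have a1 : `|pos (t - h * u) + pos t| <= 2.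
  by rewrite ger0_norm ?addr_ge0 ?pos_ge0//; have := pos_le1 t1; have := pos_le1 t1'; lra.
have a2 : `|pos (t - h * u) - pos t| <= `|h| * u.
  apply: (le_trans (pos_lip _ _)).
  by rewrite addrAC subrr add0r normrN normrM (ger0_norm u0).
have -> : 2 * u * h ^+ 2 = `|h| * (`|h| * u * 2).
  by rewrite -[h ^+ 2]real_normK ?num_real//; ring.
by rewrite ler_wpM2l// ler_pM.
Qed.

Lemma is_derive_quadratic (f : R -> R) (x df C del : R) : 0 < del ->
  (forall h, `|h| < del -> `|f (x + h) - f x - h * df| <= C * h ^+ 2) ->
  is_derive x (1 : R) f df.
Proof.
move=> del0 H.
suff cv : h^-1 *: (f (h *: (1 : R) + x) - f x) @[h --> 0^'] --> df.
  by apply: DeriveDef; [apply/cvg_ex; exists df|apply/cvg_lim].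
apply/cvgrPdist_le => e e0.
have C0 : 0 <= C.
  have d2 : `|del / 2| < del by rewrite ger0_norm; lra.
  have := le_trans (normr_ge0 _) (H _ d2).
  by rewrite pmulr_lge0// exprn_gt0// divr_gt0.
have d'0 : 0 < Num.min del (e / (C + 1)) by rewrite lt_min del0 divr_gt0//; lra.
near=> h.
have h0 : h != 0 by near: h; exact: nbhs_dnbhs_neq.
have : `|h| < Num.min del (e / (C + 1)).
  near: h; apply: dnbhs0_lt => //.
rewrite lt_min => /andP[h1 h2].
have e1 : df - h^-1 *: (f (h *: (1 : R) + x) - f x) = - h^-1 * (f (x + h) - f x - h * df).
  rewrite -![_ *: _]/(_ * _) mulr1 [h + x]addrC.
  by field.
rewrite e1 normrM normrN normfV ler_pdivrMl ?normr_gt0//.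
apply: (le_trans (H _ h1)).
rewrite -real_normK ?num_real// expr2 mulrA [C * _]mulrC -mulrA ler_wpM2l//.
move: h2; rewrite ltr_pdivlMr; last by lra.
by have := normr_ge0 h; nra.
Unshelve. all: by end_near.
Qed.

Lemma pos_le x y : x <= y -> pos x <= pos y.
Proof. by case: (posP x) => -[x0 ->]; case: (posP y) => -[y0 ->]; lra. Qed.

(** The form in which e -> 0 is taken: both sides of an inequality for [riesz e] are known as
    multiples of e^2 up to a cubic error. *)
Lemma eps_limit (rho a b c : R) : 0 < rho -> 0 <= c ->
  (forall e, 0 < e <= 1 -> e <= rho -> a * e ^+ 2 <= b * e ^+ 2 + c * e ^+ 3) ->
  a <= b.
Proof.
move=> rho0 c0 h; apply/ler_addgt0Pr => d d0.
pose e := Num.min (Num.min 1 rho) (d / (c + 1)).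
have c1 : 0 < c + 1 by lra.
have e0 : 0 < e by rewrite !lt_min ltr01 rho0 divr_gt0.
have e1 : e <= 1 by rewrite !ge_min lexx.
have er : e <= rho by rewrite !ge_min lexx orbT.
have ed : c * e <= d.
  have : e <= d / (c + 1) by rewrite !ge_min lexx orbT.
  by rewrite ler_pdivlMr// => h1; nra.
have := h e; rewrite e0 e1 => /(_ isT er).
rewrite (_ : b * e ^+ 2 + c * e ^+ 3 = (b + c * e) * e ^+ 2); last by ring.
by rewrite ler_pM2r ?exprn_gt0// => /le_trans; apply; rewrite lerD2l.
Qed.

End kernels.

(** * Circle means of the bumps *)

Section circle_mean_kernel.
Context {R : realType}.
Local Open Scope ereal_scope.
Local Notation mu := (@lebesgue_measure R).

Lemma measurable_pos d (T : measurableType d) (f : T -> measurableTypeR R) :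
  measurable_fun [set: T] f ->
  measurable_fun [set: T] (fun x => pos (f x) : measurableTypeR R).
Proof. by move=> mf; apply: measurable_maxr => //; exact: measurable_cst. Qed.

Lemma measurable_ker_b (s : R) d (T : measurableType d) (f : T -> measurableTypeR R) :
  measurable_fun [set: T] f ->
  measurable_fun [set: T] (fun x => ker_b s (f x) : measurableTypeR R).
Proof.
move=> mf; apply: measurable_funX; apply: measurable_pos.
by apply: measurable_funB => //; apply: measurable_funM.
Qed.

Lemma measurable_ker_psi (s : R) d (T : measurableType d) (f : T -> measurableTypeR R) :
  measurable_fun [set: T] f ->
  measurable_fun [set: T] (fun x => ker_psi s (f x) : measurableTypeR R).
Proof.
move=> mf; apply: measurable_funM => //; apply: measurable_funX; apply: measurable_pos.
by apply: measurable_funB => //; apply: measurable_funM.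
Qed.

Lemma sqn_sub_cis (z : R[i]) (e t : R) : (sqn (z - e%:C * cis t) =
  sqn z - 2 * e * (complex.Re z * cos t + complex.Im z * sin t) + e ^+ 2)%R.
Proof.
case: z => x y; rewrite /sqn /cis /=.
rewrite [in RHS](_ : e ^+ 2 = e ^+ 2 * (cos t ^+ 2 + sin t ^+ 2))%R; last first.
  by rewrite cos2Dsin2 mulr1.
by ring.
Qed.

(** On a circle of radius e <= 1 about a point of modulus at most D, s|w|^2 varies by at most s(2D +
    1)e: the first term is its cube, the remainder of [pos3_taylor]. The second absorbs the term in
    e^4 left by the exact integration. *)
Definition ker_err (s D : R) : R := ((s * (2 * D + 1)) ^+ 3 + 3 * s ^+ 2)%R.

(** The expansion b + (e^2 / 4) Delta b + O(e^3) of a circle mean, where Delta b is -12 s times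
    [ker_k]. *)
Lemma integral_circle_ker_b (s D e : R) (z : R[i]) :
  (0 < s)%R -> (0 <= D)%R -> (0 < e <= 1)%R -> (sqn z <= D ^+ 2)%R ->
  (2 * pi * (ker_b s (sqn z) - 3 * s * e ^+ 2 * ker_k s (sqn z) -
     ker_err s D * e ^+ 3))%:E <=
    \int[mu]_(t in `[0%R, (2 * pi)%R]) (ker_b s (sqn (z - e%:C * cis t)))%:E <=
  (2 * pi * (ker_b s (sqn z) - 3 * s * e ^+ 2 * ker_k s (sqn z) +
     ker_err s D * e ^+ 3))%:E.
Proof.
move=> s0 D0 /andP[e0 e1] zD; set C := ker_err s D.
set m := (ker_b s (sqn z) - 3 * s * e ^+ 2 * ker_k s (sqn z))%R.
have pi0 := pi_gt0 R.
pose x := complex.Re z; pose y := complex.Im z; pose u := sqn z.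
have uE : (u = x ^+ 2 + y ^+ 2)%R by [].
have u0 : (0 <= u)%R by exact: sqn_ge0.
pose T := (1 - s * u)%R; pose P := pos T.
have P0 : (0 <= P)%R by exact: pos_ge0.
have P1 : (P <= 1)%R by apply: pos_le1; rewrite /T; nra.
pose C0 := ((s * (2 * D + 1)) ^+ 3)%R.
pose del t := (s * (- 2 * e * (x * cos t + y * sin t) + e ^+ 2))%R.
(* P ^+ 3 - 3 * P ^+ 2 * del + 3 * P * del ^+ 2 + k, expanded as a trigonometric
   polynomial so as to be integrated exactly. *)
pose Q k t := ((6 * P ^+ 2 * s * e * x - 12 * P * s ^+ 2 * e ^+ 3 * x) * cos t
  + (6 * P ^+ 2 * s * e * y - 12 * P * s ^+ 2 * e ^+ 3 * y) * sin t
  + (12 * P * s ^+ 2 * e ^+ 2 * x ^+ 2) * cos t ^+ 2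
  + (24 * P * s ^+ 2 * e ^+ 2 * x * y) * (cos t * sin t)
  + (12 * P * s ^+ 2 * e ^+ 2 * y ^+ 2) * sin t ^+ 2
  + (P ^+ 3 - 3 * P ^+ 2 * s * e ^+ 2 + 3 * P * s ^+ 2 * e ^+ 4 + k))%R.
have QE t k : (Q k t = P ^+ 3 - 3 * P ^+ 2 * del t + 3 * P * del t ^+ 2 + k)%R.
  by rewrite /Q /del; ring.
have delle t : (`|del t| <= s * (2 * D + 1) * e)%R.
  (* Cauchy-Schwarz, in the form of Lagrange's identity. *)
  have p2 : ((x * cos t + y * sin t) ^+ 2 <= D ^+ 2)%R.
    apply: le_trans zD; rewrite -/u uE.
    rewrite -[leRHS]mulr1 -(cos2Dsin2 t) -subr_ge0.
    by rewrite (_ : _ - _ = (x * sin t - y * cos t) ^+ 2)%R ?sqr_ge0//; ring.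
  have p1 : (`|x * cos t + y * sin t| <= D)%R.
    by rewrite -(ger0_norm D0) -ler_sqr ?nnegrE// !real_normK ?num_real.
  rewrite /del normrM (gtr0_norm s0) -[leRHS]mulrA ler_wpM2l ?(ltW s0)//.
  move: p1; set p := (_ + _)%R; rewrite !ler_norml => /andP[p1 p3].
  apply/andP; split; nra.
have bE t : (`|ker_b s (sqn (z - e%:C * cis t)) - Q 0 t| <= C0 * e ^+ 3)%R.
  rewrite /ker_b sqn_sub_cis -/u -/x -/y.
  have -> : (1 - s * (u - 2 * e * (x * cos t + y * sin t) + e ^+ 2) = T - del t)%R.
    by rewrite /T /del; ring.
  rewrite (_ : (_ - Q 0 t = pos (T - del t) ^+ 3 - pos T ^+ 3 + 3 * pos T ^+ 2 * del t -
    3 * pos T * del t ^+ 2)%R); last by rewrite QE /P; ring.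
  apply: (le_trans (pos3_taylor _ _)).
  rewrite /C0 -exprMn lerXn2r ?nnegrE//.
  by rewrite mulr_ge0 ?(ltW e0)// mulr_ge0 ?(ltW s0)//; lra.
have muI : mu `[0%R, (2 * pi)%R]%classic < +oo.
  by rewrite lebesgue_measure_itv/=; case: ifP; rewrite ?ltry// -EFinD ltry.
have mcos : measurable_fun [set: measurableTypeR R] (@cos R : measurableTypeR R -> measurableTypeR R).
  by apply: continuous_measurable_fun; exact: continuous_cos.
have msin : measurable_fun [set: measurableTypeR R] (@sin R : measurableTypeR R -> measurableTypeR R).
  by apply: continuous_measurable_fun; exact: continuous_sin.
have iQ k : mu.-integrable `[0%R, (2 * pi)%R] (fun t => (Q k t)%:E).
  apply: continuous_compact_integrable; first exact: segment_compact.
  apply: continuous_subspaceT => t.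
  apply/differentiable_continuous/derivable1_diffP; rewrite /Q; exact: ex_derive.
have ib : mu.-integrable `[0%R, (2 * pi)%R] (fun t => (ker_b s (sqn (z - e%:C * cis t)))%:E).
  apply: measurable_bounded_integrable => //.
    apply: (@measurable_funS _ _ _ _ setT) => //.
    apply: measurable_ker_b; apply: measurable_sqn; apply: measurable_subC; first exact: measurable_cst.
    by apply: measurable_mulC; [exact: measurable_cst|apply: measurable_cis; exact: measurable_id].
  exists 1%R; split => // M M1 t _ /=.
  rewrite ger0_norm ?exprn_ge0 ?pos_ge0// (le_trans _ (ltW M1))//.
  rewrite exprn_ile1 ?pos_ge0// pos_le1//.
  by rewrite lerBlDr lerDl mulr_ge0 ?(ltW s0)// sqn_ge0.
have intQ k : \int[mu]_(t in `[0%R, (2 * pi)%R]) (Q k t)%:E =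
   (2 * pi * (m + 3 * P * s ^+ 2 * e ^+ 4 + k))%:E.
  rewrite /Q integral_trig /m /ker_b /ker_k -/u -/T -/P uE; congr EFin; ring.
have Ce : (0 <= 3 * P * s ^+ 2 * e ^+ 4 <= 3 * s ^+ 2 * e ^+ 3)%R.
  rewrite !mulr_ge0 ?exprn_ge0 ?(ltW e0) ?(ltW s0)//=.
  have : (P * e <= 1)%R by nra.
  have : (0 <= 3 * s ^+ 2 * e ^+ 3)%R by rewrite !mulr_ge0 ?exprn_ge0 ?(ltW e0) ?(ltW s0).
  rewrite (_ : 3 * P * s ^+ 2 * e ^+ 4 = (3 * s ^+ 2 * e ^+ 3) * (P * e))%R; last by ring.
  by set A := (3 * s ^+ 2 * _)%R => A0 A1; nra.
have Ce3 : (C * e ^+ 3 = C0 * e ^+ 3 + 3 * s ^+ 2 * e ^+ 3)%R by rewrite /C /ker_err /C0; ring.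
have pi20 : (0 < 2 * pi :> R)%R by rewrite mulr_gt0.
apply/andP; split.
  apply: (@le_trans _ _ (\int[mu]_(t in `[0%R, (2 * pi)%R]) (Q (- (C0 * e ^+ 3)) t)%:E)).
    by rewrite intQ lee_fin ler_pM2l// Ce3; case/andP: Ce => c1 c2; lra.
  apply: le_integral => // t _; rewrite lee_fin.
  by move: (bE t); rewrite !QE ler_norml => /andP[b1 b2]; lra.
apply: (@le_trans _ _ (\int[mu]_(t in `[0%R, (2 * pi)%R]) (Q (C0 * e ^+ 3) t)%:E)).
  apply: le_integral => // t _; rewrite lee_fin.
  by move: (bE t); rewrite !QE ler_norml => /andP[b1 b2]; lra.
by rewrite intQ lee_fin ler_pM2l// Ce3; case/andP: Ce => c1 c2; lra.
Qed.

End circle_mean_kernel.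

(** * Potentials of a superharmonic function *)

Section potential.
Context {R : realType}.
Local Open Scope ereal_scope.
Local Notation mu := (@lebesgue_measure R).
Local Notation I := (`[0%R, (2 * pi)%R]%classic : set (measurableTypeR R)).
Variables (v : borelC R -> \bar R) (W : set R[i]) (D rho : R).
Hypothesis mv : measurable_fun [set: borelC R] v.
Hypothesis v0 : forall w, 0 <= v w.
Hypothesis vfin : \int[lebC]_w v w < +oo.
Hypothesis D0 : (0 <= D)%R.
Hypothesis vD : forall w z, v w != 0 -> W z -> (sqn (w - z) <= D ^+ 2)%R.
Hypothesis super : forall z (r : R), W z -> (0 < r <= rho)%R ->
  \int[mu]_(t in I) v (z + r%:C * cis t)%R <= (2 * pi)%:E * v z.

Let pi20 : (0 < 2 * pi :> R)%R. Proof. by rewrite mulr_gt0 ?pi_gt0. Qed.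

Let vr w := fine (v w).

Let iv : lebC.-integrable [set: borelC R] v.
Proof.
apply/integrableP; split => //; rewrite (eq_integral v)// => w _; by rewrite gee0_abs.
Qed.

Let mvr : measurable_fun [set: borelC R] (vr : borelC R -> measurableTypeR R).
Proof. exact: measurableT_comp (fine_measurable measurableT) mv. Qed.

Let vr0 w : (0 <= vr w)%R. Proof. by rewrite /vr fine_ge0. Qed.

Let aev : {ae lebC, forall w, v w = (vr w)%:E}.
Proof.
have := integrable_ae measurableT iv; apply: filterS => w /(_ Logic.I) vw.
by rewrite /vr fineK.
Qed.

Definition mass := fine (\int[lebC]_w v w).

Let massE : mass%:E = \int[lebC]_w v w.
Proof. by rewrite fineK// ge0_fin_numE// integral_ge0. Qed.

(** A bound where v is not zero is enough for the pairing with v, and [vD] keeps such points within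
    D of W; [kker_le] gets its bound in this way. *)
Definition testfun (phi : borelC R -> R) :=
  measurable_fun [set: borelC R] (phi : borelC R -> measurableTypeR R) /\
  exists M : R, forall w, v w != 0 -> (`|phi w| <= M)%R.

(** With the finite part of v the pairing is real and linear in phi. Since v is integrable it is
    finite almost everywhere, and no integral changes. *)
Definition pairing (phi : borelC R -> R) : R := \int[lebC]_w (vr w * phi w)%R.
Local Notation J := pairing.

Let vr_neq0 w : vr w != 0%R -> v w != 0.
Proof. by apply: contra => /eqP vw; rewrite /vr vw. Qed.

Let testfun_integrable phi : testfun phi ->
  lebC.-integrable [set: borelC R] (EFin \o (fun w => (vr w * phi w)%R)).
Proof.
move=> [mphi [M HM]].
have iMv : lebC.-integrable [set: borelC R] (fun w => (`|M|)%:E * v w).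
  exact: integrableZl.
apply: (le_integrable measurableT _ _ iMv).
  by apply/measurable_EFinP; exact: measurable_funM.
move=> w _ /=; rewrite abseM (gee0_abs (v0 w)) /= normr_id normrM (ger0_norm (vr0 w)).
have [vw|vw] := eqVneq (vr w) 0%R.
  by rewrite vw mul0r mule_ge0.
have [voo|voo] := eqVneq (v w) +oo; first by rewrite /vr voo/= eqxx in vw.
rewrite -[v w]fineK; last by rewrite ge0_fin_numE// ltey.
rewrite -EFinM lee_fin mulrC ler_wpM2r//.
exact: (le_trans (HM _ (vr_neq0 vw)) (ler_norm _)).
Qed.

Lemma pairingE phi : testfun phi -> (forall w, (0 <= phi w)%R) ->
  \int[lebC]_w (v w * (phi w)%:E) = (J phi)%:E.
Proof.
move=> tphi phi0; rewrite /J /Rintegral fineK; last first.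
  exact: (integrable_fin_num measurableT (testfun_integrable tphi)).
apply: ge0_ae_eq_integral => //.
- by apply: emeasurable_funM => //; apply/measurable_EFinP; exact: tphi.1.
- by apply/measurable_EFinP; apply: measurable_funM => //; exact: tphi.1.
- by move=> w _; rewrite mule_ge0// lee_fin.
- by move=> w _; rewrite lee_fin mulr_ge0.
- by move: aev; apply: filterS => w -> _; rewrite EFinM.
Qed.

Lemma testfun_cst (c : R) : testfun (fun=> c).
Proof. by split; [exact: measurable_cst|exists `|c|%R]. Qed.

Lemma testfunD phi1 phi2 : testfun phi1 -> testfun phi2 ->
  testfun (fun w => phi1 w + phi2 w)%R.
Proof.
move=> [m1 [M1 H1]] [m2 [M2 H2]]; split; first exact: measurable_funD.
by exists (M1 + M2)%R => w vw; apply: (le_trans (ler_normD _ _)); rewrite lerD ?H1 ?H2.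
Qed.

Lemma testfunZ c phi : testfun phi -> testfun (fun w => c * phi w)%R.
Proof.
move=> [m1 [M1 H1]]; split; first by apply: measurable_funM.
by exists (`|c| * M1)%R => w vw; rewrite normrM ler_wpM2l// H1.
Qed.

Lemma testfunB phi1 phi2 : testfun phi1 -> testfun phi2 ->
  testfun (fun w => phi1 w - phi2 w)%R.
Proof.
move=> t1 t2; rewrite (_ : (fun _ => _) = (fun w => phi1 w + (-1) * phi2 w)%R).
  by apply: testfunD => //; exact: testfunZ.
by apply/funext => w; rewrite mulN1r.
Qed.

Lemma pairingD phi1 phi2 : testfun phi1 -> testfun phi2 ->
  J (fun w => phi1 w + phi2 w)%R = (J phi1 + J phi2)%R.
Proof.
move=> t1 t2; rewrite /J -RintegralD//; try exact: testfun_integrable.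
by apply: eq_Rintegral => w _; rewrite mulrDr.
Qed.

Lemma pairingZ c phi : testfun phi -> J (fun w => c * phi w)%R = (c * J phi)%R.
Proof.
move=> t1; rewrite /J -RintegralZl//; try exact: testfun_integrable.
by apply: eq_Rintegral => w _; rewrite mulrCA.
Qed.

Lemma pairingB phi1 phi2 : testfun phi1 -> testfun phi2 ->
  J (fun w => phi1 w - phi2 w)%R = (J phi1 - J phi2)%R.
Proof.
move=> t1 t2; rewrite /J -RintegralB//; try exact: testfun_integrable.
by apply: eq_Rintegral => w _; rewrite mulrBr.
Qed.

Lemma le_pairing phi1 phi2 : testfun phi1 -> testfun phi2 ->
  (forall w, v w != 0 -> (phi1 w <= phi2 w)%R) -> (J phi1 <= J phi2)%R.
Proof.
move=> t1 t2 h; apply: le_Rintegral => //; try exact: testfun_integrable.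
move=> w _; have [->|vw] := eqVneq (vr w) 0%R; first by rewrite !mul0r.
by rewrite ler_wpM2l// h// vr_neq0.
Qed.

Lemma pairing_cst c : J (fun=> c) = (c * mass)%R.
Proof.
have -> : (fun _ : borelC R => c) = (fun w => c * cst 1 w)%R.
  by apply/funext => w; rewrite mulr1.
rewrite pairingZ; last exact: testfun_cst.
congr (_ * _)%R; apply: EFin_inj; rewrite -pairingE//; last exact: testfun_cst.
by rewrite massE; apply: eq_integral => w _; rewrite mule1.
Qed.

Lemma mass_ge0 : (0 <= mass)%R.
Proof. by rewrite fine_ge0// integral_ge0. Qed.

Lemma pairing_bound M phi : testfun phi -> (forall w, v w != 0 -> (`|phi w| <= M)%R) ->
  (`|J phi| <= M * mass)%R.
Proof.
move=> t h; rewrite ler_norml -mulNr -!pairing_cst; apply/andP; split;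
  (apply: le_pairing => //; first exact: testfun_cst);
  by move=> w /h; rewrite ler_norml => /andP[].
Qed.

(* riesz e phi / e ^+ 2 approximates a multiple of the integral of phi against
   the Riesz measure - Delta v; the truncation at 0 is inactive on W. *)
Definition circle_int e w := \int[mu]_(t in I) v (w + e%:C * cis t)%R.
Definition defect e w := maxe 0 ((2 * pi)%:E * v w - circle_int e w).
Definition riesz e (phi : borelC R -> R) := \int[lebC]_w (defect e w * (phi w)%:E).

Let mcirc (f : borelC R -> \bar R) (c : R) : measurable_fun [set: borelC R] f ->
  measurable_fun [set: (borelC R * measurableTypeR R)%type]
    (fun p : borelC R * measurableTypeR R => f (p.1 + c%:C * cis p.2)%R * (\1_I p.2)%:E).
Proof.
move=> mf; apply: emeasurable_funM.
  apply: measurableT_comp mf _; apply: measurable_addC; first exact: measurable_fst.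
  apply: measurable_mulC; first exact: measurable_cst.
  by apply: measurable_cis; exact: measurable_snd.
apply/measurable_EFinP; apply: measurableT_comp; last exact: measurable_snd.
by apply: measurable_indic; exact: measurable_itv.
Qed.

Let int_indic (f : R -> \bar R) :
  \int[mu]_(t in I) f t = \int[mu]_t (f t * (\1_I t)%:E).
Proof.
rewrite integral_mkcond; apply: eq_integral => t _; rewrite patchE indicE.
by case: ifP; rewrite ?mule1 ?mule0.
Qed.

Lemma measurable_circle_int e : measurable_fun [set: borelC R] (circle_int e).
Proof.
rewrite (_ : circle_int e = fubini_F mu
   (fun p : borelC R * measurableTypeR R => v (p.1 + e%:C * cis p.2)%R * (\1_I p.2)%:E)); last first.
  by apply/funext => w; rewrite /circle_int int_indic.
apply: measurable_fun_fubini_tonelli_F; first exact: mcirc.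
by move=> p; rewrite mule_ge0// lee_fin.
Qed.

Lemma circle_int_ge0 e w : 0 <= circle_int e w. Proof. exact: integral_ge0. Qed.

Lemma measurable_defect e : measurable_fun [set: borelC R] (defect e).
Proof.
apply: measurable_maxe => //; apply: emeasurable_funB.
  exact: measurable_funeM.
exact: measurable_circle_int.
Qed.

Lemma defect_ge0 e w : 0 <= defect e w. Proof. by rewrite /defect le_max lexx. Qed.

(** Averaging over circles is self-adjoint, by Fubini and a translation for each angle. It moves the
    average from v, which has no regularity, to a bump, which can be expanded. *)
Lemma circle_int_adj e (phi : borelC R -> R) :
  measurable_fun [set: borelC R] (phi : borelC R -> measurableTypeR R) ->
  (forall w, (0 <= phi w)%R) ->
  \int[lebC]_w (circle_int e w * (phi w)%:E) =
  \int[lebC]_w (v w * \int[mu]_(t in I) (phi (w - e%:C * cis t)%R)%:E).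
Proof.
move=> mphi phi0.
have mphiE : measurable_fun [set: borelC R] (EFin \o phi) by exact/measurable_EFinP.
pose F (p : borelC R * measurableTypeR R) :=
  v (p.1 + e%:C * cis p.2)%R * (\1_I p.2)%:E * (phi p.1)%:E.
have F0 p : 0 <= F p by rewrite /F !mule_ge0// lee_fin.
have mF : measurable_fun [set: _] F.
  apply: emeasurable_funM; first exact: mcirc.
  by apply: measurableT_comp mphiE _; exact: measurable_fst.
pose G (p : borelC R * measurableTypeR R) :=
  (EFin \o phi) (p.1 + (- e)%:C * cis p.2)%R * (\1_I p.2)%:E * v p.1.
have G0 p : 0 <= G p by rewrite /G !mule_ge0// lee_fin.
have mG : measurable_fun [set: _] G.
  apply: emeasurable_funM; first exact: mcirc.
  by apply: measurableT_comp mv _; exact: measurable_fst.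
transitivity (\int[lebC]_w \int[mu]_t F (w, t)).
  apply: eq_integral => w _; rewrite /F/= ge0_integralZr ?lee_fin//.
  - by rewrite -int_indic.
  - exact: (@measurable_fun_pair2 _ _ _ _ _ _ _ w (mcirc e mv)).
  - by move=> t _; rewrite mule_ge0// lee_fin.
transitivity (\int[lebC]_w \int[mu]_t G (w, t)); last first.
  apply: eq_integral => w _; rewrite /G/= ge0_integralZr//.
  - rewrite muleC int_indic; congr (_ * _); apply: eq_integral => t _.
    by rewrite rmorphN mulNr.
  - exact: (@measurable_fun_pair2 _ _ _ _ _ _ _ w (mcirc (- e) mphiE)).
  - by move=> t _; rewrite mule_ge0// lee_fin.
rewrite (fubini_tonelli F mF F0) (fubini_tonelli G mG G0).
apply: eq_integral => t _.
have mGt : measurable_fun [set: borelC R] (fun w => G (w, t)).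
  exact: (@measurable_fun_pair1 _ _ _ _ _ _ _ t mG).
rewrite -(lebC_shift mGt (fun w => G0 _) (e%:C * cis t)%R).
apply: eq_integral => w _; rewrite /F /G/=.
have -> : (e%:C * cis t + w + (- e)%:C * cis t = w)%R.
  by rewrite rmorphN mulNr addrAC subrr add0r.
by rewrite (addrC w) muleC [X in _ * X]muleC muleA.
Qed.

(** Stated as a sum, which makes sense before any term is known to be finite. Where phi is not zero,
    [super] makes the truncation in [defect] inactive, and v is finite almost everywhere, so the
    circle integral can be cancelled pointwise. *)
Lemma riesz_circle_int e (phi : borelC R -> R) : (0 < e <= rho)%R ->
  measurable_fun [set: borelC R] (phi : borelC R -> measurableTypeR R) ->
  (forall w, (0 <= phi w)%R) -> (forall w, phi w != 0%R -> W w) ->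
  riesz e phi + \int[lebC]_w (circle_int e w * (phi w)%:E) =
  (2 * pi)%:E * \int[lebC]_w (v w * (phi w)%:E).
Proof.
move=> e0 mphi phi0 phiW.
have mphiE : measurable_fun [set: borelC R] (EFin \o phi) by exact/measurable_EFinP.
rewrite /riesz -ge0_integralD//; last 4 first.
- by move=> w _; rewrite mule_ge0 ?defect_ge0// lee_fin.
- by apply: emeasurable_funM => //; exact: measurable_defect.
- by move=> w _; rewrite mule_ge0 ?circle_int_ge0// lee_fin.
- by apply: emeasurable_funM => //; exact: measurable_circle_int.
rewrite -ge0_integralZl ?lee_fin ?(ltW pi20)//; last 2 first.
- exact: emeasurable_funM.
- by move=> w _; rewrite mule_ge0// lee_fin.
apply: ge0_ae_eq_integral => //.
- apply: emeasurable_funD; apply: emeasurable_funM => //.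
    exact: measurable_defect.
  exact: measurable_circle_int.
- by apply: measurable_funeM; exact: emeasurable_funM.
- by move=> w _; rewrite adde_ge0// mule_ge0 ?defect_ge0 ?circle_int_ge0// lee_fin.
- by move=> w _; rewrite mule_ge0 ?lee_fin ?(ltW pi20)// mule_ge0// lee_fin.
move: aev; apply: filterS => w vw _.
have [->|pw] := eqVneq (phi w) 0%R; first by rewrite !mule0 adde0.
have sw := super (phiW _ pw) e0.
rewrite -ge0_muleDl ?defect_ge0 ?circle_int_ge0// muleA; congr (_ * _).
have cf : circle_int e w \is a fin_num.
  rewrite ge0_fin_numE ?circle_int_ge0//; apply: (le_lt_trans sw).
  by rewrite vw -EFinM ltry.
by rewrite /defect max_r ?sube_ge0 ?subeK// cf.
Qed.

Definition bker (s : R) (z : R[i]) (w : borelC R) : R := ker_b s (sqn ((w : R[i]) - z)%R).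
Definition psiker (s : R) (z : R[i]) (w : borelC R) : R := ker_psi s (sqn ((w : R[i]) - z)%R).
Definition kker (s : R) (z : R[i]) (w : borelC R) : R := ker_k s (sqn ((w : R[i]) - z)%R).

Let msq (z : R[i]) : measurable_fun [set: borelC R]
  ((fun w => sqn ((w : R[i]) - z)%R) : borelC R -> measurableTypeR R).
Proof.
apply: measurable_sqn; apply: measurable_subC; first exact: measurable_id.
exact: measurable_cst.
Qed.

Lemma measurable_bker s z : measurable_fun [set: borelC R] (bker s z : borelC R -> measurableTypeR R).
Proof. exact: measurable_ker_b. Qed.

Lemma ker_pos_itv (s u : R) : (0 <= s)%R -> (0 <= u)%R -> (0 <= pos (1 - s * u) <= 1)%R.
Proof. by move=> s0 u0; rewrite pos_ge0/= pos_le1// lerBlDr lerDl mulr_ge0. Qed.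

Lemma bker_ge0 s z w : (0 <= bker s z w)%R.
Proof. by rewrite /bker /ker_b exprn_ge0// pos_ge0. Qed.

Lemma bker_le1 s z w : (0 <= s)%R -> (bker s z w <= 1)%R.
Proof.
by move=> s0; have /andP[a b] := ker_pos_itv s0 (sqn_ge0 (w - z)%R); rewrite exprn_ile1.
Qed.

Lemma testfun_bker s z : (0 <= s)%R -> testfun (bker s z).
Proof.
move=> s0; split; first exact: measurable_bker.
by exists 1%R => w _; rewrite ger0_norm ?bker_ge0 ?bker_le1.
Qed.

Lemma psiker_ge0 s z w : (0 <= s)%R -> (0 <= psiker s z w)%R.
Proof. by move=> s0; rewrite /psiker /ker_psi mulr_ge0// exprn_ge0// pos_ge0. Qed.

Lemma psiker_le s z w : (0 <= s)%R -> (psiker s z w <= s)%R.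
Proof.
move=> s0; have /andP[a b] := ker_pos_itv s0 (sqn_ge0 (w - z)%R).
by rewrite -[leRHS]mulr1 ler_wpM2l// exprn_ile1.
Qed.

Lemma measurable_psiker s z : measurable_fun [set: borelC R] (psiker s z : borelC R -> measurableTypeR R).
Proof. exact: measurable_ker_psi. Qed.

Lemma testfun_psiker s z : (0 <= s)%R -> testfun (psiker s z).
Proof.
move=> s0; split; first exact: measurable_psiker.
by exists s => w _; rewrite ger0_norm ?psiker_ge0 ?psiker_le.
Qed.

Lemma kker_le s z w : W z -> (0 <= s)%R -> v w != 0 ->
  (`|kker s z w| <= 1 + 2 * s * D ^+ 2)%R.
Proof.
move=> Wz s0 vw.
have /andP[a b] := ker_pos_itv s0 (sqn_ge0 (w - z)%R).
apply: (le_trans (ler_normB _ _)); apply: lerD.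
  by rewrite ger0_norm ?exprn_ge0 ?exprn_ile1.
rewrite ger0_norm; last by rewrite !mulr_ge0// sqn_ge0.
rewrite -[leRHS]mulr1 ler_pM ?mulr_ge0 ?sqn_ge0//.
by rewrite ler_wpM2l ?mulr_ge0// vD.
Qed.

Lemma testfun_kker s z : W z -> (0 <= s)%R -> testfun (kker s z).
Proof.
move=> Wz s0.
have mp : measurable_fun [set: borelC R]
  ((fun w => pos (1 - s * sqn ((w : R[i]) - z))%R) : borelC R -> measurableTypeR R).
  apply: measurable_pos; apply: measurable_funB; first exact: measurable_cst.
  by apply: measurable_funM; [exact: measurable_cst|exact: msq].
split; last by exists (1 + 2 * s * D ^+ 2)%R => w; exact: kker_le.
apply: measurable_funB; first exact: measurable_funX.
apply: measurable_funM => //; apply: measurable_funM; last exact: msq.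
exact: measurable_cst.
Qed.

(** Once the circle average is moved onto the bump and expanded, the terms of order 0 cancel; what
    is left is 6 pi s e^2 times the derivative of the potential in s, up to O(e^3). *)
Lemma riesz_bker s z e : (0 < s)%R -> W z -> (0 < e <= 1)%R -> (e <= rho)%R ->
  (forall w, s * sqn (w - z) < 1 -> W w)%R ->
  exists2 r : R, riesz e (bker s z) = r%:E &
    (`|r - 2 * pi * (3 * s * e ^+ 2 * J (kker s z))| <=
     2 * pi * (ker_err s D * e ^+ 3 * mass))%R.
Proof.
move=> s0 Wz /andP[e0 e1] er sW.
have bW w : bker s z w != 0%R -> W w.
  apply: contra_neqP => /(contra_not (sW w))/negP; rewrite -leNgt => h.
  by rewrite /bker /ker_b /pos max_l ?expr0n//; lra.
have e01 : (0 < e <= 1)%R by rewrite e0.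
have := riesz_circle_int (_ : 0 < e <= rho)%R (measurable_bker s z) (bker_ge0 s z) bW.
rewrite e0 er => /(_ isT).
rewrite (circle_int_adj e (measurable_bker s z) (bker_ge0 s z)).
rewrite (pairingE (testfun_bker z (ltW s0)) (bker_ge0 s z)).
pose B w := \int[mu]_(t in I) (bker s z (w - e%:C * cis t)%R)%:E.
have mB : measurable_fun [set: borelC R] B.
  rewrite (_ : B = fubini_F mu (fun p : borelC R * measurableTypeR R =>
      (EFin \o bker s z) (p.1 + (- e)%:C * cis p.2)%R * (\1_I p.2)%:E)); last first.
    apply/funext => w; rewrite /B int_indic; apply: eq_integral => t _ /=.
    by rewrite rmorphN mulNr.
  apply: measurable_fun_fubini_tonelli_F.
    by apply: mcirc; apply/measurable_EFinP; exact: measurable_bker.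
  by move=> p; rewrite mule_ge0// lee_fin ?bker_ge0.
have B0 w : 0 <= B w by apply: integral_ge0 => t _; rewrite lee_fin bker_ge0.
have Ble w : B w <= (2 * pi)%:E.
  apply: (@le_trans _ _ (\int[mu]_(t in I) cst 1 t)).
    apply: ge0_le_integral => //.
    - by move=> t _; rewrite lee_fin bker_ge0.
    - apply/measurable_EFinP; apply: (@measurable_funS _ _ _ _ setT) => //.
      apply: measurableT_comp (measurable_bker s z) _.
      apply: measurable_subC; first exact: measurable_cst.
      by apply: measurable_mulC; [exact: measurable_cst|apply: measurable_cis; exact: measurable_id].
    - by move=> t _; rewrite lee_fin bker_le1// ltW.
  rewrite integral_cst; last exact: measurable_itv.
  by rewrite mul1e [leLHS]lebesgue_measure_itv/= lte_fin pi20 oppr0 adde0.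
have Bfin w : B w = (fine (B w))%:E.
  by rewrite fineK// ge0_fin_numE// (le_lt_trans (Ble w))// ltry.
have tB : testfun (fun w => fine (B w)).
  split; first exact: measurableT_comp (fine_measurable measurableT) mB.
  by exists (2 * pi)%R => w _; rewrite ger0_norm ?fine_ge0// -lee_fin -Bfin.
have -> : \int[lebC]_w (v w * B w) = (J (fun w => fine (B w)))%:E.
  rewrite -pairingE//; last by move=> w; rewrite fine_ge0.
  by apply: eq_integral => w _; rewrite -Bfin.
set JB := J _ => eqr.
(* In [eqr] a nonnegative value plus a real number is real, so [riesz] is finite. *)
have rE : riesz e (bker s z) = (2 * pi * J (bker s z) - JB)%:E.
  move: eqr; have : 0 <= riesz e (bker s z).
    by apply: integral_ge0 => w _; rewrite mule_ge0 ?defect_ge0// lee_fin bker_ge0.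
  by case: (riesz _ _) => [r| |]//= _ [<-]; rewrite addrK.
exists (2 * pi * J (bker s z) - JB)%R => //.
pose Q (c : R) w := (2 * pi * ((bker s z w - 3 * s * e ^+ 2 * kker s z w) + c))%R.
have tk := testfun_kker Wz (ltW s0).
have tb := testfun_bker z (ltW s0).
have tbk : testfun (fun w => bker s z w - 3 * s * e ^+ 2 * kker s z w)%R.
  by apply: testfunB => //; exact: testfunZ.
have tQ c : testfun (Q c).
  by apply: testfunZ; apply: testfunD => //; exact: testfun_cst.
have JQ c : J (Q c) = (2 * pi * (J (bker s z) - 3 * s * e ^+ 2 * J (kker s z) + c * mass))%R.
  rewrite pairingZ; last by apply: testfunD => //; exact: testfun_cst.
  rewrite pairingD//; last exact: testfun_cst.
  by rewrite pairingB ?pairingZ ?pairing_cst//; exact: testfunZ.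
have key w : v w != 0 -> (Q (- (ker_err s D * e ^+ 3)) w <= fine (B w) <= Q (ker_err s D * e ^+ 3) w)%R.
  move=> vw; have := integral_circle_ker_b s0 D0 e01 (vD vw Wz).
  rewrite -!lee_fin -Bfin /B.
  under [X in _ -> is_true (_ <= X <= _)]eq_integral do rewrite /bker addrAC.
  by [].
have l1 : (J (Q (- (ker_err s D * e ^+ 3))) <= JB)%R.
  by apply: le_pairing => // w /key /andP[].
have l2 : (JB <= J (Q (ker_err s D * e ^+ 3)))%R.
  by apply: le_pairing => // w /key /andP[].
by move: l1 l2; rewrite !JQ ler_norml => l1 l2; apply/andP; split; lra.
Qed.

(* bker s z is supported in W. *)
Definition adm (s : R) (z : R[i]) := forall w, (s * sqn (w - z) < 1)%R -> W w.

Lemma adm_W s z : adm s z -> W z.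
Proof. by apply; rewrite subrr /sqn expr0n addr0 mulr0. Qed.

Lemma adm_le s s' z : (s <= s')%R -> adm s z -> adm s' z.
Proof.
move=> ss sz w h; apply: sz; apply: le_lt_trans h.
by rewrite ler_wpM2r// sqn_ge0.
Qed.

Lemma riesz_ge0 e phi : (forall w, (0 <= phi w)%R) -> 0 <= riesz e phi.
Proof. by move=> p0; apply: integral_ge0 => w _; rewrite mule_ge0 ?defect_ge0 ?lee_fin. Qed.

Lemma riesz_le e (phi psi : borelC R -> R) :
  measurable_fun [set: borelC R] (phi : borelC R -> measurableTypeR R) ->
  measurable_fun [set: borelC R] (psi : borelC R -> measurableTypeR R) ->
  (forall w, (0 <= phi w <= psi w)%R) -> riesz e phi <= riesz e psi.
Proof.
move=> m1 m2 h; have md := measurable_defect e.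
apply: ge0_le_integral => //.
- by move=> w _; rewrite mule_ge0 ?defect_ge0 ?lee_fin//; case/andP: (h w).
- by apply: emeasurable_funM => //; exact/measurable_EFinP.
- by apply: emeasurable_funM => //; exact/measurable_EFinP.
- by move=> w _; rewrite lee_wpmul2l ?defect_ge0// lee_fin; case/andP: (h w).
Qed.

Lemma riesz_combo e c (phi psi : borelC R -> R) : (0 <= c)%R ->
  measurable_fun [set: borelC R] (phi : borelC R -> measurableTypeR R) ->
  measurable_fun [set: borelC R] (psi : borelC R -> measurableTypeR R) ->
  (forall w, (0 <= phi w)%R) -> (forall w, (0 <= psi w)%R) ->
  riesz e (fun w => phi w + c * psi w)%R = riesz e phi + c%:E * riesz e psi.
Proof.
move=> c0 m1 m2 p1 p2; have md := measurable_defect e.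
have mm f : measurable_fun [set: borelC R] (f : borelC R -> measurableTypeR R) ->
    measurable_fun [set: borelC R] (fun w => defect e w * (f w)%:E).
  by move=> mf; apply: emeasurable_funM => //; exact/measurable_EFinP.
have g0 f : (forall w, (0 <= f w)%R) -> forall w, [set: borelC R] w -> 0 <= defect e w * (f w)%:E.
  by move=> f0 w _; rewrite mule_ge0 ?defect_ge0 ?lee_fin.
rewrite /riesz -ge0_integralZl//; [|exact: mm|exact: g0].
rewrite -ge0_integralD//; [|exact: g0|exact: mm| |].
- apply: eq_integral => w _; rewrite EFinD ge0_muleDr ?lee_fin ?mulr_ge0//.
  by rewrite EFinM muleCA.
- by move=> w _; rewrite mule_ge0// g0.
- by apply: measurable_funeM; exact: mm.
Qed.

Hypothesis rho0 : (0 < rho)%R.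

Lemma ker_err_ge0 s : (0 <= s)%R -> (0 <= ker_err s D)%R.
Proof.
move=> s0; apply: addr_ge0; last by rewrite mulr_ge0// exprn_ge0.
apply: exprn_ge0; apply: mulr_ge0 => //; have := D0; lra.
Qed.

(* By riesz_bker both sides are limits of riesz e, which is monotone. *)
Lemma kker_compare (s1 s2 s3 : R) z1 z2 z3 (c : R) : (0 < s1)%R -> (0 < s2)%R -> (0 < s3)%R ->
  adm s1 z1 -> adm s2 z2 -> adm s3 z3 -> (0 <= c)%R ->
  (forall w, bker s1 z1 w <= bker s2 z2 w + c * bker s3 z3 w)%R ->
  (s1 * J (kker s1 z1) <= s2 * J (kker s2 z2) + c * (s3 * J (kker s3 z3)))%R.
Proof.
move=> p1 p2 p3 a1 a2 a3 c0 h.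
have g0 s : (0 < s)%R -> (0 <= ker_err s D * mass)%R.
  by move=> s0; rewrite mulr_ge0 ?mass_ge0 ?ker_err_ge0 ?ltW.
pose E := (ker_err s1 D * mass + ker_err s2 D * mass + c * (ker_err s3 D * mass))%R.
have E0 : (0 <= E)%R by apply: addr_ge0; [apply: addr_ge0|apply: mulr_ge0 => //]; exact: g0.
suff : (6 * pi * (s1 * J (kker s1 z1)) <= 6 * pi *
    (s2 * J (kker s2 z2) + c * (s3 * J (kker s3 z3))))%R.
  by rewrite ler_pM2l// mulr_gt0 ?pi_gt0.
apply: (@eps_limit _ _ _ _ (2 * pi * E)%R rho0) => [|e e1 er]; first by rewrite mulr_ge0// ltW.
have [r1 R1] := riesz_bker p1 (adm_W a1) e1 er a1.
have [r2 R2] := riesz_bker p2 (adm_W a2) e1 er a2.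
have [r3 R3] := riesz_bker p3 (adm_W a3) e1 er a3.
have : riesz e (bker s1 z1) <= riesz e (fun w => bker s2 z2 w + c * bker s3 z3 w)%R.
  apply: riesz_le; [exact: measurable_bker| |].
    by apply: measurable_funD; [|apply: measurable_funM => //]; exact: measurable_bker.
  by move=> w; rewrite bker_ge0 h.
rewrite riesz_combo//; try exact: measurable_bker; try exact: bker_ge0.
rewrite R1 R2 R3 -EFinM -EFinD lee_fin => r123.
rewrite !ler_norml => /andP[u3 l3] /andP[u2 l2] /andP[u1 l1].
have l3' : (c * (r3 - 2 * pi * (3 * s3 * e ^+ 2 * J (kker s3 z3))) <=
    c * (2 * pi * (ker_err s3 D * e ^+ 3 * mass)))%R by rewrite ler_wpM2l.
by rewrite /E; lra.
Qed.

(** The kernel [kker] changes sign; positivity comes from superharmonicity through [riesz]. It makes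
    the potentials monotone in s. *)
Lemma pairing_kker_ge0 s z : (0 < s)%R -> adm s z -> (0 <= J (kker s z))%R.
Proof.
move=> s0 a.
suff : (0 <= 6 * pi * (s * J (kker s z)))%R.
  by rewrite pmulr_rge0 ?mulr_gt0 ?pi_gt0// pmulr_rge0.
have E0 : (0 <= 2 * pi * (ker_err s D * mass))%R.
  by rewrite mulr_ge0 ?(ltW pi20)// mulr_ge0 ?mass_ge0// ker_err_ge0// ltW.
apply: (@eps_limit _ _ _ _ _ rho0 E0) => e e1 er.
have [r R1] := riesz_bker s0 (adm_W a) e1 er a.
have := riesz_ge0 e (bker_ge0 s z); rewrite R1 lee_fin => r0.
by rewrite ler_norml => /andP[u l]; lra.
Qed.

Lemma is_derive_pot z (s : R) : W z -> (0 < s)%R ->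
  is_derive s (1 : R)%R (fun s : R => J (psiker s z)) (J (kker s z)).
Proof.
move=> Wz s0.
apply: (@is_derive_quadratic _ _ _ _ ((s * (D ^+ 2) ^+ 2 + 2 * D ^+ 2) * mass)%R s s0) => h hs.
have s'0 : (0 <= s + h)%R by move: hs; rewrite ltr_norml => /andP[]; lra.
have t1 := testfun_psiker z s'0; have t2 := testfun_psiker z (ltW s0).
have t3 := testfun_kker Wz (ltW s0).
rewrite -pairingB// -pairingZ// -pairingB//; [|exact: testfunB|exact: testfunZ].
rewrite -mulrA [(mass * _)%R]mulrC mulrA.
apply: pairing_bound; first by apply: testfunB; [exact: testfunB|exact: testfunZ].
move=> w vw; have := ker_psi_taylor (ltW s0) s'0 (sqn_ge0 (w - z)%R).
rewrite (_ : (s + h - s = h)%R); last by ring.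
move=> /le_trans; apply; rewrite ler_wpM2r ?sqr_ge0//.
have := vD vw Wz => wD; have := sqn_ge0 (w - z)%R => w0.
apply: lerD; last by rewrite ler_wpM2l.
by rewrite ler_wpM2l ?(ltW s0)// ler_sqr ?nnegrE// sqr_ge0.
Qed.

(** The factor c allows two uses: c = 0 for one potential, c = 1 for the difference of two, which
    must share the same intermediate xi for their bumps to be comparable. *)
Lemma pot_MVT (s : R) z x (c : R) : (0 < s)%R -> W z -> W x -> exists2 xi : R, (s < xi < 4 * s)%R &
  (J (psiker (4 * s) z) - c * J (psiker (4 * s) x) - (J (psiker s z) - c * J (psiker s x)) =
   (J (kker xi z) - c * J (kker xi x)) * (3 * s))%R.
Proof.
move=> s0 Wz Wx; have s4 : (s < 4 * s)%R by lra.
have dV (y : R) : (s <= y)%R -> is_derive y (1 : R)%R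
    (fun s : R => J (psiker s z) - c * J (psiker s x))%R (J (kker y z) - c * J (kker y x))%R.
  move=> sy; have y0 : (0 < y)%R by lra.
  have d1 := is_derive_pot Wz y0; have d2 := is_derive_pot Wx y0.
  have d3 := is_deriveZ c d2; exact: is_deriveB.
have [||y] := @MVT R (fun s : R => J (psiker s z) - c * J (psiker s x))%R
  (fun y : R => J (kker y z) - c * J (kker y x))%R s (4 * s)%R s4.
- by move=> y; rewrite in_itv/= => /andP[sy _]; apply: dV; exact: ltW.
- apply: derivable_within_continuous => y; rewrite in_itv/= => /andP[sy _].
  by have [] := dV _ sy.
rewrite in_itv/= => sy E; exists y => //; rewrite E; congr (_ * _)%R; ring.
Qed.

Lemma bker_anti s s' z w : (s <= s')%R -> (bker s' z w <= bker s z w)%R.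
Proof.
move=> ss; rewrite /bker /ker_b lerXn2r ?nnegrE ?pos_ge0//; apply: pos_le.
by rewrite lerB// ler_wpM2r// sqn_ge0.
Qed.

(** Bumps decrease in s, so s times the derivative at the intermediate scale is at most its value at
    the initial scale. The interval from s to 4s has length 3s, whence the 3. *)
Lemma pot_quadruple s z : (0 < s)%R -> adm s z ->
  (J (psiker (4 * s) z) <= J (psiker s z) + 3 * (s * J (kker s z)))%R.
Proof.
move=> s0 a; have [x /andP[sx _]] := pot_MVT 0 s0 (adm_W a) (adm_W a).
rewrite !mul0r !subr0 => E.
have x0 : (0 < x)%R by lra.
have ax : adm x z by apply: adm_le a; exact: ltW.
(* Only two bumps are compared: the third has coefficient 0. *)
have := @kker_compare x s s z z z 0%R x0 s0 s0 ax a a (lexx _).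
rewrite mul0r addr0 => h.
have {}h : (x * J (kker x z) <= s * J (kker s z))%R.
  by apply: h => w; rewrite mul0r addr0 bker_anti// ltW.
have J0 := pairing_kker_ge0 x0 ax.
have : (s * J (kker x z) <= x * J (kker x z))%R by rewrite ler_wpM2r// ltW.
by lra.
Qed.

(** The two bump inequalities bound the difference of the derivatives from both sides by the fixed
    bump at x0; they are assumed for all xi in the interval because the mean value theorem chooses
    it. *)
Lemma pot_quadruple_diff (s s0 : R) z x x0 (c : R) : (0 < s)%R -> (0 < s0)%R -> (0 <= c)%R ->
  adm s z -> adm s x -> adm s0 x0 ->
  (forall xi w, s <= xi <= 4 * s ->
     bker xi z w <= bker xi x w + c * bker s0 x0 w /\
     bker xi x w <= bker xi z w + c * bker s0 x0 w)%R ->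
  (`|J (psiker (4 * s) z) - J (psiker (4 * s) x)| <=
   `|J (psiker s z) - J (psiker s x)| + 3 * c * (s0 * J (kker s0 x0)))%R.
Proof.
move=> sp s0p c0 az ax a0 h.
have [y sy] := pot_MVT 1 sp (adm_W az) (adm_W ax).
rewrite !mul1r => E.
have [sy1 sy2] := andP sy.
have y0 : (0 < y)%R by lra.
have az' : adm y z by apply: adm_le az; exact: ltW.
have ax' : adm y x by apply: adm_le ax; exact: ltW.
have sy' : (s <= y <= 4 * s)%R by rewrite !ltW.
have k1 := @kker_compare y y s0 z x x0 c y0 y0 s0p az' ax' a0 c0 (fun w => (h y w sy').1).
have k2 := @kker_compare y y s0 x z x0 c y0 y0 s0p ax' az' a0 c0 (fun w => (h y w sy').2).
set M := (s0 * J _)%R in k1 k2 *.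
have k3 : (y * `|J (kker y z) - J (kker y x)| <= c * M)%R.
  by rewrite -{1}(gtr0_norm y0) -normrM ler_norml mulrBr; apply/andP; split; lra.
have k4 : (s * `|J (kker y z) - J (kker y x)| <= y * `|J (kker y z) - J (kker y x)|)%R.
  by rewrite ler_wpM2r// ltW.
have k5 : (`|(J (kker y z) - J (kker y x)) * (3 * s)| <= 3 * c * M)%R.
  by rewrite normrM (@ger0_norm _ (3 * s)%R); lra.
rewrite -E in k5.
move: k5; set A := (J (psiker (4 * s) z) - _)%R; set B := (J (psiker s z) - _)%R => k5.
have : (`|A| <= `|B| + `|A - B|)%R.
  by rewrite -{1}(subrKC B A) ler_normD.
by lra.
Qed.

Let mdiff : measurable_fun [set: (borelC R * borelC R)%type]
  ((fun p : borelC R * borelC R => sqn ((p.2 : R[i]) - p.1)%R) : _ -> measurableTypeR R).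
Proof.
by apply: measurable_sqn; apply: measurable_subC; [exact: measurable_snd|exact: measurable_fst].
Qed.

Lemma measurable_pot s : (0 <= s)%R ->
  measurable_fun [set: borelC R] (fun z : borelC R => (J (psiker s z))%:E).
Proof.
move=> s0; rewrite (_ : (fun _ => _) = fubini_F lebC
    (fun p : borelC R * borelC R => v p.2 * (psiker s p.1 p.2)%:E)); last first.
  apply/funext => z; rewrite /fubini_F/= (pairingE (testfun_psiker z s0))//.
  by move=> w; rewrite psiker_ge0.
apply: measurable_fun_fubini_tonelli_F.
  apply: emeasurable_funM; first by apply: measurableT_comp mv _; exact: measurable_snd.
  by apply/measurable_EFinP; apply: measurable_ker_psi; exact: mdiff.
by move=> p; rewrite mule_ge0// lee_fin psiker_ge0.
Qed.

Let mrb e s : measurable_fun [set: (borelC R * borelC R)%type]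
  (fun p : borelC R * borelC R => defect e p.2 * (bker s p.1 p.2)%:E).
Proof.
apply: emeasurable_funM.
  by apply: measurableT_comp (measurable_defect e) _; exact: measurable_snd.
by apply/measurable_EFinP; apply: measurable_ker_b; exact: mdiff.
Qed.

Lemma measurable_riesz e s : measurable_fun [set: borelC R] (fun z : borelC R => riesz e (bker s z)).
Proof.
apply: (@measurable_fun_fubini_tonelli_F _ _ _ _ _ _ _ (mrb e s)).
by move=> p; rewrite mule_ge0 ?defect_ge0// lee_fin bker_ge0.
Qed.

Lemma pairing_psiker_ge0 s z : (0 <= s)%R -> (0 <= J (psiker s z))%R.
Proof.
move=> s0; rewrite -lee_fin -pairingE; [|exact: testfun_psiker|by move=> w; exact: psiker_ge0].
by apply: integral_ge0 => w _; rewrite mule_ge0// lee_fin psiker_ge0.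
Qed.

(** After [pot_quadruple] one has to integrate J(kker s z) over z in B. It is replaced by its
    approximation [riesz e (bker s z)], an integral of a nonnegative function, so that Fubini brings
    the integral over B inside, where [hB] applies. *)
Lemma pot_quadruple_integral (nu : {sigma_finite_measure set (borelC R) -> \bar R})
    (B : set (borelC R)) (s s0 : R) x (c : R) :
  measurable B -> nu B < +oo -> (0 < s)%R -> (0 < s0)%R -> (0 <= c)%R ->
  (forall z, B z -> adm s z) -> adm s0 x ->
  (forall w, \int[nu]_(z in B) (bker s z w)%:E <= (c * bker s0 x w)%:E) ->
  \int[nu]_(z in B) (J (psiker (4 * s) z))%:E <=
  \int[nu]_(z in B) (J (psiker s z))%:E + (3 * c * (s0 * J (kker s0 x)))%:E.
Proof.
move=> mB nuB sp s0p c0 aB ax hB.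
have sp4 : (0 <= 4 * s)%R by lra.
have nuBf : nu B \is a fin_num by rewrite ge0_fin_numE.
pose b := fine (nu B).
have b0 : (0 <= b)%R by rewrite fine_ge0.
(* The first error is that of the fixed bump at x, the second that of the bumps centred in B,
   integrated over B. *)
pose E := (c * (ker_err s0 D * mass) + ker_err s D * mass * b)%R.
have E0 : (0 <= E)%R.
  by rewrite addr_ge0// ?mulr_ge0// ?mulr_ge0 ?mass_ge0// ker_err_ge0// ltW.
have key e : (0 < e <= 1)%R -> (e <= rho)%R ->
  \int[nu]_(z in B) (J (psiker (4 * s) z))%:E <=
  \int[nu]_(z in B) (J (psiker s z))%:E + (3 * c * (s0 * J (kker s0 x)) + E * e)%:E.
  move=> e1 er; have e0 : (0 < e)%R by case/andP: e1.
  have q0 : (0 < (2 * pi * e ^+ 2)^-1 :> R)%R by rewrite invr_gt0 mulr_gt0// exprn_gt0.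
  (* The normalisation for which [q * riesz e (bker s z)] approximates 3 s J(kker s z). *)
  set q := (_^-1)%R in q0.
  have qE : (q * (2 * pi * e ^+ 2) = 1)%R by rewrite mulVf// gt_eqF// mulr_gt0// exprn_gt0.
  have qM (a : R) : (a = q * (2 * pi * e ^+ 2) * a)%R by rewrite qE mul1r.
  have mr := measurable_riesz e s.
  apply: (@le_trans _ _ (\int[nu]_(z in B) ((J (psiker s z))%:E +
     (q%:E * riesz e (bker s z) + (ker_err s D * mass * e)%:E)))).
    apply: ge0_le_integral => //.
    - by move=> z _; rewrite lee_fin pairing_psiker_ge0.
    - by apply: (@measurable_funS _ _ _ _ setT) => //; exact: measurable_pot.
    - apply: (@measurable_funS _ _ _ _ setT) => //.
      apply: emeasurable_funD; first by apply: measurable_pot; exact: ltW.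
      by apply: emeasurable_funD => //; exact: measurable_funeM.
    - move=> z Bz; have := pot_quadruple sp (aB z Bz).
      have [r -> /ler_normlP[+ _]] := riesz_bker sp (adm_W (aB z Bz)) e1 er (aB z Bz).
      rewrite -EFinM -!EFinD lee_fin => h1 h2; apply: (le_trans h2); rewrite lerD2l.
      have : (q * (2 * pi * (3 * s * e ^+ 2 * J (kker s z)) - r) <=
         q * (2 * pi * (ker_err s D * e ^+ 3 * mass)))%R.
        by rewrite ler_wpM2l ?(ltW q0)//; lra.
      rewrite mulrBr.
      have -> : (q * (2 * pi * (3 * s * e ^+ 2 * J (kker s z))) = 3 * (s * J (kker s z)))%R.
        by rewrite [RHS]qM; ring.
      have -> : (q * (2 * pi * (ker_err s D * e ^+ 3 * mass)) = ker_err s D * mass * e)%R.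
        by rewrite [RHS]qM; ring.
      by lra.
  rewrite ge0_integralD//; last 4 first.
  - by move=> z _; rewrite lee_fin pairing_psiker_ge0// ltW.
  - by apply: (@measurable_funS _ _ _ _ setT) => //; apply: measurable_pot; exact: ltW.
  - move=> z _; rewrite adde_ge0// ?lee_fin ?mulr_ge0 ?mass_ge0 ?ker_err_ge0 ?(ltW e0) ?(ltW sp)//.
    by rewrite mule_ge0 ?lee_fin ?(ltW q0)// riesz_ge0// => w; exact: bker_ge0.
  - apply: (@measurable_funS _ _ _ _ setT) => //.
    by apply: emeasurable_funD => //; exact: measurable_funeM.
  apply: leeD => //.
  rewrite ge0_integralD//; last 3 first.
  - by move=> z _; rewrite mule_ge0 ?lee_fin ?(ltW q0)// riesz_ge0// => w; exact: bker_ge0.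
  - by apply: (@measurable_funS _ _ _ _ setT) => //; exact: measurable_funeM.
  - by move=> z _; rewrite lee_fin !mulr_ge0 ?mass_ge0 ?ker_err_ge0 ?(ltW e0) ?(ltW sp).
  have -> : \int[nu]_(z in B) (ker_err s D * mass * e)%:E = (ker_err s D * mass * e * b)%:E.
    by rewrite integral_cst// [RHS]EFinM; congr (_ * _); exact/esym/(fineK nuBf).
  rewrite ge0_integralZl ?lee_fin ?(ltW q0)//; last 2 first.
  - by apply: (@measurable_funS _ _ _ _ setT).
  - by move=> z _; rewrite riesz_ge0// => w; exact: bker_ge0.
  have [r0 R0 hr0] := riesz_bker s0p (adm_W ax) e1 er ax.
  (* For each w the inner integral over z becomes the one bounded in [hB]. *)
  have hR : \int[nu]_(z in B) riesz e (bker s z) <= (c * r0)%:E.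
    rewrite integral_mkcond.
    pose F (p : borelC R * borelC R) := defect e p.2 * (bker s p.1 p.2)%:E * (\1_B p.1)%:E.
    have F0 p : 0 <= F p by rewrite /F !mule_ge0 ?defect_ge0// lee_fin ?bker_ge0.
    have mF : measurable_fun [set: _] F.
      apply: emeasurable_funM; first exact: mrb.
      apply/measurable_EFinP; apply: measurableT_comp; last exact: measurable_fst.
      exact: measurable_indic.
    rewrite (_ : \int[nu]_z _ = \int[nu]_z \int[lebC]_w F (z, w)); last first.
      apply: eq_integral => z _; rewrite patchE /F/= indicE; case: ifP => zB.
        by apply: eq_integral => w _; rewrite mule1.
      by rewrite integral0_eq// => w _; rewrite mule0.
    rewrite (fubini_tonelli F mF F0).
    rewrite EFinM -R0 /riesz -ge0_integralZl ?lee_fin//; last 2 first.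
    - apply: emeasurable_funM; first exact: measurable_defect.
      by apply/measurable_EFinP; exact: measurable_bker.
    - by move=> w _; rewrite mule_ge0 ?defect_ge0// lee_fin bker_ge0.
    apply: ge0_le_integral => //.
    - by move=> w _; apply: integral_ge0.
    - exact: (measurable_fun_fubini_tonelli_G _ mF F0).
    - apply: measurable_funeM; apply: emeasurable_funM; first exact: measurable_defect.
      by apply/measurable_EFinP; exact: measurable_bker.
    - move=> w _; rewrite /F/=.
      under eq_integral do rewrite -muleA.
      rewrite ge0_integralZl ?defect_ge0//; last 2 first.
      + apply: emeasurable_funM; last by apply/measurable_EFinP; exact: measurable_indic.
        apply/measurable_EFinP.
        exact: (@measurable_fun_pair1 _ _ _ _ _ _ _ w (measurable_ker_b s mdiff)).
      + by move=> z _; rewrite mule_ge0// lee_fin bker_ge0.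
      rewrite muleCA lee_wpmul2l ?defect_ge0//.
      apply: le_trans (hB w); rewrite [leRHS]integral_mkcond.
      rewrite le_eqVlt; apply/orP; left; apply/eqP; apply: eq_integral => z _.
      by rewrite patchE indicE; case: ifP => _; rewrite ?mule1 ?mule0.
  apply: (@le_trans _ _ (q%:E * (c * r0)%:E + (ker_err s D * mass * e * b)%:E)).
    by rewrite leeD2r// lee_pmul2l ?lte_fin.
  rewrite -EFinM -EFinD lee_fin.
  have {hr0} hr0 : (q * (c * r0) <= q * (c * (2 * pi * (3 * s0 * e ^+ 2 * J (kker s0 x)) +
     2 * pi * (ker_err s0 D * e ^+ 3 * mass))))%R.
    rewrite ler_wpM2l ?(ltW q0)// ler_wpM2l//.
    by move: hr0; rewrite ler_norml => /andP[_]; lra.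
  apply: (le_trans (lerD hr0 (lexx _))).
  have -> : (q * (c * (2 * pi * (3 * s0 * e ^+ 2 * J (kker s0 x)) +
     2 * pi * (ker_err s0 D * e ^+ 3 * mass))) =
     3 * c * (s0 * J (kker s0 x)) + c * (ker_err s0 D * mass) * e)%R.
    by rewrite [RHS]qM; ring.
  by rewrite /E; lra.
apply/lee_addgt0Pr => d d0.
have E1 : (0 < E + 1)%R by lra.
pose e := (Num.min (Num.min 1 rho) (d / (E + 1)))%R.
have e0 : (0 < e)%R by rewrite !lt_min ltr01 rho0 divr_gt0.
have e1 : (0 < e <= 1)%R by rewrite e0 !ge_min lexx.
have er : (e <= rho)%R by rewrite !ge_min lexx orbT.
apply: (le_trans (key e e1 er)); rewrite -[leRHS]addeA; apply: leeD => //.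
rewrite -EFinD lee_fin lerD2l.
have : (e <= d / (E + 1))%R by rewrite !ge_min lexx orbT.
by rewrite ler_pdivlMr// => h1; nra.
Qed.

End potential.

(** * Dilations and the total mass of the kernels *)

Section dilation.
Context {R : realType}.
Local Open Scope ereal_scope.
Local Notation mu := (@lebesgue_measure R).

Lemma measurable_mull (a : R) :
  measurable_fun [set: measurableTypeR R] (fun x => (a * x)%R : measurableTypeR R).
Proof. by apply: measurable_funM => //; exact: measurable_id. Qed.

Lemma lebesgue_measure_dilate (a : R) (A : set (measurableTypeR R)) :
  (0 < a)%R -> measurable A ->
  mu ((fun x => (a * x)%R) @^-1` A) = (a^-1)%:E * mu A.
Proof.
move=> a0 mA.
have ai : (0 <= a)%R by exact: ltW.
pose m : {measure set (measurableTypeR R) -> \bar R} :=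
  mscale (NngNum ai) (measure_function_pushforward__canonical__measure_function_Measure
    mu (measurable_mull a)).
have mE : mu A = m A.
  apply: (@lebesgue_measure_unique _ m) => //= _ [[b c]] _ <-.
  rewrite /m /mscale/= /pushforward/= (_ : _ @^-1` _ = `](b / a)%R, (c / a)%R]%classic).
    rewrite !lebesgue_measure_itv/= !lte_fin ltr_pM2r ?invr_gt0//.
    case: ifP => _; last by rewrite mule0.
    by rewrite -!EFinD -EFinM; congr EFin; field; rewrite gt_eqF.
  apply/seteqP; split => x /=; rewrite !in_itv/=.
    by rewrite ltr_pdivrMr// ler_pdivlMr// ![(_ * a)%R]mulrC.
  by rewrite ltr_pdivrMr// ler_pdivlMr// ![(_ * a)%R]mulrC.
by rewrite mE /m /mscale/= muleA -EFinM mulVf ?gt_eqF// mul1e.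
Qed.

Lemma ge0_integral_dilate (a : R) (g : measurableTypeR R -> \bar R) : (0 < a)%R ->
  measurable_fun [set: measurableTypeR R] g -> (forall x, 0 <= g x) ->
  \int[mu]_x g (a * x)%R = (a^-1)%:E * \int[mu]_x g x.
Proof.
move=> a0 mg g0.
have ai : (0 <= a^-1)%R by rewrite invr_ge0 ltW.
have := ge0_integral_pushforward (measurable_mull a) mu measurableT mg.
rewrite preimage_setT => <-; last by move=> y _; exact: g0.
rewrite -(ge0_integral_mscale mu measurableT (NngNum ai))//.
apply: eq_measure_integral => [|? A mA _]; first exact: measurable_mull.
exact: (lebesgue_measure_dilate a0 mA).
Qed.

Lemma lebC_dilate (a : R) (g : borelC R -> \bar R) : (0 < a)%R ->
  measurable_fun [set: borelC R] g -> (forall z, 0 <= g z) ->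
  \int[lebC]_z g (a%:C * z)%R = (a ^- 2)%:E * \int[lebC]_z g z.
Proof.
move=> a0 mg g0.
have mga : measurable_fun [set: borelC R] (fun z : borelC R => g (a%:C * z)%R).
  apply: measurableT_comp mg _; apply: measurable_mulC; first exact: measurable_cst.
  exact: measurable_id.
rewrite (integral_lebC_yx mga)// (integral_lebC_yx mg)//.
have mcx : measurable_fun [set: (measurableTypeR R * measurableTypeR R)%type] (g \o toC).
  by apply: measurableT_comp mg _; exact: measurable_toC.
pose G (x : measurableTypeR R) := \int[mu]_y g (Complex x y).
have mG : measurable_fun [set: measurableTypeR R] G.
  apply: (measurable_fun_fubini_tonelli_F (m2 := mu) _ mcx) => p; exact: g0.
have G0 x : 0 <= G x by exact: integral_ge0.
transitivity (\int[mu]_x ((a^-1)%:E * G (a * x)%R)).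
  apply: eq_integral => x _; rewrite /G -ge0_integral_dilate//; last first.
    apply: measurableT_comp mg _; apply: measurable_complex; first exact: measurable_cst.
    exact: measurable_id.
  by apply: eq_integral => y _; congr (g (Complex _ _)); ring.
have mGa : measurable_fun [set: measurableTypeR R] (fun x => G (a * x)%R).
  by apply: measurableT_comp mG _; exact: measurable_mull.
have ai : 0 <= (a^-1)%:E by rewrite lee_fin invr_ge0 ltW.
rewrite (ge0_integralZl mu measurableT mGa (fun x _ => G0 _) ai).
rewrite ge0_integral_dilate// muleA -EFinM; congr (_%:E * _).
by rewrite expr2 invfM.
Qed.

Definition cpsi (s : R) : \bar R := \int[lebC]_w (ker_psi s (sqn w))%:E.

Lemma measurable_ker_psi_sqn (s : R) : measurable_fun [set: borelC R]
  ((fun w => ker_psi s (sqn w)) : borelC R -> measurableTypeR R).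
Proof. by apply: measurable_ker_psi; apply: measurable_sqn; exact: measurable_id. Qed.

Lemma ker_psi_ge0 (s u : R) : (0 <= s)%R -> (0 <= ker_psi s u)%R.
Proof. by move=> s0; rewrite /ker_psi mulr_ge0// exprn_ge0// pos_ge0. Qed.

(** The factor s in [ker_psi] compensates the Jacobian of the dilation by the square root of s. *)
Lemma cpsiE (s : R) : (0 < s)%R -> cpsi s = cpsi 1.
Proof.
move=> s0; rewrite /cpsi; pose q := Num.sqrt s.
have q0 : (0 < q)%R by rewrite sqrtr_gt0.
have q2 : (q ^+ 2 = s)%R by rewrite sqr_sqrtr// ltW.
transitivity (\int[lebC]_w (s%:E * (fun w : borelC R => (ker_psi 1 (sqn w))%:E) (q%:C * w)%R)).
  apply: eq_integral => w _ /=; rewrite -EFinM; congr EFin.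
  by rewrite /ker_psi sqnM (_ : sqn (q%:C) = s)%R ?mul1r// /sqn/= expr0n addr0.
have m1 : measurable_fun [set: borelC R] (fun w : borelC R => (ker_psi 1 (sqn w))%:E).
  by apply/measurable_EFinP; exact: measurable_ker_psi_sqn.
have g1 (z : borelC R) : 0 <= (ker_psi (1 : R)%R (sqn z))%:E by rewrite lee_fin; exact: ker_psi_ge0.
have m2 : measurable_fun [set: borelC R]
    (fun w : borelC R => (ker_psi 1 (sqn (q%:C * (w : R[i]))%R))%:E).
  have m3 : measurable_fun [set: borelC R] ((fun w => q%:C * (w : R[i]))%R : borelC R -> borelC R).
    by apply: measurable_mulC; [exact: measurable_cst|exact: measurable_id].
  exact: measurableT_comp m1 m3.
rewrite (ge0_integralZl lebC measurableT m2 (fun z _ => g1 _)) ?lee_fin ?(ltW s0)//.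
by rewrite (lebC_dilate q0 m1 g1) muleA -EFinM q2 divff ?gt_eqF// mul1e.
Qed.

Lemma cpsi_gt0 (s : R) : (0 < s)%R -> 0 < cpsi s.
Proof.
(* On the square of half-side h, |w|^2 <= 2h^2 <= 2h, hence s|w|^2 <= 1/2 and the kernel is at least
   s/4. *)
move=> s0; pose h := (Num.min 1 ((4 * s)^-1))%R.
have h0 : (0 < h)%R by rewrite lt_min ltr01 invr_gt0 mulr_gt0.
have hs : (h * (4 * s) <= 1)%R.
  by rewrite -ler_pdivlMr ?mulr_gt0// div1r ge_min lexx orbT.
have h1 : (h <= 1)%R by rewrite ge_min lexx.
pose Q : set (borelC R) := [set z | (complex.Re z \in `[-h, h]%R) && (complex.Im z \in `[-h, h]%R)].
have mQ : measurable Q by exact: measurable_rect.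
apply: (@lt_le_trans _ _ (\int[lebC]_(w in Q) (s / 4)%:E)).
  rewrite integral_cst// mule_gt0 ?lte_fin ?divr_gt0//.
  have : 0 < lebC Q by rewrite /Q lebC_rect ?lte_fin ?mulr_gt0//; lra.
  by [].
apply: (@le_trans _ _ (\int[lebC]_(w in Q) (ker_psi s (sqn w))%:E)); last first.
  apply: ge0_subset_integral => //; first (by apply/measurable_EFinP; exact: measurable_ker_psi_sqn).
  by move=> w _; rewrite lee_fin ker_psi_ge0// ltW.
apply: ge0_le_integral => //.
- by move=> w _; rewrite lee_fin divr_ge0// ltW.
- by apply: (@measurable_funS _ _ _ _ setT) => //; apply/measurable_EFinP; exact: measurable_ker_psi_sqn.
move=> w /andP[]; rewrite !in_itv/= => /andP[x1 x2] /andP[y1 y2].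
rewrite lee_fin /ker_psi ler_wpM2l ?(ltW s0)//.
have wh : (sqn w <= 2 * h)%R by rewrite /sqn; nra.
have sw : (s * sqn w <= 1 / 2)%R.
  have : (s * sqn w <= s * (2 * h))%R by rewrite ler_wpM2l// ltW.
  by move=> /le_trans; apply; lra.
have : (1 / 2 <= pos (1 - s * sqn w))%R by case: (posP (1 - s * sqn w)) => -[p0 ->]; lra.
set p := pos _ => p0; nra.
Qed.

Lemma cpsi_lty (s : R) : (0 < s)%R -> cpsi s < +oo.
Proof.
(* Both h >= 1 and s h >= 1, so s h^2 >= 1 and the kernel vanishes outside the square. *)
move=> s0; pose h := (s^-1 + 1)%R.
have h0 : (0 < h)%R by rewrite addr_gt0// invr_gt0.
have hs : (1 <= s * h)%R by rewrite mulrDr mulr1 divff ?gt_eqF// lerDl ltW.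
pose Q : set (borelC R) := [set z | (complex.Re z \in `[-h, h]%R) && (complex.Im z \in `[-h, h]%R)].
have mQ : measurable Q by exact: measurable_rect.
apply: (@le_lt_trans _ _ (\int[lebC]_(w in Q) s%:E)); last first.
  rewrite integral_cst//.
  have : lebC Q < +oo by rewrite /Q lebC_rect ?ltry//; lra.
  by move=> Qoo; apply: lte_mul_pinfty => //; rewrite lee_fin ltW.
rewrite [leRHS]integral_mkcond; apply: ge0_le_integral => //.
- by move=> w _; rewrite lee_fin ker_psi_ge0// ltW.
- apply/measurable_EFinP; exact: measurable_ker_psi_sqn.
- by apply/(measurable_restrictT _ _).1 => //; exact: measurable_cst.
move=> w _; rewrite patchE; case: ifPn => [_|].
  have /andP[a b] := ker_pos_itv (ltW s0) (sqn_ge0 w).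
  by rewrite lee_fin -[leRHS]mulr1 ler_wpM2l ?(ltW s0)// exprn_ile1.
move=> /negP; rewrite inE => nQ; rewrite lee_fin.
have swh : (h ^+ 2 <= sqn w)%R.
  rewrite leNgt; apply/negP => wh; apply: nQ; rewrite /Q/= !in_itv/= -!ler_norml.
  by rewrite -normc_lt in wh; rewrite // !(le_trans _ (ltW wh)) ?abs_Re_le ?abs_Im_le.
have : (1 - s * sqn w <= 0)%R.
  rewrite subr_le0; apply: (@le_trans _ _ (s * h ^+ 2)%R); last by rewrite ler_wpM2l// ltW.
  have h1 : (1 <= h)%R by rewrite /h lerDr invr_ge0 ltW.
  by rewrite expr2 mulrA -[leLHS]mulr1 ler_pM.
by rewrite /ker_psi /pos => p0; rewrite max_l// expr0n mulr0.
Qed.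

End dilation.

(** * Oscillation of a superharmonic function on a regular set *)

Section regular_measure.
Context {R : realType}.
Local Open Scope ereal_scope.
Local Notation mu := (@lebesgue_measure R).
Local Notation I := (`[0%R, (2 * pi)%R]%classic : set (measurableTypeR R)).
Variables (v : borelC R -> \bar R) (W : set R[i]) (D rho : R).
Hypothesis mv : measurable_fun [set: borelC R] v.
Hypothesis v0 : forall w, 0 <= v w.
Hypothesis vfin : \int[lebC]_w v w < +oo.
Hypothesis D0 : (0 <= D)%R.
Hypothesis vD : forall w z, v w != 0 -> W z -> (sqn (w - z) <= D ^+ 2)%R.
Hypothesis super : forall z (r : R), W z -> (0 < r <= rho)%R ->
  \int[mu]_(t in I) v (z + r%:C * cis t)%R <= (2 * pi)%:E * v z.
Hypothesis rho0 : (0 < rho)%R.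
Variables (K : set R[i]) (R1 : R).
Hypothesis R10 : (0 < R1)%R.
Hypothesis KW : forall x w, K x -> (sqn (w - x) < R1 ^+ 2)%R -> W w.
Hypothesis vlsc : forall z (c : R), K z -> c%:E < v z ->
  exists2 e : R, (0 < e)%R & forall w, disk z e w -> c%:E < v w.

Local Notation J := (pairing v).
Definition pot (v : borelC R -> \bar R) (r : R) (z : borelC R) : R := pairing v (psiker (r ^- 2) z).
Local Notation V := (pot v).

Let r20 (r : R) : (0 < r)%R -> (0 < r ^- 2)%R.
Proof. by move=> r0; rewrite invr_gt0 exprn_gt0. Qed.

Lemma invsq_lt1 (r u : R) : (0 < r)%R -> (r ^- 2 * u < 1)%R = (u < r ^+ 2)%R.
Proof. by move=> r0; rewrite mulrC ltr_pdivrMr ?exprn_gt0// mul1r. Qed.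

Lemma adm_K z (r : R) : K z -> (0 < r <= R1)%R -> adm W (r ^- 2) z.
Proof.
move=> Kz /andP[r0 r1] w; rewrite invsq_lt1// => h; apply: KW Kz _.
by apply: (lt_le_trans h); rewrite lerXn2r ?nnegrE ?(ltW r0) ?(ltW R10).
Qed.

Definition kappa : R := fine (@cpsi R 1).

Lemma kappaE : (@cpsi R 1) = kappa%:E.
Proof.
by rewrite /kappa fineK// ge0_fin_numE ?cpsi_lty// ltW// cpsi_gt0.
Qed.

Lemma kappa_gt0 : (0 < kappa)%R.
Proof. by rewrite -lte_fin -kappaE cpsi_gt0. Qed.

Lemma pot_shift r z : (0 < r)%R ->
  (V r z)%:E = \int[lebC]_w ((ker_psi (r ^- 2) (sqn w))%:E * v (z + w)%R).
Proof.
move=> r0; rewrite /pot -(pairingE mv v0 vfin (testfun_psiker v z (ltW (r20 r0)))); last first.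
  by move=> w; rewrite psiker_ge0// ltW// r20.
have mg : measurable_fun [set: borelC R] (fun w => v w * (psiker (r ^- 2) z w)%:E).
  by apply: emeasurable_funM => //; apply/measurable_EFinP; exact: measurable_psiker.
rewrite -(lebC_shift mg _ z); last first.
  by move=> w; rewrite mule_ge0// lee_fin psiker_ge0// ltW// r20.
apply: eq_integral => w _; rewrite muleC /psiker; congr ((ker_psi _ (sqn _))%:E * _).
by rewrite addrAC subrr add0r.
Qed.

Lemma pot_le z r : W z -> (0 < r <= rho)%R -> (V r z)%:E <= kappa%:E * v z.
Proof.
move=> Wz /andP[r0 rr]; rewrite pot_shift// -kappaE -(cpsiE (r20 r0)).
apply: (@ge0_supermean_disk _ (ker_psi (r ^- 2)) v z r) => //.
- by apply: measurable_ker_psi; exact: measurable_id.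
- by move=> u; apply: ker_psi_ge0; rewrite ltW// r20.
- by move=> t /andP[t0 tr]; apply: super => //; rewrite t0 (le_trans tr).
- exact: ltW.
- move=> u ur; rewrite /ker_psi /pos max_l ?expr0n ?mulr0//.
  by rewrite subr_le0 leNgt invsq_lt1// -leNgt ltW.
Qed.

(** By lower semicontinuity v > c near z, and a kernel of small radius sees nothing else. *)
Lemma pot_ge z (c : R) : K z -> (0 <= c)%R -> c%:E < v z ->
  exists2 e : R, (0 < e)%R & forall r, (0 < r <= e)%R -> (kappa * c <= V r z)%R.
Proof.
move=> Kz c0 cv; have [e e0 he] := vlsc Kz cv.
exists e => // r /andP[r0 re]; rewrite -lee_fin pot_shift// EFinM -kappaE -(cpsiE (r20 r0)).
have psi0 w : (0 <= ker_psi (r ^- 2) (sqn w))%R by apply: ker_psi_ge0; rewrite ltW// r20.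
rewrite -ge0_integralZr ?lee_fin//; last 2 first.
- by apply/measurable_EFinP; exact: measurable_ker_psi_sqn.
- by move=> w _; rewrite lee_fin.
apply: ge0_le_integral => //.
- by move=> w _; rewrite mule_ge0// lee_fin.
- by apply: emeasurable_funM; [apply/measurable_EFinP; exact: measurable_ker_psi_sqn|exact: measurable_cst].
- apply: emeasurable_funM; first by apply/measurable_EFinP; exact: measurable_ker_psi_sqn.
  apply: measurableT_comp mv _; apply: measurable_addC; first exact: measurable_cst.
  exact: measurable_id.
move=> w _; have [wr|wr] := ltP (sqn w) (r ^+ 2)%R.
  apply: lee_wpmul2l; first by rewrite lee_fin.
  apply: ltW; apply: he; rewrite /disk /mkset (_ : z + w - z = w)%R; last by rewrite addrAC subrr add0r.
  by rewrite normc_lt//; apply: (lt_le_trans wr); rewrite lerXn2r ?nnegrE ?(ltW r0) ?(ltW e0).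
rewrite (_ : ker_psi _ _ = 0)%R ?mul0e//.
by rewrite /ker_psi /pos max_l ?expr0n ?mulr0// subr_le0 leNgt invsq_lt1// -leNgt.
Qed.

Let half_sq (r : R) : (4 * r ^- 2 = (r / 2) ^- 2)%R.
Proof. by rewrite expr_div_n invf_div; congr (_ * _)%R; ring. Qed.

Lemma pot_half z (r : R) : K z -> (0 < r <= R1)%R -> (V r z <= V (r / 2) z)%R.
Proof.
move=> Kz rr; have /andP[r0 r1] := rr; have s0 := r20 r0.
have a := adm_K Kz rr.
have [xi /andP[x1 x2]] := pot_MVT mv v0 vfin vD 0 s0 (adm_W a) (adm_W a).
rewrite !mul0r !subr0 half_sq => E.
have xi0 : (0 < xi)%R := lt_trans s0 x1.
have := pairing_kker_ge0 mv v0 vfin D0 vD super rho0 xi0 (adm_le (ltW x1) a).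
by move=> J0; rewrite -subr_ge0 /pot E mulr_ge0// mulr_ge0// ltW.
Qed.

Lemma pot_nd z (r : R) : K z -> (0 < r <= R1)%R ->
  nondecreasing_seq (fun n => V (r / 2 ^+ n) z).
Proof.
move=> Kz /andP[r0 r1]; apply/nondecreasing_seqP => n.
have -> : (r / 2 ^+ n.+1 = r / 2 ^+ n / 2)%R by rewrite exprS invfM mulrCA mulrC.
apply: pot_half => //.
rewrite divr_gt0 ?exprn_gt0//= (le_trans _ r1)// ler_pdivrMr ?exprn_gt0//.
by rewrite ler_peMr ?(ltW r0)// exprn_ege1// ler1n.
Qed.

(** By monotonicity the limit is a supremum. It is compared with kappa c for every real c < v z,
    which also covers the points where v is +oo. *)
Lemma pot_cvg z (r : R) : K z -> (0 < r)%R -> (r <= R1)%R -> (r <= rho)%R ->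
  (V (r / 2 ^+ n) z)%:E @[n --> \oo] --> kappa%:E * v z.
Proof.
move=> Kz r0 r1 rr.
have k0 := kappa_gt0.
have rr1 : (0 < r <= R1)%R by rewrite r0.
have Wz : W z := adm_W (adm_K Kz rr1).
have nd : nondecreasing_seq (fun n => (V (r / 2 ^+ n) z)%:E).
  by move=> m n mn; rewrite lee_fin; exact: (pot_nd Kz rr1 mn).
have rn n : (0 < r / 2 ^+ n <= r)%R.
  rewrite divr_gt0 ?exprn_gt0//= ler_pdivrMr ?exprn_gt0//.
  by rewrite ler_peMr ?(ltW r0)// exprn_ege1// ler1n.
suff -> : kappa%:E * v z = ereal_sup (range (fun n => (V (r / 2 ^+ n) z)%:E)).
  exact: ereal_nondecreasing_cvgn.
apply/eqP; rewrite eq_le; apply/andP; split; last first.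
  apply: ge_ereal_sup => _ [n _ <-]; apply: pot_le => //.
  by have /andP[-> h] := rn n; rewrite (le_trans h).
have V0 n : (0 <= V (r / 2 ^+ n) z)%R.
  by apply: pairing_psiker_ge0 => //; apply: ltW; apply: r20; case/andP: (rn n).
have sup0 : 0 <= ereal_sup (range (fun n => (V (r / 2 ^+ n) z)%:E)).
  apply: (@le_trans _ _ (V (r / 2 ^+ 0) z)%:E); first by rewrite lee_fin.
  by apply: ereal_sup_ubound; exists 0%N.
have main (c : R) : (0 <= c)%R -> c%:E < v z ->
    (kappa * c)%:E <= ereal_sup (range (fun n => (V (r / 2 ^+ n) z)%:E)).
  move=> c0 /(pot_ge Kz c0)[e e0 he].
  have [n ne] : exists n, (r / 2 ^+ n <= e)%R.
    exists (Num.truncn (r / e)).+1; rewrite ler_pdivrMr ?exprn_gt0// mulrC -ler_pdivrMr//.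
    apply: (le_trans (ltW (truncnS_gt _))).
    by rewrite -natrX ler_nat ltnW// ltn_expl.
  apply: (@le_trans _ _ (V (r / 2 ^+ n) z)%:E); last by apply: ereal_sup_ubound; exists n.
  by rewrite lee_fin he// ne andbT; case/andP: (rn n).
move: sup0 main; case: (ereal_sup _) => [S|_ _|//]; last by rewrite leey.
rewrite lee_fin => S0 main; rewrite leNgt; apply/negP => Sv.
have [c Sc cv] : exists2 c : R, (S / kappa < c)%R & c%:E < v z.
  move: (v0 z) Sv; case: (v z) => [x| |] // x0.
    rewrite -EFinM lte_fin mulrC -ltr_pdivrMr// => Sx.
    by exists ((S / kappa + x) / 2)%R; rewrite ?lte_fin; lra.
  by move=> _; exists (S / kappa + 1)%R; rewrite ?ltry// ltrDl.
have c0 : (0 <= c)%R by apply: le_trans (ltW Sc); rewrite divr_ge0// ltW.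
have := main c c0 cv; rewrite lee_fin leNgt => /negP; apply.
by rewrite mulrC -ltr_pdivrMr.
Qed.

(** * Integration over K against a measure of growth t^d *)

Variables (nu : {sigma_finite_measure set (borelC R) -> \bar R}) (a d T0 : R).
Hypothesis a0 : (0 <= a)%R.
Hypothesis d0 : (0 < d)%R.
Hypothesis mK : measurable (K : set (borelC R)).
Hypothesis nuK : forall w (t : R), (0 < t <= T0)%R -> nu (K `&` disk w t) <= (a * t `^ d)%:E.

(** The bound of [kker_le] at the fixed scale R1. Up to a constant it bounds, uniformly in x in K,
    the Riesz measure tested on the bump of radius R1 at x. *)
Definition riesz_bound : R := (R1 ^- 2 * ((1 + 2 * R1 ^- 2 * D ^+ 2) * mass v))%R.
Local Notation M := riesz_bound.

Lemma riesz_bound_ge x : K x -> (R1 ^- 2 * J (kker (R1 ^- 2) x) <= M)%R.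
Proof.
move=> Kx; have s0 := ltW (r20 R10).
have rr : (0 < R1 <= R1)%R by rewrite R10 lexx.
have Wx := adm_W (adm_K Kx rr).
rewrite /M ler_wpM2l// (le_trans (ler_norm _))// (pairing_bound mv v0 vfin)//.
  exact: (testfun_kker vD).
by move=> w vw; exact: (kker_le vD Wx s0 vw).
Qed.

Lemma riesz_bound_ge0 : (0 <= M)%R.
Proof.
have s0 := ltW (r20 R10).
rewrite /M; apply: mulr_ge0 => //; apply: mulr_ge0; last exact: mass_ge0.
by apply: addr_ge0 => //; apply: mulr_ge0; [exact: mulr_ge0|exact: sqr_ge0].
Qed.

Lemma bker_eq0 z w (r : R) : (0 < r)%R -> (r ^+ 2 <= sqn (w - z))%R -> bker (r ^- 2) z w = 0%R.
Proof.
move=> r0 h; rewrite /bker /ker_b /pos max_l ?expr0n//.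
by rewrite subr_le0 leNgt invsq_lt1// -leNgt.
Qed.

(** Within half the radius R1 the fixed bump is at least (3/4)^3. It can thus majorise, with a
    factor 4, the indicator of any disk lying there. *)
Lemma bker_ge_quarter x w (t : R) : (0 < t)%R -> (4 * t <= R1)%R ->
  (sqn (w - x) <= (2 * t) ^+ 2)%R -> (1 / 4 <= bker (R1 ^- 2) x w)%R.
Proof.
move=> t0 tR h; rewrite /bker /ker_b; set u := sqn _ in h *.
have u1 : (R1 ^- 2 * u <= 1 / 4)%R.
  rewrite mulrC ler_pdivrMr ?exprn_gt0// (le_trans h)//.
  have : ((4 * t) ^+ 2 <= R1 ^+ 2)%R by rewrite lerXn2r ?nnegrE ?(ltW R10) ?mulr_ge0 ?(ltW t0).
  by rewrite !exprMn; lra.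
have p1 : (3 / 4 <= pos (1 - R1 ^- 2 * u))%R by case: (posP (1 - R1 ^- 2 * u)) => -[? ->]; lra.
have : ((3 / 4) ^+ 3 <= pos (1 - R1 ^- 2 * u) ^+ 3)%R.
  by rewrite lerXn2r ?nnegrE ?pos_ge0//; lra.
by lra.
Qed.

Lemma measurable_disk x (r : R) : measurable (disk x r : set (borelC R)).
Proof. by apply: measurable_open; exact: disk_open. Qed.

Lemma measurable_ball x (r : R) : measurable (K `&` disk x r : set (borelC R)).
Proof. by apply: measurableI => //; exact: measurable_disk. Qed.

(** A bump is at most the indicator of its disk, so [nuK] bounds the integral. It vanishes unless w
    is within 2t of x, where the fixed bump is at least 1/4. *)
Lemma integral_bker x w (r t : R) : K x -> (0 < r <= t)%R -> (4 * t <= R1)%R -> (r <= T0)%R ->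
  \int[nu]_(z in K `&` disk x t) (bker (r ^- 2) z w)%:E <=
  (4 * (a * r `^ d) * bker (R1 ^- 2) x w)%:E.
Proof.
move=> Kx /andP[r0 rt] tR rT; have t0 : (0 < t)%R := lt_le_trans r0 rt.
have ar0 : (0 <= a * r `^ d)%R by rewrite mulr_ge0// powR_ge0.
have mB := measurable_ball x t.
have [wx|wx] := ltP (sqn (w - x)%R) ((2 * t) ^+ 2)%R; last first.
  rewrite integral0_eq; first by rewrite lee_fin mulr_ge0 ?bker_ge0// mulr_ge0.
  move=> z [_ zx]; rewrite bker_eq0// -normc_sqr lerXn2r ?nnegrE ?normc_ge0 ?(ltW r0)//.
  have h1 : (2 * t <= normc (w - x))%R.
    by rewrite leNgt normc_lt ?mulr_gt0// -leNgt.
  have := normc_dist_triangle w z x; move: zx; rewrite /disk /mkset => zx; lra.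
have hq := bker_ge_quarter t0 tR (ltW wx).
apply: (@le_trans _ _ (nu (K `&` disk w r))); last first.
  have rT' : (0 < r <= T0)%R by rewrite r0.
  by apply: (le_trans (nuK w rT')); rewrite lee_fin; nra.
have mD := measurable_disk w r.
apply: (@le_trans _ _ (\int[nu]_(z in K `&` disk x t) (\1_(disk w r : set (borelC R)) z)%:E)).
  apply: ge0_le_integral => //.
  - by move=> z _; rewrite lee_fin bker_ge0.
  - apply/measurable_EFinP; apply: (@measurable_funS _ _ _ _ setT) => //.
    apply: measurable_ker_b; apply: measurable_sqn; apply: measurable_subC; first exact: measurable_cst.
    exact: measurable_id.
  - by apply/measurable_EFinP; exact: measurable_indic.
  move=> z _; rewrite lee_fin indicE; case: (boolP (z \in _)) => zw.
    by rewrite bker_le1// ltW// r20.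
  rewrite bker_eq0//; move: zw => /negP; rewrite inE /disk /mkset => zw.
  rewrite leNgt -normc_lt//; apply/negP; rewrite -normcN opprB; exact: zw.
rewrite integral_indic// le_measure// ?inE.
- by apply: measurableI.
- by apply: measurableI.
- by move=> z [zw [Kz _]].
Qed.

Definition dyadic_ratio : R := ((2^-1 : R) `^ d)%R.
Local Notation q := dyadic_ratio.

(** Positivity of d gives q < 1, so that the contributions of ever smaller scales are summable. *)
Lemma dyadic_ratio_itv : (0 < q < 1)%R.
Proof.
rewrite powR_gt0 ?invr_gt0//=.
have <- : (1 `^ d = 1 :> R)%R by rewrite powR1.
by apply: gt0_ltr_powR; rewrite ?nnegrE ?invr_ge0// invf_lt1// ltr1n.
Qed.

Lemma powR_dyadic (r : R) n : (0 < r)%R -> ((r / 2 ^+ n) `^ d = r `^ d * q ^+ n)%R.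
Proof.
move=> r0; rewrite powRM ?(ltW r0) ?invr_ge0 ?exprn_ge0//; congr (_ * _)%R.
rewrite -exprVn; elim: n => [|n IH]; first by rewrite !expr0 powR1.
by rewrite !exprS powRM ?exprn_ge0 ?invr_ge0// IH.
Qed.

(** Here 12 is the 3 of [pot_quadruple_integral] times the 4 of [integral_bker], and the quotient is
    the sum of the geometric series. *)
Definition growth : R := (12 * M * a / (1 - q))%R.

Lemma nuB_lty x (r : R) : K x -> (0 < r <= T0)%R -> nu (K `&` disk x r) < +oo.
Proof. by move=> Kx rT; apply: (le_lt_trans (nuK x rT)); rewrite ltry. Qed.

(** The ball keeps its radius r while the scale t of the kernel is halved; each halving costs 12 M a
    t^d. *)
Lemma integral_pot_dyadic x (r : R) n : K x -> (0 < r)%R -> (4 * r <= R1)%R -> (r <= T0)%R ->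
  \int[nu]_(z in K `&` disk x r) (V (r / 2 ^+ n) z)%:E <=
  \int[nu]_(z in K `&` disk x r) (V r z)%:E +
  (12 * M * a * r `^ d * \sum_(i < n) q ^+ i)%:E.
Proof.
move=> Kx r0 rR rT.
have mB := measurable_ball x r.
have rT' : (0 < r <= T0)%R by rewrite r0.
elim: n => [|n IH].
  by rewrite big_ord0 mulr0 adde0 expr0 divr1.
set t := (r / 2 ^+ n)%R in IH.
have t0 : (0 < t)%R by rewrite divr_gt0// exprn_gt0.
have tr : (t <= r)%R.
  by rewrite ler_pdivrMr ?exprn_gt0// ler_peMr ?(ltW r0)// exprn_ege1// ler1n.
have tR : (0 < t <= R1)%R by rewrite t0/=; lra.
have RR : (0 < R1 <= R1)%R by rewrite R10 lexx.
have tE : (r / 2 ^+ n.+1 = t / 2)%R by rewrite exprS invfM mulrCA mulrC.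
have c0 : (0 <= 4 * (a * t `^ d))%R by rewrite mulr_ge0// mulr_ge0// powR_ge0.
have := @pot_quadruple_integral R v W D rho mv v0 vfin D0 vD super rho0 nu
  (K `&` disk x r) (t ^- 2) (R1 ^- 2) x (4 * (a * t `^ d)) mB (nuB_lty Kx rT')
  (r20 t0) (r20 R10) c0 (fun z Bz => adm_K Bz.1 tR) (adm_K Kx RR)
  (fun w => integral_bker w Kx _ rR _).
rewrite t0 tr => /(_ isT (le_trans tr rT)).
rewrite half_sq tE => /le_trans; apply.
apply: (@le_trans _ _ ((\int[nu]_(z in K `&` disk x r) (V r z)%:E +
  (12 * M * a * r `^ d * \sum_(i < n) q ^+ i)%:E) + (12 * M * a * r `^ d * q ^+ n)%:E)).
  apply: leeD; first exact: IH.
  rewrite lee_fin /t powR_dyadic//.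
  have q0 : (0 <= q ^+ n)%R by rewrite exprn_ge0// powR_ge0.
  rewrite (_ : 12 * M * a * r `^ d * q ^+ n = 3 * (4 * (a * (r `^ d * q ^+ n))) * M)%R; last by ring.
  rewrite ler_wpM2l ?riesz_bound_ge//.
  by rewrite mulr_ge0// mulr_ge0// mulr_ge0// mulr_ge0// powR_ge0.
by rewrite -addeA -EFinD big_ord_recr/= mulrDr.
Qed.

Lemma geometric_le n : (\sum_(i < n) q ^+ i <= (1 - q)^-1)%R.
Proof.
have /andP[q0 q1] := dyadic_ratio_itv.
have q1' : (0 < 1 - q)%R by rewrite subr_gt0.
rewrite -(ler_pM2l q1') divff ?gt_eqF//.
have := subrX1 q n; have : (0 <= q ^+ n)%R by rewrite exprn_ge0// ltW.
set S := (\sum_(i < n) _)%R; lra.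
Qed.

Lemma growth_ge0 : (0 <= growth)%R.
Proof.
have /andP[q0 q1] := dyadic_ratio_itv.
rewrite /growth mulr_ge0 ?invr_ge0 ?subr_ge0 ?(ltW q1)//.
by rewrite mulr_ge0// mulr_ge0// riesz_bound_ge0.
Qed.

Lemma integral_v_ball x (r : R) : K x -> (0 < r)%R -> (4 * r <= R1)%R ->
  (r <= rho)%R -> (r <= T0)%R ->
  \int[nu]_(z in K `&` disk x r) (kappa%:E * v z) <=
  \int[nu]_(z in K `&` disk x r) (V r z)%:E + (growth * r `^ d)%:E.
Proof.
move=> Kx r0 rR rr rT.
have mB := measurable_ball x r.
have rR' : (r <= R1)%R by lra.
have rn n : (0 < r / 2 ^+ n)%R by rewrite divr_gt0// exprn_gt0.
have V0 n z : (0 <= V (r / 2 ^+ n) z)%R.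
  by apply: pairing_psiker_ge0 => //; apply: ltW; apply: r20.
have mV n : measurable_fun (K `&` disk x r : set (borelC R)) (fun z => (V (r / 2 ^+ n) z)%:E).
  apply: (@measurable_funS _ _ _ _ setT) => //.
  by apply: measurable_pot => //; apply: ltW; apply: r20.
pose g n z := (V (r / 2 ^+ n) z)%:E.
have -> : \int[nu]_(z in K `&` disk x r) (kappa%:E * v z) =
    \int[nu]_(z in K `&` disk x r) limn (g^~ z).
  apply: eq_integral => z; rewrite inE => -[Kz _]; apply/esym/cvg_lim => //.
  exact: pot_cvg.
have cv : \int[nu]_(z in K `&` disk x r) g n z @[n --> \oo] -->
    \int[nu]_(z in K `&` disk x r) limn (g^~ z).
  apply: cvg_monotone_convergence => //.
  - by move=> n z _; rewrite lee_fin.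
  - move=> z [Kz _] m n mn; rewrite lee_fin.
    by apply: (pot_nd Kz _ mn); rewrite r0.
rewrite -(cvg_lim _ cv)//; apply: lime_le; first by apply/cvg_ex; eexists; exact: cv.
apply: nearW => n; apply: (le_trans (integral_pot_dyadic n Kx r0 rR rT)).
apply: leeD => //; rewrite lee_fin /growth [leRHS]mulrAC.
by rewrite ler_wpM2l ?geometric_le// mulr_ge0 ?powR_ge0// mulr_ge0// mulr_ge0// riesz_bound_ge0.
Qed.

(** A bump at scale t has slope O(1/t). Since xi <= 4 t^-2 and |w - x|^2 - |w - z|^2 <= 3rt, its
    base changes by at most 12 r/t; cubing gives a factor 3 and the fixed bump, at least 1/4 there,
    a factor 4. Either centre may serve as x0, because the bound is used both ways with one fixed
    bump. *)
Lemma bker_shift_le xi t x z x0 w (r : R) : (0 < r)%R -> (r <= t)%R -> (4 * t <= R1)%R ->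
  (t ^- 2 <= xi <= 4 * t ^- 2)%R -> (sqn (z - x) < r ^+ 2)%R ->
  (x0 = x \/ x0 = z) ->
  (bker xi z w <= bker xi x w + (144 * (r / t)) * bker (R1 ^- 2) x0 w)%R.
Proof.
move=> r0 rt tR /andP[x1 x2] zx hx0.
have t0 : (0 < t)%R := lt_le_trans r0 rt.
have xi0 : (0 < xi)%R := lt_le_trans (r20 t0) x1.
have T1 : (t ^- 2 * t ^+ 2 = 1)%R by rewrite mulVf// expf_neq0// gt_eqF.
have rtE : (r / t = r * t ^- 2 * t)%R by field; rewrite gt_eqF.
have rt0 : (0 <= r / t)%R by rewrite divr_ge0// ltW.
have c0 : (0 <= 144 * (r / t))%R by lra.
(* Beyond distance t the bump at z vanishes, as xi >= t^-2. *)
have [wz|wz] := leP (t ^+ 2)%R (sqn (w - z)%R).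
  have -> : bker xi z w = 0%R.
    rewrite /bker /ker_b /pos max_l ?expr0n//.
    rewrite subr_le0 -T1; apply: ler_pM => //; first exact: ltW (r20 t0).
    by rewrite sqr_ge0.
  by rewrite addr_ge0 ?bker_ge0// mulr_ge0 ?bker_ge0.
pose nz := normc (w - z)%R; pose nx := normc (w - x)%R.
have nzt : (nz < t)%R by rewrite normc_lt.
have nzx : (normc (z - x)%R < r)%R by rewrite normc_lt.
have nx1 : (nx <= nz + r)%R.
  by apply: (le_trans (normc_dist_triangle w z x)); rewrite lerD2l ltW.
have nz0 : (0 <= nz)%R by exact: normc_ge0.
have nx0 : (0 <= nx)%R by exact: normc_ge0.
have q4 : (1 / 4 <= bker (R1 ^- 2) x0 w)%R.
  apply: (bker_ge_quarter t0 tR); rewrite -normc_sqr lerXn2r ?nnegrE ?normc_ge0 ?mulr_ge0 ?(ltW t0)//.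
  by case: hx0 => ->; rewrite -/nx -/nz; lra.
suff : (bker xi z w <= bker xi x w + 36 * (r / t))%R.
  have : (0 <= r / t)%R by rewrite divr_ge0// ltW.
  by set A := (r / t)%R; nra.
rewrite /bker /ker_b -!normc_sqr -/nz -/nx.
have p0 := pos_ge0 (1 - xi * nz ^+ 2); have q0 := pos_ge0 (1 - xi * nx ^+ 2).
(* If w is at least as close to x as to z, the bump at x is already the larger one. *)
have [nxz|nxz] := leP nx nz.
  apply: (@le_trans _ _ (pos (1 - xi * nx ^+ 2) ^+ 3)%R).
    rewrite lerXn2r ?nnegrE//; apply: pos_le; rewrite lerB// ler_wpM2l ?(ltW xi0)//.
    by rewrite lerXn2r ?nnegrE.
  by rewrite lerDl mulr_ge0// divr_ge0// ltW.
have pq : (pos (1 - xi * nx ^+ 2) <= pos (1 - xi * nz ^+ 2))%R.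
  apply: pos_le; rewrite lerB// ler_wpM2l ?(ltW xi0)//.
  by rewrite lerXn2r ?nnegrE// ltW.
have p1 : (pos (1 - xi * nz ^+ 2) <= 1)%R.
  by have /andP[] := ker_pos_itv (ltW xi0) (sqr_ge0 nz).
have dpq : (pos (1 - xi * nz ^+ 2) - pos (1 - xi * nx ^+ 2) <= 12 * (r / t))%R.
  apply: (le_trans (ler_norm _)); apply: (le_trans (pos_lip _ _)).
  rewrite (_ : _ - _ = xi * ((nx - nz) * (nx + nz)))%R; last by ring.
  rewrite ger0_norm; last first.
    by rewrite mulr_ge0 ?(ltW xi0)// mulr_ge0 ?subr_ge0 ?addr_ge0// ltW.
  apply: (@le_trans _ _ (4 * t ^- 2 * (r * (3 * t)))%R); last by rewrite rtE; lra.
  apply: ler_pM => //; [exact: ltW|by rewrite mulr_ge0 ?subr_ge0 ?addr_ge0// ltW|].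
  by apply: ler_pM; rewrite ?subr_ge0 ?addr_ge0// ?(ltW nxz)//; lra.
move: p0 q0 pq p1 dpq; set p := pos _; set p' := pos _ => p0 q0 pq p1 dpq.
have : (p ^+ 3 - p' ^+ 3 <= 3 * (p - p'))%R.
  rewrite (_ : p ^+ 3 - p' ^+ 3 = (p ^+ 2 + p * p' + p' ^+ 2) * (p - p'))%R; last by ring.
  by rewrite ler_wpM2r ?subr_ge0//; nra.
by lra.
Qed.

Lemma pot_osc_step t x z (r : R) : K x -> K z -> (0 < r)%R -> (r <= t)%R -> (4 * t <= R1)%R ->
  (sqn (z - x) < r ^+ 2)%R ->
  (`|V (t / 2) z - V (t / 2) x| <= `|V t z - V t x| + 432 * (r / t) * M)%R.
Proof.
move=> Kx Kz r0 rt tR zx.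
have t0 : (0 < t)%R := lt_le_trans r0 rt.
have xz : (sqn (x - z) < r ^+ 2)%R.
  by rewrite -normc_lt// -normcN opprB normc_lt.
have tR' : (0 < t <= R1)%R by rewrite t0/=; lra.
have RR : (0 < R1 <= R1)%R by rewrite R10 lexx.
have rt0 : (0 <= r / t)%R by rewrite divr_ge0// ltW.
have c0 : (0 <= 144 * (r / t))%R by lra.
have := @pot_quadruple_diff R v W D rho mv v0 vfin D0 vD super rho0 (t ^- 2) (R1 ^- 2) z x x
  (144 * (r / t)) (r20 t0) (r20 R10) c0 (adm_K Kz tR') (adm_K Kx tR') (adm_K Kx RR)
  (fun xi w h => conj (bker_shift_le w r0 rt tR h zx (or_introl erefl))
                      (bker_shift_le w r0 rt tR h xz (or_intror erefl))).
rewrite half_sq => /le_trans; apply; rewrite lerD2l.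
have := riesz_bound_ge Kx; set A := (R1 ^- 2 * _)%R => AM.
rewrite mulrA (_ : 3 * 144 = 432 :> R)%R; last by ring.
by apply: ler_wpM2l; [lra|exact: AM].
Qed.

(** The first term covers the top scale t > R1/8, where each potential is at most 64 R1^-2 times the
    mass. The second sums the steps of [pot_osc_step], with 432 = 3 * 144, over the dyadic scales
    above r. *)
Definition osc_bound : R := (128 * R1 ^- 2 * mass v + 432 * M)%R.

Lemma pot_osc x z (r : R) : K x -> K z -> (0 < r)%R -> (4 * r <= R1)%R ->
  (sqn (z - x) < r ^+ 2)%R -> (`|V r z - V r x| <= osc_bound)%R.
Proof.
move=> Kx Kz r0 rR zx.
have M0 := riesz_bound_ge0.
pose A := (128 * R1 ^- 2 * mass v)%R.
have base t : (r <= t)%R -> (R1 < 8 * t)%R -> (`|V t z - V t x| <= A)%R.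
  move=> rt tn; have t0 : (0 < t)%R := lt_le_trans r0 rt.
  have t2 : (t ^- 2 <= 64 * R1 ^- 2)%R.
    rewrite -[leLHS]mul1r ler_pdivrMr ?exprn_gt0// mulrAC ler_pdivlMr ?exprn_gt0// mul1r.
    have : (R1 ^+ 2 <= (8 * t) ^+ 2)%R by rewrite lerXn2r ?nnegrE ?(ltW R10) ?mulr_ge0 ?(ltW t0)// ltW.
    by rewrite exprMn; lra.
  have Vle y : (0 <= V t y <= 64 * R1 ^- 2 * mass v)%R.
    rewrite pairing_psiker_ge0 ?(ltW (r20 t0))//=.
    apply: (le_trans (ler_norm _)).
    apply: (@pairing_bound _ _ mv v0 vfin); first exact: testfun_psiker (ltW (r20 t0)).
    move=> w _; rewrite ger0_norm ?psiker_ge0 ?(ltW (r20 t0))//.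
    by apply: le_trans t2; apply: psiker_le; exact: ltW (r20 t0).
  have /andP[z1 z2] := Vle z; have /andP[x1 x2] := Vle x.
  by rewrite ler_norml; apply/andP; split; rewrite /A; lra.
(* Induction on the number n of doublings up to the top scale. The bound reproduces itself: at 2t
   the term is 432 (r/2t) M, and the step down to t adds as much again. *)
have main n t : (r <= t)%R -> (4 * t <= R1)%R -> (R1 < 8 * (2 ^+ n * t))%R ->
    (`|V t z - V t x| <= A + 432 * (r / t) * M)%R.
  elim: n t => [|n IH] t rt tR tn; have t0 : (0 < t)%R := lt_le_trans r0 rt;
    have rt0 : (0 <= (r / t) * M)%R by rewrite mulr_ge0// divr_ge0// ltW.
    by rewrite expr0 mul1r in tn; have := base t rt tn; lra.
  have [tR2|tR2] := leP (4 * (2 * t))%R R1; last first.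
    have t8 : (R1 < 8 * t)%R by lra.
    by have := base t rt t8; lra.
  have rt2 : (r <= 2 * t)%R by lra.
  have tn2 : (R1 < 8 * (2 ^+ n * (2 * t)))%R by rewrite exprS in tn; lra.
  have h1 := IH _ rt2 tR2 tn2.
  have h2 := pot_osc_step Kx Kz r0 rt2 tR2 zx.
  have t2E : (2 * t / 2 = t)%R by rewrite mulrC mulKf.
  have rtE : (r / (2 * t) = (r / t) / 2)%R by rewrite invfM mulrA mulrAC.
  rewrite t2E rtE in h2; rewrite rtE in h1; lra.
have [n rn] : exists n, (R1 < 8 * (2 ^+ n * r))%R.
  pose n := (Num.truncn (R1 / r)).+1; exists n.
  have h1 : (R1 / r < n%:R)%R by exact: truncnS_gt.
  have h2 : (n%:R <= 2 ^+ n :> R)%R by rewrite -natrX ler_nat ltnW// ltn_expl.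
  rewrite ltr_pdivrMr// in h1.
  have h3 : (n%:R * r <= 2 ^+ n * r)%R by rewrite ler_wpM2r// ltW.
  have h4 : (0 <= 2 ^+ n * r)%R by rewrite mulr_ge0 ?exprn_ge0// ltW.
  by lra.
by have := main n r (lexx _) rR rn; rewrite divff ?gt_eqF// mulr1.
Qed.

Lemma osc_bound_ge0 : (0 <= osc_bound)%R.
Proof.
have M0 := riesz_bound_ge0.
have : (0 <= R1 ^- 2 * mass v)%R by rewrite mulr_ge0 ?mass_ge0// ltW// r20.
by rewrite /osc_bound; lra.
Qed.

(** Insert V_r(z): the difference kappa v(z) - V_r(z) is nonnegative and is controlled in mean by
    [integral_v_ball], while V_r(z) - V_r(x) is controlled pointwise by [pot_osc]. *)
Lemma integral_oscillation x (r : R) : K x -> (0 < r)%R -> (4 * r <= R1)%R ->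
  (r <= rho)%R -> (r <= T0)%R ->
  \int[nu]_(z in K `&` disk x r) `|kappa%:E * v z - (V r x)%:E| <=
  (growth * r `^ d)%:E + osc_bound%:E * nu (K `&` disk x r).
Proof.
move=> Kx r0 rR rr rT.
pose B : set (borelC R) := K `&` disk x r.
have mB : measurable B := measurable_ball x r.
have rT' : (0 < r <= T0)%R by rewrite r0.
have nuB : nu B < +oo by exact: nuB_lty.
have nuBf : nu B \is a fin_num by rewrite ge0_fin_numE.
have rR' : (0 < r <= R1)%R by rewrite r0/=; lra.
have V0 z : (0 <= V r z)%R by apply: pairing_psiker_ge0 => //; exact: ltW (r20 r0).
have mV : measurable_fun B (fun z => (V r z)%:E).
  apply: (@measurable_funS _ _ _ _ setT) => //.
  by apply: measurable_pot => //; apply: ltW; apply: r20.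
have mkv : measurable_fun B (fun z => kappa%:E * v z).
  by apply: (@measurable_funS _ _ _ _ setT) => //; apply: measurable_funeM.
have k0 := kappa_gt0.
have Vle z : B z -> (V r z)%:E <= kappa%:E * v z.
  by move=> [Kz _]; apply: pot_le; [exact: adm_W (adm_K Kz rR')|rewrite r0].
have dv0 z : B z -> 0 <= kappa%:E * v z - (V r z)%:E by move=> Bz; rewrite sube_ge0// Vle.
have mdv : measurable_fun B (fun z => kappa%:E * v z - (V r z)%:E) by exact: emeasurable_funB.
apply: (@le_trans _ _ (\int[nu]_(z in B) ((kappa%:E * v z - (V r z)%:E) + osc_bound%:E))).
  apply: ge0_le_integral => //.
  - by apply: measurableT_comp => //; exact: emeasurable_funB.
  - exact: emeasurable_funD.
  move=> z Bz; have [Kz zx] := Bz.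
  have -> : kappa%:E * v z - (V r x)%:E =
      (kappa%:E * v z - (V r z)%:E) + (V r z - V r x)%:E.
    by rewrite EFinB addeA subeK.
  apply: (le_trans (lee_abs_add _ _)); apply: leeD.
    by rewrite gee0_abs// dv0.
  by rewrite lee_fin; apply: (pot_osc Kx Kz r0 rR); rewrite -normc_lt.
rewrite ge0_integralD//; last first.
  by move=> z _; rewrite lee_fin osc_bound_ge0.
rewrite integral_cst//; apply: leeD => //.
(* Finiteness allows this integral to be added to both sides, which turns the difference into
   [integral_v_ball]. *)
have IVf : \int[nu]_(z in B) (V r z)%:E \is a fin_num.
  rewrite ge0_fin_numE; last by apply: integral_ge0 => z _; rewrite lee_fin.
  apply: (@le_lt_trans _ _ (\int[nu]_(z in B) cst (r ^- 2 * mass v)%:E z)).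
    apply: ge0_le_integral => //.
    - by move=> z _; rewrite lee_fin.
    move=> z _; rewrite lee_fin; apply: (le_trans (ler_norm _)).
    apply: (@pairing_bound _ _ mv v0 vfin); first exact: testfun_psiker (ltW (r20 r0)).
    by move=> w _; rewrite ger0_norm ?psiker_ge0 ?psiker_le ?(ltW (r20 r0)).
  rewrite integral_cst//; apply: lte_mul_pinfty => //.
  by rewrite lee_fin mulr_ge0 ?mass_ge0// ltW// r20.
rewrite -(leeD2rE _ _ IVf) -ge0_integralD//; last by move=> z _; rewrite lee_fin.
rewrite addeC; apply: le_trans (integral_v_ball Kx r0 rR rr rT).
rewrite le_eqVlt; apply/orP; left; apply/eqP; apply: eq_integral => z _.
by rewrite subeK.
Qed.

End regular_measure.

(** * Subharmonic functions *)

(** If Q K fails, the sets A such that Q holds on K minus A form a proper filter containing K; a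
    cluster point in K contradicts the local hypothesis. *)
Lemma compact_induction (T : topologicalType) (K : set T) (Q : set T -> Prop) :
  compact K -> Q set0 ->
  (forall A B, A `<=` B -> Q B -> Q A) ->
  (forall A B, Q A -> Q B -> Q (A `|` B)) ->
  (forall x, K x -> exists2 B, nbhs x B & Q B) -> Q K.
Proof.
move=> cK Q0 Qsub QU Qloc; apply: contrapT => nQ.
pose F : set_system T := [set A | Q (K `\` A)].
have FF : ProperFilter F.
  split.
    by rewrite /F/= setD0.
  split.
  - by rewrite /F/= setDT.
  - by move=> A B FA FB; rewrite /F/= setDIr; exact: QU.
  - by move=> A B AB; apply: Qsub; exact: setDS.
have [x [Kx cl]] : K `&` cluster F !=set0.
  by apply: cK; rewrite /F/= setDv.
have [B xB QB] := Qloc x Kx.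
have FB : F (~` B) by apply: Qsub QB => y [_ /contrapT].
by have [y [ny yy]] := cl _ _ FB xB.
Qed.

Section subharmonic_facts.
Context {R : realType}.
Local Open Scope ereal_scope.
Local Notation mu := (@lebesgue_measure R).
Local Notation I := (`[0%R, (2 * pi)%R]%classic : set (measurableTypeR R)).

Lemma nbhs_disk (z : R[i]) (A : set R[i]) : nbhs z A -> exists2 e : R, (0 < e)%R & disk z e `<=` A.
Proof.
move=> zA; have [e e0 he] := open_disk (@open_interior _ A) (zA : A° z).
by exists e => // w /he; exact: interior_subset.
Qed.

Lemma disk_nbhs (z : R[i]) (e : R) : (0 < e)%R -> nbhs z (disk z e).
Proof.
move=> e0; apply: open_nbhs_nbhs; split; first exact: disk_open.
by rewrite /disk /mkset subrr normc0.
Qed.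

Variables (U : set R[i]) (f : R[i] -> \bar R).
Hypothesis oU : open U.
Hypothesis fs : subharmonic U f.

Lemma usc_measurable (O : set R[i]) : open O -> O `<=` U ->
  measurable_fun (O : set (borelC R)) (f : borelC R -> \bar R).
Proof.
move=> oO OU; apply: (measurability _ (measurable_realfun.ErealGenInftyO.measurableE R)).
move=> _ [_ [c ->] <-].
apply: measurable_open; apply: open_from_disk => z [Oz]; rewrite /= in_itv/= => fc.
have [e1 e10 h1] := open_disk oO Oz.
have [e2 e20 h2] := nbhs_disk (subharmonic_usc fs (OU _ Oz) fc).
exists (Num.min e1 e2); first by rewrite lt_min e10.
move=> w; rewrite /disk /mkset lt_min => /andP[w1 w2]; split; first exact: h1.
by rewrite /= in_itv/=; exact: h2.
Qed.

(** Extended by 0 so that all integrals run over the plane. The jump at the boundary may destroy the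
    mean value inequality, which is therefore claimed only for disks inside O. *)
Definition trunc_super (M : R) (O : set R[i]) : borelC R -> \bar R :=
  (fun w => M%:E - f w) \_ O.

Section trunc.
Variables (M : R) (O : set R[i]).
Hypothesis oO : open O.
Hypothesis OU : O `<=` U.
Hypothesis fM : forall w, O w -> f w <= M%:E.
Local Notation v := (trunc_super M O).

Lemma trunc_superE w : O w -> v w = M%:E - f w.
Proof. by move=> Ow; rewrite /trunc_super patchE mem_set. Qed.

Lemma trunc_super_out w : ~ O w -> v w = 0.
Proof. by move=> Ow; rewrite /trunc_super patchE memNset. Qed.

Lemma trunc_super_ge0 w : 0 <= v w.
Proof.
have [Ow|Ow] := pselect (O w); last by rewrite trunc_super_out.
rewrite trunc_superE//; case: (f w) (fM Ow) => [x| |] //; last by rewrite leey.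
by rewrite -EFinB !lee_fin subr_ge0.
Qed.

Lemma measurable_trunc_super : measurable_fun [set: borelC R] v.
Proof.
apply/(measurable_restrictT _ _).1; first exact: measurable_open.
by apply: emeasurable_funB; [exact: measurable_cst|exact: usc_measurable].
Qed.

(** The subtraction M - f under the integral needs f to be integrable on the circle. If f z is
    finite, the bound above by M and the submean inequality itself give this. *)
Lemma trunc_super_mean z (r : R) : (0 < r)%R -> cdisk z r `<=` O ->
  \int[mu]_(t in I) v (z + r%:C * cis t)%R <= (2 * pi)%:E * v z.
Proof.
move=> r0 rO.
have pi20 : (0 < 2 * pi :> R)%R by rewrite mulr_gt0 ?pi_gt0.
have Oz : O z by apply: rO; rewrite /cdisk /mkset subrr normc0 ltW.
have Oc t : O (z + r%:C * cis t)%R.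
  apply: rO; rewrite /cdisk /mkset addrAC subrr add0r normc_le ?(ltW r0)//.
  by rewrite sqnM sqn_cis mulr1 /sqn/= expr0n addr0.
rewrite trunc_superE//.
have : f z < +oo by exact: subharmonic_lty fs _ (OU Oz).
have := @subharmonic_mean _ _ _ fs z r r0 (subset_trans rO OU).
rewrite /circle_mean -/(cis _).
pose F t := f (z + r%:C * cis t)%R.
have -> : \int[mu]_(t in I) f (z + r%:C * (cos t +i* sin t))%R = \int[mu]_(t in I) F t by [].
have FM t : F t <= M%:E by exact: fM.
have -> : \int[mu]_(t in I) v (z + r%:C * cis t)%R = \int[mu]_(t in I) (M%:E - F t).
  by apply: eq_integral => t _; rewrite trunc_superE.
have muI : mu I = (2 * pi)%:E.
  by rewrite lebesgue_measure_itv/= lte_fin pi20 oppr0 adde0.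
have muIoo : mu I < +oo by rewrite muI ltry.
have mI : measurable I by exact: measurable_itv.
have mF : measurable_fun I F.
  have mv : measurable_fun [set: measurableTypeR R] (fun t => v (z + r%:C * cis t)%R).
    apply: measurableT_comp measurable_trunc_super _.
    apply: measurable_addC; first exact: measurable_cst.
    by apply: measurable_mulC; [exact: measurable_cst|apply: measurable_cis; exact: measurable_id].
  apply: (@measurable_funS _ _ _ _ setT) => //.
  rewrite (_ : F = fun t => M%:E - v (z + r%:C * cis t)%R); last first.
    apply/funext => t; rewrite trunc_superE// /F; case: (f _) (subharmonic_lty fs (OU (Oc t))) => [x| |] //= _.
    by rewrite -!EFinB subKr.
  by apply: emeasurable_funB => //; exact: measurable_cst.
(* Where f is -oo the right-hand side is +oo. *)
case: (f z) => [x| |] //; last first.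
  by move=> _ _; rewrite (_ : M%:E - -oo = +oo)// mulry gtr0_sg// mul1e leey.
move=> hm _.
set X := \int[mu]_(t in I) F t in hm.
have X2 : (2 * pi * x)%:E <= X.
  rewrite EFinM -(@lee_pmul2l _ (2 * pi)^-1%:E) ?lte_fin ?invr_gt0//.
  by rewrite muleA -!EFinM mulVf ?gt_eqF// mul1r.
have posF : \int[mu]_(t in I) F^\+ t < +oo.
  apply: (@le_lt_trans _ _ (\int[mu]_(t in I) cst (`|M|)%:E t)).
    apply: ge0_le_integral => //.
    - exact: measurable_funepos.
    move=> t _; rewrite funeposE ge_max; apply/andP; split; last by rewrite lee_fin.
    by apply: (le_trans (FM t)); rewrite lee_fin ler_norm.
  by rewrite integral_cst//; apply: lte_mul_pinfty => //; rewrite lee_fin.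
(* An infinite negative part would give the integral the value -oo, against [X2]. *)
have negF : \int[mu]_(t in I) F^\- t < +oo.
  rewrite ltNge leye_eq; apply/negP => /eqP nF.
  move: X2; rewrite /X integralE nF.
  have : \int[mu]_(t in I) F^\+ t \is a fin_num by rewrite ge0_fin_numE// integral_ge0.
  by case: (\int[mu]_(t in I) F^\+ t).
have iF : mu.-integrable I F.
  apply/integrableP; split => //.
  have -> : \int[mu]_(t in I) `|F t| = \int[mu]_(t in I) (F^\+ t + F^\- t).
    by apply: eq_integral => t _; exact: (congr1 (@^~ t) (fune_abse F)).
  rewrite ge0_integralD//; first by rewrite lte_add_pinfty.
    exact: measurable_funepos.
  exact: measurable_funeneg.
have iM : mu.-integrable I (cst M%:E).
  apply/integrableP; split; first exact: measurable_cst.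
  by rewrite integral_cst//=; apply: lte_mul_pinfty => //; rewrite lee_fin.
have intM : \int[mu]_(t in I) (cst M%:E) t = (M * (2 * pi))%:E.
  by rewrite integral_cst// EFinM; congr (_ * _); exact: muI.
rewrite (@integralB _ _ _ mu I mI (cst M%:E) F iM iF) intM -/X.
have Xf : X \is a fin_num by exact: integrable_fin_num.
move: X2; rewrite -(fineK Xf) -!EFinB -EFinM !lee_fin; lra.
Qed.

End trunc.

Lemma lebC_bounded_lty (N : R) (A : set (borelC R)) : (0 <= N)%R -> measurable A ->
  (forall w, A w -> normc w <= N)%R -> lebC A < +oo.
Proof.
move=> N0 mA AN; pose Q : set (borelC R) :=
  [set z | (complex.Re z \in `[-N, N]%R) && (complex.Im z \in `[-N, N]%R)].
have mQ : measurable Q by exact: measurable_rect.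
apply: (@le_lt_trans _ _ (lebC Q)).
  apply: le_measure; rewrite ?inE// => w /AN wN.
  by rewrite /Q/= !in_itv/= -!ler_norml !(le_trans _ wN) ?abs_Re_le ?abs_Im_le.
by rewrite /Q lebC_rect ?ltry//; lra.
Qed.

Lemma lebC_disk_gt0 z (e : R) : (0 < e)%R -> 0 < lebC (disk z e).
Proof.
move=> e0; case: z => a b; pose h := (e / 2)%R.
have h0 : (0 < h)%R by rewrite divr_gt0.
pose Q : set (borelC R) :=
  [set z | (complex.Re z \in `[a - h / 2, a + h / 2]%R) && (complex.Im z \in `[b - h / 2, b + h / 2]%R)].
have mQ : measurable Q by exact: measurable_rect.
apply: (@lt_le_trans _ _ (lebC Q)).
  by rewrite /Q lebC_rect ?lte_fin ?mulr_gt0//; lra.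
apply: le_measure; rewrite ?inE//; first exact: measurable_disk.
move=> -[x y] /andP[]; rewrite /= !in_itv/= => /andP[x1 x2] /andP[y1 y2].
rewrite /disk /mkset normc_lt// /sqn/=.
have -> : (e = 2 * h)%R by rewrite /h mulrC divfK.
nra.
Qed.

Lemma trunc_super_le (M : R) (O O' : set R[i]) w : (forall w, O w -> f w <= M%:E) ->
  O' `<=` O -> trunc_super M O' w <= trunc_super M O w.
Proof.
move=> fM O'O; have [Ow|Ow] := pselect (O' w).
  by rewrite !trunc_superE//; exact: O'O.
by rewrite trunc_super_out// trunc_super_ge0.
Qed.

Lemma le_integral_trunc (M : R) (O O' : set R[i]) : open O -> open O' -> O `<=` U ->
  (forall w, O w -> f w <= M%:E) -> O' `<=` O ->
  \int[lebC]_w trunc_super M O' w <= \int[lebC]_w trunc_super M O w.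
Proof.
move=> oO oO' OU fM O'O; apply: ge0_le_integral => //.
- by move=> w _; apply: trunc_super_ge0 => u /O'O /fM.
- by apply: measurable_trunc_super => //; exact: subset_trans O'O OU.
- exact: measurable_trunc_super.
- by move=> w _; exact: trunc_super_le.
Qed.

Definition locally_int z := exists M (e : R), [/\ (0 < e)%R, disk z e `<=` U,
  (forall w, disk z e w -> f w <= M%:E) &
  \int[lebC]_w trunc_super M (disk z e) w < +oo].

(** The mean value inequality over the disk of radius e/2, with an indicator as radial weight,
    bounds the area integral by a multiple of the finite value of v at z. *)
Lemma integral_trunc_finite z (M e : R) : (0 < e)%R -> disk z e `<=` U ->
  (forall w, disk z e w -> f w <= M%:E) -> f z != -oo ->
  \int[lebC]_w trunc_super M (disk z (e / 2)) w < +oo.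
Proof.
move=> e0 eU fM fz; set v := trunc_super M (disk z e).
have oD := @disk_open R z e.
have e20 : (0 < e / 2)%R by rewrite divr_gt0.
have mv := measurable_trunc_super M oD eU.
have v0 := trunc_super_ge0 fM.
pose H : set (measurableTypeR R) := `]-oo, ((e / 2) ^+ 2)%R]%classic.
have mH : measurable H by exact: measurable_itv.
have mh : measurable_fun [set: measurableTypeR R] (\1_H : measurableTypeR R -> measurableTypeR R).
  exact: measurable_indic.
have h0 x : (0 <= \1_H x :> R)%R by rewrite indicE.
have sm (r : R) : (0 < r <= e / 2)%R ->
    \int[mu]_(t in I) v (z + r%:C * cis t)%R <= (2 * pi)%:E * v z.
  move=> /andP[r0 re]; apply: trunc_super_mean => // w; rewrite /cdisk /disk /mkset => h.
  by apply: le_lt_trans h _; lra.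
have hs u : ((e / 2) ^+ 2 < u)%R -> \1_H u = 0%R :> R.
  by move=> hu; rewrite indicE memNset// /H/= in_itv/= leNgt hu.
have := @ge0_supermean_disk R (\1_H) v z (e / 2) mh h0 mv v0 sm (ltW e20) hs.
have vz : v z < +oo.
  rewrite /v trunc_superE; last by rewrite /disk /mkset subrr normc0.
  by move: fz; case: (f z) => [x| |] //= _; rewrite -EFinB ltry.
have hfin : \int[lebC]_w (\1_H (sqn w))%:E < +oo.
  pose A : set (borelC R) := [set w | (sqn w <= (e / 2) ^+ 2)%R].
  have AE : A = (fun w : borelC R => sqn w) @^-1` H.
    by apply/seteqP; split => w; rewrite /A /H/= in_itv/=.
  have mA : measurable A.
    rewrite AE -[X in measurable X]setTI; apply: measurable_sqn => //; exact: measurable_id.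
  rewrite (_ : \int[lebC]_w _ = \int[lebC]_w (\1_A w)%:E); last first.
    by apply: eq_integral => w _; rewrite !indicE AE.
  rewrite integral_indic// setIT; apply: (@lebC_bounded_lty (e / 2)) => //; first exact: ltW.
  by move=> w; rewrite /A /mkset normc_le// ltW.
move=> hle.
have c0 : 0 <= \int[lebC]_w (\1_H (sqn w))%:E by apply: integral_ge0 => w _; rewrite lee_fin.
have cf : \int[lebC]_w (\1_H (sqn w))%:E \is a fin_num by rewrite ge0_fin_numE.
have {}hle := le_lt_trans hle (lte_mul_pinfty c0 cf vz).
have sub2 : disk z (e / 2) `<=` disk z e.
  by move=> w; rewrite /disk /mkset => wz; apply: (lt_trans wz); lra.
have mv2 := measurable_trunc_super M (@disk_open R z (e / 2)) (subset_trans sub2 eU).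
have v20 := trunc_super_ge0 (fun w h => fM w (sub2 w h)).
rewrite -(lebC_shift mv2 v20 z); apply: le_lt_trans hle.
have mshift (g : borelC R -> \bar R) : measurable_fun [set: borelC R] g ->
    measurable_fun [set: borelC R] (fun w : borelC R => g (z + w)%R).
  move=> mg; apply: measurableT_comp mg _.
  by apply: measurable_addC; [exact: measurable_cst|exact: measurable_id].
apply: ge0_le_integral => //.
- exact: mshift.
- apply: emeasurable_funM; last exact: mshift.
  apply/measurable_EFinP; apply: measurableT_comp mh _; apply: measurable_sqn; exact: measurable_id.
move=> w _; have [wH|wH] := leP (sqn w) ((e / 2) ^+ 2)%R.
  rewrite indicE mem_set ?mul1e; last by rewrite /H/= in_itv/=.
  exact: trunc_super_le.
rewrite hs// mul0e trunc_super_out// /disk /mkset addrAC subrr add0r normc_lt//.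
by apply/negP; rewrite -leNgt ltW.
Qed.

Lemma integral_trunc_notNy z (M e : R) : (0 < e)%R -> disk z e `<=` U ->
  (forall w, disk z e w -> f w <= M%:E) ->
  \int[lebC]_w trunc_super M (disk z e) w < +oo ->
  exists2 w, disk z e w & f w != -oo.
Proof.
move=> e0 eU fM fin; apply: contrapT => nex.
have mv := measurable_trunc_super M (@disk_open R z e) eU.
have mD := measurable_disk z e.
have : \int[lebC]_(w in (disk z e : set (borelC R))) cst +oo w <= \int[lebC]_w trunc_super M (disk z e) w.
  rewrite [leLHS]integral_mkcond le_eqVlt; apply/orP; left; apply/eqP.
  apply: eq_integral => w _; rewrite /trunc_super !patchE; case: ifP => //; rewrite inE => ew.
  have -> : f w = -oo.
    by apply/eqP; apply: contrapT => /negP fw; apply: nex; exists w.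
  by [].
rewrite integral_cst// gt0_mulye ?lebC_disk_gt0//.
by move=> /le_lt_trans /(_ fin).
Qed.

Lemma usc_bound z : U z -> exists (M e : R), [/\ (0 < e)%R, disk z e `<=` U &
  forall w, disk z e w -> f w <= M%:E].
Proof.
move=> Uz; have [e1 e10 h1] := open_disk oU Uz.
have [M fzM] : exists M : R, f z < M%:E.
  move: (subharmonic_lty fs Uz); case: (f z) => [x _| |_]//.
    by exists (x + 1)%R; rewrite lte_fin ltrDl.
  by exists 0%R; rewrite ltNyr.
have [e2 e20 h2] := nbhs_disk (subharmonic_usc fs Uz fzM).
exists M, (Num.min e1 e2); split; first by rewrite lt_min e10.
  by move=> w; rewrite /disk /mkset lt_min => /andP[w1 _]; exact: h1.
by move=> w; rewrite /disk /mkset lt_min => /andP[_ w2]; apply: ltW; exact: h2.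
Qed.

Lemma disk_sub (x y : R[i]) (s t : R) : (normc (x - y) + s <= t)%R -> disk x s `<=` disk y t.
Proof.
move=> h w; rewrite /disk /mkset => wx.
by have := normc_dist_triangle w x y; lra.
Qed.

Lemma locally_int_sub x y (M s t : R) : (0 < s)%R -> (normc (x - y) + s <= t)%R ->
  disk y t `<=` U -> (forall w, disk y t w -> f w <= M%:E) ->
  \int[lebC]_w trunc_super M (disk y t) w < +oo -> locally_int x.
Proof.
move=> s0 xy tU fM fin; have sub := disk_sub xy; exists M, s; split => //.
- exact: subset_trans sub tU.
- by move=> w /sub /fM.
- apply: le_lt_trans fin; apply: le_integral_trunc => //; exact: disk_open.
Qed.

Lemma locally_int_near z (M e : R) u : (0 < e)%R -> disk z e `<=` U ->
  (forall w, disk z e w -> f w <= M%:E) -> (normc (u - z) < e / 4)%R -> f u != -oo ->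
  locally_int z.
Proof.
move=> e0 eU fM uz fu.
(* The radii fit: 1/4 + 7/10 < 1, and half of 7/10 equals 1/4 + 1/10, so integrability on the half
   disk about u reaches the disk of radius e/10 about z. *)
have sub : disk u (7 / 10 * e) `<=` disk z e by apply: disk_sub; lra.
have fin := @integral_trunc_finite u M (7 / 10 * e) _ (subset_trans sub eU) (fun w h => fM w (sub w h)) fu.
have zu : (normc (z - u) < e / 4)%R by rewrite -normcN opprB.
have sub2 : disk u (7 / 10 * e / 2) `<=` disk u (7 / 10 * e) by apply: disk_sub; rewrite subrr normc0; lra.
apply: (@locally_int_sub z u M (e / 10) (7 / 10 * e / 2)); [lra|lra| | |apply: fin; lra].
  exact: subset_trans sub2 (subset_trans sub eU).
by move=> w /sub2 /sub /fM.
Qed.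

(** In a component of U the points of local integrability form an open and closed set. It is
    nonempty because f is not identically -oo there. *)
Lemma locally_intT z : U z -> locally_int z.
Proof.
move=> Uz; have [w Cw fw] := subharmonic_neqNy fs Uz.
set C := connected_component U z in Cw.
have CU : C `<=` U by exact: connected_component_sub.
have cC : connected C by exact: component_connected.
have Cz : C z by exact: connected_component_refl.
pose G := [set u | locally_int u].
have oG : open G.
  apply: open_from_disk => u [M [e [e0 eU fM fin]]]; exists (e / 2)%R; first by rewrite divr_gt0.
  move=> x; rewrite /disk /mkset => xu.
  by apply: (@locally_int_sub x u M (e / 2) e) => //; [rewrite divr_gt0|lra].
suff CG : C `&` G = C by rewrite -CG in Cz; case: Cz.
apply: cC.
- exists w; split => //; have [M [e [e0 eU fM]]] := usc_bound (CU _ Cw).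
  by apply: (@locally_int_near w M e w) => //; rewrite subrr normc0 divr_gt0.
- by exists G.
(* Near a limit point u of G lies a disk with finite integral, hence a point y with f y finite; the
   two distances of e/8 put y within e/4 of u, as [locally_int_near] asks. *)
- exists (closure G); first exact: closed_closure.
  apply/seteqP; split => u [Cu Gu]; split => //; first exact: subset_closure.
  have [M [e [e0 eU fM]]] := usc_bound (CU _ Cu).
  have e8 : (0 < e / 8)%R by rewrite divr_gt0.
  have [x [[M' [e' [e'0 e'U fM' fin']]] xu]] := Gu _ (disk_nbhs u e8).
  rewrite /disk /mkset in xu.
  pose s := Num.min e' (e / 8)%R.
  have s0 : (0 < s)%R by rewrite lt_min e'0.
  have ss : (s <= e')%R by rewrite ge_min lexx.
  have sub : disk x s `<=` disk x e' by apply: disk_sub; rewrite subrr normc0 add0r.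
  have [y xy fy] := @integral_trunc_notNy x M' s s0 (subset_trans sub e'U)
    (fun w h => fM' w (sub w h))
    (le_lt_trans (le_integral_trunc (@disk_open R x e') (@disk_open R x s) e'U fM' sub) fin').
  apply: (@locally_int_near u M e y) => //.
  have : (s <= e / 8)%R by rewrite ge_min lexx orbT.
  rewrite /disk /mkset in xy.
  by have := normc_dist_triangle y x u; lra.
Qed.

End subharmonic_facts.

(** * A uniform neighbourhood of the compact set *)

Section thickening.
Context {R : realType}.
Local Open Scope ereal_scope.
Variables (U : set R[i]) (f : R[i] -> \bar R).
Hypothesis oU : open U.
Hypothesis fs : subharmonic U f.

Definition thick (S : set R[i]) (e : R) : set R[i] :=
  [set w | exists2 x, S x & (normc (w - x) < e)%R].

Lemma thick_open S e : open (thick S e).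
Proof.
apply: open_from_disk => w [x Sx wx]; exists (e - normc (w - x))%R; first by rewrite subr_gt0.
move=> y; rewrite /disk /mkset => yw; exists x => //.
by have := normc_dist_triangle y w x; lra.
Qed.

Lemma thick_sub S S' (e e' : R) : S `<=` S' -> (e <= e')%R -> thick S e `<=` thick S' e'.
Proof. by move=> SS ee w [x Sx wx]; exists x; [exact: SS|exact: lt_le_trans wx ee]. Qed.

(** Two neighbourhoods come with different upper bounds of f; raising one to the other costs only a
    multiple of the area. *)
Lemma trunc_superD (M M' : R) (O : set R[i]) : (0 <= M' - M)%R -> open O -> O `<=` U ->
  (forall w, O w -> f w <= M%:E) ->
  \int[lebC]_w trunc_super f M' O w =
  \int[lebC]_w trunc_super f M O w + (M' - M)%:E * lebC O.
Proof.
move=> MM oO OU fM.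
have mO : measurable (O : set (borelC R)) by exact: measurable_open.
have mv := measurable_trunc_super fs M oO OU.
have -> : (M' - M)%:E * lebC O = \int[lebC]_(w in (O : set (borelC R))) cst (M' - M)%:E w.
  by rewrite integral_cst.
rewrite [X in _ + X]integral_mkcond -ge0_integralD//.
- apply: eq_integral => w _; rewrite patchE; case: ifP => [|] Ow.
    rewrite inE in Ow; rewrite !trunc_superE//.
    have := fM _ Ow; case: (f w) => [x _|//|_ //].
    by rewrite -!EFinB -EFinD; congr EFin; ring.
  have nO : ~ O w by move=> /mem_set; rewrite Ow.
  by rewrite !trunc_super_out// adde0.
- by move=> w _; exact: trunc_super_ge0.
- by move=> w _; rewrite patchE; case: ifP => _; rewrite ?lee_fin.
- by apply/(measurable_restrictT _ _).1 => //; exact: measurable_cst.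
Qed.

Lemma compact_thick (K : set R[i]) : compact K -> K `<=` U ->
  exists (e M N : R), [/\ (0 < e)%R /\ (0 <= N)%R, thick K e `<=` U,
   (forall w, thick K e w -> f w <= M%:E /\ (normc w <= N)%R) &
   \int[lebC]_w trunc_super f M (thick K e) w < +oo].
Proof.
move=> cK KU.
pose Q S := exists (e M N : R), [/\ (0 < e)%R /\ (0 <= N)%R, thick S e `<=` U,
   (forall w, thick S e w -> f w <= M%:E /\ (normc w <= N)%R) &
   \int[lebC]_w trunc_super f M (thick S e) w < +oo].
apply: (@compact_induction _ _ Q) => //.
- exists 1%R, 0%R, 0%R; split => //; try by move=> w [].
  rewrite integral0_eq// => w _; rewrite trunc_super_out//; by case.
- move=> A B AB [e [M [N [[e0 N0] h1 h2 h3]]]]; exists e, M, N.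
  have sub := thick_sub AB (lexx e).
  split => //; first exact: subset_trans sub h1.
    by move=> w /sub /h2.
  apply: le_lt_trans h3; apply: (le_integral_trunc fs _ _ _ _ sub) => //; try exact: thick_open.
  by move=> w /h2 [].
- move=> A B [e1 [M1 [N1 [[e10 N10] h1 k1 i1]]]] [e2 [M2 [N2 [[e20 N20] h2 k2 i2]]]].
  pose e := Num.min e1 e2; pose M := Num.max M1 M2; pose N := Num.max N1 N2.
  have M1M : (0 <= M - M1)%R by rewrite subr_ge0 /M le_max lexx.
  have M2M : (0 <= M - M2)%R by rewrite subr_ge0 /M le_max lexx orbT.
  have N1N : (N1 <= N)%R by rewrite /N le_max lexx.
  have N2N : (N2 <= N)%R by rewrite /N le_max lexx orbT.
  (* The integral over the common neighbourhood is then at most the sum of the two. *)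
  have s12 : thick (A `|` B) e `<=` thick A e1 `|` thick B e2.
    move=> w [x [Ax|Bx]]; rewrite lt_min => /andP[w1 w2]; [left|right]; by exists x.
  have fin1 : \int[lebC]_w trunc_super f M (thick A e1) w < +oo.
    rewrite (@trunc_superD M1)//; [|exact: thick_open|by move=> w /k1 []].
    apply: lte_add_pinfty => //; apply: lte_mul_pinfty => //.
    apply: (@lebC_bounded_lty _ N1) => //; first by apply: measurable_open; exact: thick_open.
    by move=> w /k1 [].
  have fin2 : \int[lebC]_w trunc_super f M (thick B e2) w < +oo.
    rewrite (@trunc_superD M2)//; [|exact: thick_open|by move=> w /k2 []].
    apply: lte_add_pinfty => //; apply: lte_mul_pinfty => //.
    apply: (@lebC_bounded_lty _ N2) => //; first by apply: measurable_open; exact: thick_open.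
    by move=> w /k2 [].
  have fM1 w : thick A e1 w -> f w <= M%:E.
    by move=> /k1 [h _]; apply: (le_trans h); rewrite lee_fin -subr_ge0.
  have fM2 w : thick B e2 w -> f w <= M%:E.
    by move=> /k2 [h _]; apply: (le_trans h); rewrite lee_fin -subr_ge0.
  have fM w : thick (A `|` B) e w -> f w <= M%:E by move=> /s12 [/fM1|/fM2].
  have tU : thick (A `|` B) e `<=` U by move=> w /s12 [/h1|/h2].
  exists e, M, N; split => //.
  + by split; [rewrite lt_min e10|exact: le_trans N10 N1N].
  + move=> w hw; split; first exact: fM.
    by case: (s12 _ hw) => [/k1 [_ h]|/k2 [_ h]]; [exact: le_trans h N1N|exact: le_trans h N2N].
  + have o1 := @thick_open A e1; have o2 := @thick_open B e2; have o := @thick_open (A `|` B) e.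
    have m1 := measurable_trunc_super fs M o1 h1.
    have m2 := measurable_trunc_super fs M o2 h2.
    have m := measurable_trunc_super fs M o tU.
    have p1 := trunc_super_ge0 fM1; have p2 := trunc_super_ge0 fM2; have p := trunc_super_ge0 fM.
    apply: (@le_lt_trans _ _ (\int[lebC]_w (trunc_super f M (thick A e1) w + trunc_super f M (thick B e2) w))).
      apply: ge0_le_integral => //.
        exact: emeasurable_funD.
      move=> w _; have [hw|hw] := pselect (thick (A `|` B) e w); last first.
        by rewrite trunc_super_out// adde_ge0.
      case: (s12 _ hw) => h.
        rewrite trunc_superE// -(@trunc_superE _ f M (thick A e1))//.
        by rewrite leeDl.
      rewrite trunc_superE// -(@trunc_superE _ f M (thick B e2))//.
      by rewrite leeDr.
    by rewrite ge0_integralD// lte_add_pinfty.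
- move=> x Kx; have [M [e [e0 eU fM fin]]] := locally_intT oU fs (KU _ Kx).
  exists (disk x (e / 2)); first by apply: disk_nbhs; rewrite divr_gt0.
  have sub : thick (disk x (e / 2)) (e / 2) `<=` disk x e.
    move=> w [y]; rewrite /disk /mkset => yx wy.
    by have := normc_dist_triangle w y x; lra.
  exists (e / 2)%R, M, (normc x + e)%R; split.
  + by split; [rewrite divr_gt0|rewrite addr_ge0 ?normc_ge0 ?ltW].
  + exact: subset_trans sub eU.
  + move=> w /sub hw; split; first exact: fM.
    move: hw; rewrite /disk /mkset => hw.
    by have := normc_dist_triangle w x 0%R; rewrite !subr0; lra.
  + apply: le_lt_trans fin; apply: (le_integral_trunc fs _ _ _ _ sub) => //.
      exact: disk_open.
    exact: thick_open.
Qed.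

End thickening.

(** * Mean oscillation on a d-set *)

Section dset.
Context {R : realType}.
Local Open Scope ereal_scope.
Variables (d : R) (K U : set R[i]) (f : R[i] -> \bar R).
Hypothesis d0 : (0 < d)%R.
Hypothesis cK : compact K.
Hypothesis oU : open U.
Hypothesis KU : K `<=` U.
Hypothesis fs : subharmonic U f.
Local Notation H := (@hausdorff_measure R d).

Lemma compact_borel : measurable (K : set (borelC R)).
Proof.
have cl : closed K by apply: compact_closed => //; exact: norm_hausdorff.
rewrite -[X in measurable X]setCK; apply: measurableC; apply: measurable_open.
exact: closed_openC.
Qed.

Let mK := compact_borel.

Lemma measurable_on_K (B : set R[i]) : B `<=` K -> measurable (B : set (borelC R)) ->
  measurable_fun (B : set (borelC R)) (f : borelC R -> \bar R).
Proof.
move=> BK mB; apply: (@measurable_funS _ _ _ _ (U : set (borelC R))) => //.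
- exact: measurable_open.
- exact: subset_trans BK KU.
- exact: (usc_measurable fs oU (@subset_refl _ U)).
Qed.

Section nondegenerate.
Variables (a b tau : R).
Hypothesis tau0 : (0 < tau)%R.
Hypothesis a0 : (0 < a)%R.
Hypothesis dsetK : forall x (t : R), K x -> (0 < t)%R -> (t <= tau)%R ->
  (b * t `^ d)%:E <= H (K `&` disk x t) <= (a * t `^ d)%:E.

(** A d-set controls disks centred on K, but bumps are integrated about every w. A disk that meets K
    lies in one of twice the radius centred on K, whence 2^d. *)
Lemma hausdorff_disk_le w (t : R) : (0 < t <= tau / 2)%R ->
  H (K `&` disk w t) <= (a * 2 `^ d * t `^ d)%:E.
Proof.
move=> /andP[t0 tt].
have [[z [Kz zw]]|none] := pselect (exists z, K z /\ disk w t z); last first.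
  rewrite (_ : K `&` disk w t = set0); last first.
    by apply/seteqP; split => // z [Kz zw]; apply: none; exists z.
  rewrite measure0 lee_fin; apply: mulr_ge0; last exact: powR_ge0.
  by apply: mulr_ge0; [exact: ltW|exact: powR_ge0].
have sub : K `&` disk w t `<=` K `&` disk z (2 * t).
  move=> y [Ky yw]; split => //; move: yw zw; rewrite /disk /mkset => yw zw.
  have wz : (normc (w - z) < t)%R by rewrite -normcN opprB.
  by have := normc_dist_triangle y w z; lra.
apply: (le_trans (le_hausdorff d sub)).
have t20 : (0 < 2 * t)%R by rewrite mulr_gt0.
have t2t : (2 * t <= tau)%R by lra.
have /andP[_ h] := dsetK Kz t20 t2t.
by rewrite -mulrA -powRM// ltW.
Qed.

Lemma hausdorff_K_lty : H K < +oo.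
Proof.
rewrite -[X in H X](@setIid _ K).
apply: (@compact_induction _ K (fun S : set R[i] => H (K `&` S) < +oo) cK).
- by rewrite setI0 (measure0 H).
- by move=> A B AB; apply: le_lt_trans; apply: le_hausdorff; exact: setIS.
- move=> A B hA hB; rewrite setIUr.
  apply: (le_lt_trans (outer_measureU2 (hausdorff d) _ _)).
  exact: lte_add_pinfty.
- move=> x Kx; exists (disk x (tau / 2)); first by apply: disk_nbhs; rewrite divr_gt0.
  have t2 : (0 < tau / 2 <= tau / 2)%R by rewrite divr_gt0/=.
  by apply: (le_lt_trans (hausdorff_disk_le x t2)); rewrite ltry.
Qed.

Let Hfin : fin_num_fun (mrestr H mK).
Proof.
move=> A mA; rewrite ge0_fin_numE//; apply: le_lt_trans hausdorff_K_lty.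
by apply: le_hausdorff; exact: subIsetr.
Qed.

(** Fubini asks for a sigma-finite measure, which [hausdorff_measure] is not on the plane when d <
    2; its restriction to K is finite. *)
Definition restr_fin : {finite_measure set (borelC R) -> \bar R} :=
  HB.pack (mrestr H mK) (Measure_isFinite.Build _ _ _ (mrestr H mK) Hfin).

Lemma restr_finE (A : set (borelC R)) : A `<=` K -> restr_fin A = H A.
Proof. by move=> AK; rewrite /= /mrestr setIidl. Qed.

Lemma local_oscillation : exists C1 C2 r0 : R, [/\ (0 <= C1)%R, (0 <= C2)%R,
  (0 < r0 <= tau)%R & forall x r, K x -> (0 < r <= r0)%R ->
  exists c : R, \int[H]_(z in (K `&` disk x r : set (borelC R))) `|f z - c%:E| <=
    (C1 * r `^ d)%:E + C2%:E * H (K `&` disk x r)].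
Proof.
have [e [M [N [[e0 N0] tU tM tfin]]]] := compact_thick oU fs cK KU.
pose O := thick K e; pose v := trunc_super f M O.
have oO : open O by exact: thick_open.
have fM w : O w -> f w <= M%:E by move=> /tM [].
have mv := measurable_trunc_super fs M oO tU.
have v0 := trunc_super_ge0 fM.
(* All points concerned have modulus at most N, so distances are at most 2N. With W of thickness
   e/2, circles of radius at most e/4 about W stay in O. *)
have D0 : (0 <= 2 * N)%R by rewrite mulr_ge0.
pose W := thick K (e / 2).
have WO : W `<=` O by apply: thick_sub => //; lra.
have vD w z : v w != 0 -> W z -> (sqn (w - z) <= (2 * N) ^+ 2)%R.
  move=> vw /WO /tM [_ zN].
  have Ow : O w by apply: contrapT => /(trunc_super_out f M) vw0; rewrite /v vw0 eqxx in vw.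
  have [_ wN] := tM _ Ow; rewrite -normc_le//.
  have := normc_dist_triangle w 0%R z; rewrite subr0 sub0r normcN; lra.
have super z (r : R) : W z -> (0 < r <= e / 4)%R ->
    \int[lebesgue_measure]_(t in (`[0%R, (2 * pi)%R]%classic : set (measurableTypeR R)))
      v (z + r%:C * cis t)%R <= (2 * pi)%:E * v z.
  move=> [x Kx zx] /andP[r0 re]; apply: (trunc_super_mean fs oO tU fM) => //.
  move=> w; rewrite /cdisk /mkset => wz; exists x => //.
  by have := normc_dist_triangle w z x; lra.
have rho0 : (0 < e / 4)%R by rewrite divr_gt0.
have R10 : (0 < e / 2)%R by rewrite divr_gt0.
have KW x w : K x -> (sqn (w - x) < (e / 2) ^+ 2)%R -> W w.
  by move=> Kx wx; exists x => //; rewrite normc_lt.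
have KO x : K x -> O x by move=> Kx; exists x => //; rewrite subrr normc0.
have vlsc z (c : R) : K z -> c%:E < v z ->
    exists2 e : R, (0 < e)%R & forall w, disk z e w -> c%:E < v w.
  move=> Kz; rewrite /v trunc_superE; last exact: KO.
  move=> cf; have fc : f z < (M - c)%:E.
    move: cf (subharmonic_lty fs (KU Kz)); case: (f z) => [y| |] //.
      by rewrite -EFinB !lte_fin => ? _; lra.
    by move=> _ _; rewrite ltNyr.
  have [e1 e10 h1] := nbhs_disk (subharmonic_usc fs (KU Kz) fc).
  have [e2 e20 h2] := open_disk oO (KO _ Kz).
  exists (Num.min e1 e2); first by rewrite lt_min e10.
  move=> w; rewrite /disk /mkset lt_min => /andP[w1 w2].
  rewrite trunc_superE; last exact: h2.
  move: (h1 _ w1); case: (f w) => [y| |] //; last by rewrite ltry.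
  by rewrite -EFinB !lte_fin; lra.
have a2 : (0 <= a * 2 `^ d)%R by rewrite mulr_ge0 ?powR_ge0// ltW.
have nuK w (t : R) : (0 < t <= tau / 2)%R ->
    restr_fin (K `&` disk w t) <= (a * 2 `^ d * t `^ d)%:E.
  by move=> tt; rewrite restr_finE; [exact: hausdorff_disk_le|exact: subIsetl].
have osc := integral_oscillation mv v0 tfin D0 vD super rho0 R10 KW vlsc a2 d0 mK nuK.
have k0 := @kappa_gt0 R.
have ki : (0 <= (@kappa R)^-1)%R by rewrite invr_ge0 ltW.
(* The bound e/8 comes from 4r <= R1 = e/2, and tau/2 from [hausdorff_disk_le]. *)
pose r0 := (Num.min (e / 8) (tau / 2))%R.
exists ((@kappa R)^-1 * growth v (2 * N) (e / 2) (a * 2 `^ d) d)%R,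
  ((@kappa R)^-1 * osc_bound v (2 * N) (e / 2))%R, r0.
have e8 : (0 < e / 8)%R by rewrite divr_gt0.
have t2 : (0 < tau / 2)%R by rewrite divr_gt0.
split.
- by rewrite mulr_ge0//; apply: (growth_ge0 (2 * N) v0 R10 a2 d0).
- by rewrite mulr_ge0//; apply: (osc_bound_ge0 (2 * N) v0 R10).
- by rewrite lt_min e8 t2/= ge_min; apply/orP; right; lra.
move=> x r Kx /andP[rr]; rewrite le_min => /andP[r1 r2].
exists (M - pot v r x / @kappa R)%R.
have r4 : (4 * r <= e / 2)%R by lra.
have r5 : (r <= e / 4)%R by lra.
have := osc _ _ Kx rr r4 r5 r2.
set B : set (borelC R) := K `&` disk x r.
have mB : measurable B by apply: measurableI => //; exact: measurable_disk.
have BK : B `<=` K by exact: subIsetl.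
have mfB := measurable_on_K BK mB.
have resB : restr_fin B = H B := restr_finE BK.
move=> osc_r.
have hosc : \int[H]_(z in B) `|kappa%:E * v z - (pot v r x)%:E| <=
    (growth v (2 * N) (e / 2) (a * 2 `^ d) d * r `^ d)%:E +
    (osc_bound v (2 * N) (e / 2))%:E * H B.
  rewrite -[X in _ + _ * X]resB; apply: le_trans osc_r.
  rewrite le_eqVlt; apply/orP; left; apply/eqP; apply: eq_measure_integral => A mA AB.
  by apply/esym/restr_finE; exact: subset_trans AB BK.
have -> : \int[H]_(z in B) `|f z - (M - pot v r x / kappa)%:E| =
    \int[H]_(z in B) ((@kappa R)^-1%:E * `|kappa%:E * v z - (pot v r x)%:E|).
  apply: eq_integral => z; rewrite inE => Bz.
  rewrite /v trunc_superE; last exact/KO/BK.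
  move: (subharmonic_lty fs (KU (BK _ Bz))); case: (f z) => [y _| |_] //; last first.
    (* At a point where f is -oo both integrands are +oo. *)
    by rewrite (_ : M%:E - -oo = +oo)// gt0_muley ?lte_fin//= gt0_muley ?lte_fin ?invr_gt0.
  rewrite -!EFinB -!EFinM /=; congr EFin.
  rewrite -[X in _ = (X * _)%R](ger0_norm ki) -normrM -[LHS]normrN; congr `|_|%R.
  by field; rewrite gt_eqF.
rewrite ge0_integralZl//.
- apply: (le_trans (lee_wpmul2l _ hosc)); first by rewrite lee_fin.
  rewrite ge0_muleDr.
  + by rewrite -EFinM muleA -EFinM mulrA.
  + by rewrite lee_fin mulr_ge0 ?powR_ge0//; apply: (growth_ge0 (2 * N) v0 R10 a2 d0).
  + by rewrite mule_ge0// lee_fin; apply: (osc_bound_ge0 (2 * N) v0 R10).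
- apply: measurableT_comp => //; apply: emeasurable_funB; last exact: measurable_cst.
  by apply: measurable_funeM; apply: (@measurable_funS _ _ _ _ setT).
Qed.

End nondegenerate.
End dset.

(** * Mean oscillation about an arbitrary constant; null sets *)

Section oscillation.
Local Open Scope ereal_scope.

(** Replacing c by the average costs a factor 2, since their distance is at most the mean of |f -
    c|. *)
Lemma mean_oscillation_le {R : realType} (nu : {measure set (borelC R) -> \bar R})
    (B : set (borelC R)) (f : borelC R -> \bar R) (m c E : R) :
  measurable B -> measurable_fun B f -> nu B = m%:E -> (0 < m)%R ->
  \int[nu]_(z in B) `|f z - c%:E| <= E%:E ->
  nu.-integrable B f /\ mean_oscillation nu B f <= (2 * E / m)%:E.
Proof.
move=> mB mf nuB m0 hE.
have nuBoo : nu B < +oo by rewrite nuB ltry.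
have icst (k : R) : nu.-integrable B (cst k%:E).
  apply/integrableP; split; first exact: measurable_cst.
  by rewrite integral_cst//= nuB -EFinM ltry.
have mfc k : measurable_fun B (fun z => f z - k%:E).
  by apply: emeasurable_funB => //; exact: measurable_cst.
have mafc k : measurable_fun B (fun z => `|f z - k%:E|) by exact: measurableT_comp.
have ifc : nu.-integrable B (fun z => f z - c%:E).
  by apply/integrableP; split => //; apply: le_lt_trans hE _; rewrite ltry.
have if_ : nu.-integrable B f.
  apply: (@eq_integrable _ _ _ nu B mB (fun z => (f z - c%:E) + cst c%:E z)).
    by move=> z _; exact: subeK.
  exact: integrableD.
split => //.
have minv : (nu B)^-1 = (m^-1)%:E by rewrite nuB inver gt_eqF.
have mi0 : (0 < m^-1)%R by rewrite invr_gt0.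
have Xf : \int[nu]_(z in B) f z \is a fin_num by exact: integrable_fin_num.
pose X := fine (\int[nu]_(z in B) f z).
have XE : \int[nu]_(z in B) f z = X%:E by rewrite /X fineK.
have avg : average nu B f = (m^-1 * X)%:E by rewrite /average minv XE EFinM.
have intc (k : R) : \int[nu]_(z in B) cst k%:E z = (k * m)%:E.
  by rewrite integral_cst// nuB EFinM.
have hX : (`|X - c * m| <= E)%R.
  rewrite -lee_fin; apply: le_trans hE; apply: le_trans (le_abse_integral nu mB (mfc c)).
  have hI : \int[nu]_(z in B) (f z - c%:E) = (X - c * m)%:E.
    by have := @integralB _ _ _ nu B mB f (cst c%:E) if_ (icst c); rewrite intc XE.
  by rewrite hI.
rewrite /mean_oscillation avg; set al := (m^-1 * X)%R.
rewrite /average minv.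
have hal : (`|c - al| * m <= E)%R.
  rewrite -{1}(gtr0_norm m0) -normrM -normrN; apply: le_trans hX.
  by rewrite (_ : - _ = X - c * m)%R// /al; field; rewrite gt_eqF.
rewrite (_ : 2 * E / m = m^-1 * (2 * E))%R; last by rewrite mulrC.
rewrite [leRHS]EFinM. apply: lee_wpmul2l; first by rewrite lee_fin ltW.
apply: (@le_trans _ _ (\int[nu]_(z in B) (`|f z - c%:E| + cst (`|c - al|)%:E z))).
  apply: ge0_le_integral => //.
  - by apply: emeasurable_funD => //; exact: measurable_cst.
  move=> z _; have -> : f z - al%:E = (f z - c%:E) + (c - al)%:E.
    by rewrite EFinB addeA subeK.
  exact: lee_abs_add.
rewrite ge0_integralD//; last by move=> z _; rewrite lee_fin.
rewrite intc (_ : (2 * E)%:E = E%:E + E%:E); last by rewrite -EFinD; congr EFin; ring.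
by apply: leeD => //; rewrite lee_fin.
Qed.

(** The inverse of a null measure is +oo, and its product with the zero integral is 0. *)
Lemma integral_null_set {R : realType} (nu : {measure set (borelC R) -> \bar R})
    (B : set (borelC R)) (f : borelC R -> \bar R) :
  measurable B -> measurable_fun B f -> nu B = 0 ->
  nu.-integrable B f /\ mean_oscillation nu B f = 0.
Proof.
move=> mB mf nuB.
have z0 g : measurable_fun B g -> \int[nu]_(z in B) g z = 0.
  by move=> mg; apply: null_set_integral.
split.
  by apply/integrableP; split => //; rewrite z0 ?ltry//; exact: measurableT_comp.
rewrite /mean_oscillation /average (z0 f)// mule0.
rewrite z0 ?mule0//; apply: measurableT_comp => //.
by apply: emeasurable_funB => //; exact: measurable_cst.
Qed.

Lemma hausdorff_set1 {R : realType} (d : R) (x : R[i]) : (0 < d)%R ->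
  hausdorff d [set x] = 0.
Proof.
move=> d0; apply/eqP; rewrite eq_le hausdorff_ge0 andbT.
apply: ge_ereal_sup => _ [e e0 <-].
pose F (n : nat) : set R[i] := if n == 0%N then [set x] else set0.
have dx : diam [set x] = 0.
  rewrite /diam (_ : [set _ | _ in _ & _ in _] = [set 0]); first by rewrite ereal_sup1 maxxx.
  apply/seteqP; split => [y [u ->] [w ->] <-|y ->].
    by rewrite subrr normc0.
  by exists x => //; exists x => //; rewrite subrr normc0.
apply: (@le_trans _ _ (\sum_(i <oo) hgauge d (F i))).
  apply: ereal_inf_lbound; exists F => //; split.
    by move=> i; rewrite /F; case: ifP => _; rewrite ?dx ?diam0 lee_fin ltW.
  by move=> y ->; exists 0%N.
rewrite eseries0// => i _ _; rewrite /F; case: ifP => _; last exact: hgauge0.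
by rewrite /hgauge; case: ifP => // _; rewrite dx poweR0r// gt_eqF.
Qed.

End oscillation.

(** * Balls of all sizes *)

Section bmo_dset.
Context {R : realType}.
Local Open Scope ereal_scope.
Variables (d : R) (K U : set R[i]) (f : R[i] -> \bar R).
Hypothesis d0 : (0 < d)%R.
Hypothesis cK : compact K.
Hypothesis oU : open U.
Hypothesis KU : K `<=` U.
Hypothesis fs : subharmonic U f.
Local Notation H := (@hausdorff_measure R d).

Let mK : measurable (K : set (borelC R)) := compact_borel cK.

Lemma measurable_metric_ball x r : measurable (metric_ball K x r : set (borelC R)).
Proof. by apply: measurableI => //; exact: measurable_disk. Qed.

Let mf (B : set R[i]) : B `<=` K -> measurable (B : set (borelC R)) ->
  measurable_fun (B : set (borelC R)) (f : borelC R -> \bar R) :=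
  @measurable_on_K _ _ _ _ oU KU fs B.

(** With at most one point no radius is admissible in the d-set condition; instead every ball is
    null because d > 0. *)
Lemma bmo_degenerate : (forall x y, K x -> K y -> x = y) -> bmo K H f.
Proof.
move=> Keq.
have null x r : K x -> H (metric_ball K x r) = 0.
  move=> Kx; apply/eqP; rewrite eq_le measure_ge0 andbT -(hausdorff_set1 x d0).
  by apply: le_hausdorff => y [Ky _]; exact: Keq.
have mfB x r : measurable_fun (metric_ball K x r : set (borelC R)) f.
  by apply: mf; [exact: subIsetl|exact: measurable_metric_ball].
split=> [x Kx|].
  exists 1%R => //.
  by have [] := integral_null_set (measurable_metric_ball x 1) (mfB x 1%R) (null x 1%R Kx).
apply: le_lt_trans (ltry 0); apply: ge_ereal_sup => _ [x Kx [r r0 <-]].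
by have [_ ->] := integral_null_set (measurable_metric_ball x r) (mfB x r) (null x r Kx).
Qed.

Section nondegenerate.
Variables (a b tau : R).
Hypothesis tau0 : (0 < tau)%R.
Hypothesis a0 : (0 < a)%R.
Hypothesis b0 : (0 < b)%R.
Hypothesis dsetK : forall x (t : R), K x -> (0 < t)%R -> (t <= tau)%R ->
  (b * t `^ d)%:E <= H (K `&` disk x t) <= (a * t `^ d)%:E.

Lemma bmo_nondegenerate : bmo K H f.
Proof.
have [C1 [C2 [r0 [C10 C20 /andP[r00 r0tau] osc]]]] :=
  local_oscillation d0 cK oU KU fs tau0 a0 dsetK.
have HK := hausdorff_K_lty cK tau0 a0 dsetK.
have mball x r : {m | H (metric_ball K x r) = m%:E}.
  exists (fine (H (metric_ball K x r))); rewrite fineK// ge0_fin_numE//.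
  by apply: le_lt_trans HK; apply: le_hausdorff; exact: subIsetl.
have mfB x r : measurable_fun (metric_ball K x r : set (borelC R)) f.
  by apply: mf; [exact: subIsetl|exact: measurable_metric_ball].
(* Used twice: with t = r it turns the term C1 r^d into a multiple C1/b of the measure of the ball,
   and with t = r0 it bounds the measure of every large ball below. *)
have lower x (r t m : R) : K x -> (0 < t)%R -> (t <= r)%R -> (t <= tau)%R ->
    H (metric_ball K x r) = m%:E -> (b * t `^ d <= m)%R.
  move=> Kx t0 tr tt Hm; rewrite -lee_fin -Hm; have /andP[+ _] := dsetK Kx t0 tt.
  move=> /le_trans; apply; apply: le_hausdorff => y [Ky yt]; split => //.
  exact: lt_le_trans yt tr.
have small x r : K x -> (0 < r)%R -> (r <= r0)%R ->
    H.-integrable (metric_ball K x r) f /\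
    mean_oscillation H (metric_ball K x r) f <= (2 * (C1 / b + C2))%:E.
  move=> Kx rr rr0; have [m Hm] := mball x r.
  have bm := lower x r r m Kx rr (lexx r) (le_trans rr0 r0tau) Hm.
  have rd : (0 < r `^ d)%R by exact: powR_gt0.
  have m0 : (0 < m)%R by apply: lt_le_trans bm; exact: mulr_gt0.
  have rr' : (0 < r <= r0)%R by rewrite rr.
  have [c hc] := osc x r Kx rr'.
  rewrite -[K `&` _]/(metric_ball K x r) Hm -EFinM -EFinD in hc.
  have [-> h] := mean_oscillation_le (measurable_metric_ball x r) (mfB x r) Hm m0 hc.
  split=> //; apply: le_trans h _; rewrite lee_fin -mulrA ler_pM2l//.
  rewrite mulrDl mulfK ?gt_eqF// lerD2r -mulrA ler_wpM2l//.
  by rewrite ler_pdivrMr// ler_pdivlMl.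
have intK : \int[H]_(z in K) `|f z| < +oo.
  (* The sets met in [compact_induction] are arbitrary, so a measurable superset is carried
     along. *)
  pose Q (S : set R[i]) := exists T : set (borelC R),
    [/\ measurable T, S `<=` T & \int[H]_(z in (K `&` T)) `|f z| < +oo].
  have mafT (T : set (borelC R)) : measurable T ->
      measurable_fun (K `&` T : set (borelC R)) (fun z => `|f z|).
    by move=> mT; apply: measurableT_comp => //; apply: mf;
      [exact: subIsetl|exact: measurableI].
  have : Q K.
    apply: (compact_induction cK).
    - by exists set0; split => //; rewrite setI0 integral_set0.
    - by move=> A B AB [T [mT BT h]]; exists T; split => //; exact: subset_trans BT.
    - move=> A B [T [mT AT hT]] [S [mS BS hS]]; exists (T `|` S); split.
      + exact: measurableU.
      + exact: setUSS.
      + have mD : measurable (K `&` (S `\` T) : set (borelC R)).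
          by apply: measurableI => //; exact: measurableD.
        rewrite (_ : K `&` (T `|` S) = (K `&` T) `|` (K `&` (S `\` T))); last first.
          by rewrite -setIUr setUDr setDv setD0.
        rewrite ge0_integral_setU//.
        * apply: lte_add_pinfty => //; apply: le_lt_trans hS.
          apply: ge0_subset_integral => //; [exact: measurableI|exact: mafT|].
          by apply: setIS; exact: subDsetl.
        * exact: measurableI.
        * apply: measurableT_comp => //; apply: mf; first by move=> z [[]|[]].
          by apply: measurableU => //; exact: measurableI.
        * apply/disj_setPS => z [[_ Tz] [_ [_]]]; exact.
    - move=> x Kx; exists (disk x r0); first exact: disk_nbhs.
      exists (disk x r0); split => //; first exact: measurable_disk.
      by have [/integrableP[_]] := small x r0 Kx r00 (lexx r0).
  move=> [T [mT KT]]; rewrite (_ : K `&` T = K)//; exact/setIidPl.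
have [E hE] : {E | \int[H]_(z in K) `|f z| = E%:E}.
  exists (fine (\int[H]_(z in K) `|f z|)); rewrite fineK// ge0_fin_numE//.
  exact: integral_ge0.
have E0 : (0 <= E)%R by rewrite -lee_fin -hE; exact: integral_ge0.
split=> [x Kx|]; first by exists r0 => //; have [] := small x r0 Kx r00 (lexx r0).
pose C3 := (b * r0 `^ d)%R.
have C30 : (0 < C3)%R by rewrite mulr_gt0// powR_gt0.
apply: (@le_lt_trans _ _ (Num.max (2 * (C1 / b + C2)) (2 * E / C3))%R%:E); last exact: ltry.
apply: ge_ereal_sup => _ [x Kx [r /= rr <-]].
have [rr0|/ltW rr0] := leP r r0.
  have [_ /le_trans] := small x r Kx rr rr0; apply.
  by rewrite lee_fin le_max lexx.
have [m Hm] := mball x r.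
have Cm := lower x r r0 m Kx r00 rr0 r0tau Hm.
have m0 : (0 < m)%R by exact: lt_le_trans Cm.
(* For a large ball f is compared with the constant 0. *)
have h0 : \int[H]_(z in metric_ball K x r) `|f z - 0%:E| <= E%:E.
  rewrite -hE; under eq_integral do rewrite sube0.
  apply: ge0_subset_integral => //; [exact: measurable_metric_ball| |exact: subIsetl].
  by apply: measurableT_comp => //; apply: mf.
have [_ h] := mean_oscillation_le (measurable_metric_ball x r) (mfB x r) Hm m0 h0.
apply: le_trans h _; rewrite lee_fin le_max; apply/orP; right.
by rewrite ler_wpM2l ?mulr_ge0// lef_pV2.
Qed.

End nondegenerate.
End bmo_dset.

Theorem theorem1p3 (R : realType) (d : R) (K U : set R[i]) (f : R[i] -> \bar R)
    (d_gt0 : 0 < d) (K_compact : compact K) (K_dset : d_set d K)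
    (U_open : open U) (KU : K `<=` U) (f_sub : subharmonic U f) :
  bmo K (hausdorff_measure d) f.
Proof.
(* The diameter is an extended real; a real positive tau below it serves as the limit for radii, and
   without one any two points of K coincide. *)
have [[tau [tau0 tauK]]|deg] := pselect (exists tau : R, 0 < tau /\ (tau%:E <= diam K)%E).
  have [a [b [a0 b0 dK]]] := K_dset.
  apply: (bmo_nondegenerate d_gt0 K_compact U_open KU f_sub tau0 a0 b0).
  by move=> x t Kx t0 tt; apply: dK => //; apply: le_trans tauK; rewrite lee_fin.
apply: (bmo_degenerate d_gt0 K_compact U_open KU f_sub) => x y Kx Ky.
apply: contrapT => xy; apply: deg; exists (normc (x - y)); split; last exact: diam_le.
by rewrite lt_neqAle normc_ge0 andbT eq_sym; apply: contra_notN xy => /eqP/eq0_normc/subr0_eq.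
Qed.
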